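(* Let $F:M^2\rightarrow\mathbb{H}^2(-1)\times\mathbb{R}\subset\mathbb{L}^4$ be a totally umbilical surface with shape operator $S=\lambda\,\mathrm{id}$ and angle function $\theta$, which is not totally geodesic. Then one can choose local coordinates $(u,v)$ on $M^2$ such that $\lambda$ and $\theta$ only depend on $u$ and we are in one of the following three cases: (i) $\theta(u)$ and $\lambda(u)$ are given by $$\theta(u)=\arctan\left(\frac{2ce^{\pm cu}}{1+c^2-e^{\pm 2cu}}\right),\qquad \lambda(u)=\frac{\theta'(u)}{\sin\theta(u)},$$ for some real constant $c>0$, and the immersion is, up to an isometry of $\mathbb{H}^2(-1)\times\mathbb{R}$, locally given by $$F(u,v)=\frac{1}{c}\left(\lambda,\,\sin\theta\,\cos v,\,\sin\theta\,\sin v,\,c\int\sin^2\theta\,du\right);$$ (ii) $\theta(u)$ and $\lambda(u)$ are given by $$\theta(u)=\mathrm{arccot}\,(\pm u),\qquad \lambda(u)=\frac{\mp 1}{\sqrt{1+u^2}},$$ and the immersion is, up to an isometry of $\mathbb{H}^2(-1)\times\mathbb{R}$, locally given by $$F(u,v)=\frac{1}{\sqrt{1+u^2}}\left(\frac{u^2+v^2}{2}+1,\,v,\,\frac{u^2+v^2}{2},\,\sqrt{1+u^2}\,\arctan u\right);$$ (iii) $\theta(u)$ and $\lambda(u)$ are given by $$\theta(u)=\arctan\left(\frac{\tan c}{\sin(\pm u\sin c)}\right),\qquad \lambda(u)=\frac{\theta'(u)}{\sin\theta(u)},$$ for some real constant $c\neq0$ (with $\sin c\neq 0$ and $\cos c\neq0$,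 so that the formulas are meaningful), and the immersion is, up to an isometry of $\mathbb{H}^2(-1)\times\mathbb{R}$, locally given by $$F(u,v)=\frac{1}{\sin c}\left(\sin\theta\,\cosh v,\,\sin\theta\,\sinh v,\,\lambda,\,\sin c\int\sin^2\theta\,du\right).$$ In each case the signs $\pm$, $\mp$ are chosen consistently.
   Context: $\mathbb{L}^4=\mathbb{E}^4_1$ is $\mathbb{R}^4$ with the Lorentzian metric $-dx_1^2+dx_2^2+dx_3^2+dx_4^2$, and $\mathbb{H}^2(-1)\times\mathbb{R}=\{(x_1,x_2,x_3,x_4)\in\mathbb{L}^4 \mid -x_1^2+x_2^2+x_3^2=-1,\ x_1>0\}$ with the induced (Riemannian product) metric; in explicit formulas for immersions, ''up to an isometry'' includes, if necessary, changing the sign of some of the components. Let $e_3=(0,0,0,1)$ be the unit vector field tangent to the $\mathbb{R}$-factor. $F$ is an isometric immersion of an oriented surface $M^2$; $\xi$ denotes a unit normal along $M^2$, tangent to $\mathbb{H}^2(-1)\times\mathbb{R}$; $S$ is the associated shape operator, $SX=-\widetilde{\nabla}_X\xi$ with $\widetilde{\nabla}$ the Levi Civita connection of $\mathbb{H}^2(-1)\times\mathbb{R}$. The angle function $\theta$ is the angle between $e_3$ and $\xi$; working locally, one may assume $\theta\in[0,\frac{\pi}{2}]$ (by choice of $\xi$). The surface is totally umbilical if $S=\lambda\,\mathrm{id}$ at every point, for a function $\lambda$ on $M^2$; it is totally geodesic if moreover $\lambda\equiv0$. The symbol $\int\sin^2\theta\,du$ denotes an antiderivative of $\sin^2\theta(u)$.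 *)

(* Defs.v *)
From HB Require Import structures.
From mathcomp Require Import all_boot all_order all_algebra.
From mathcomp Require Import all_classical all_reals all_analysis.
Set Implicit Arguments.
Unset Strict Implicit.
Unset Printing Implicit Defensive.
Import Order.TTheory GRing.Theory Num.Theory.
Import numFieldNormedType.Exports.
Local Open Scope classical_set_scope.
Local Open Scope ring_scope.

Section Smoothness.
Context {R : realType} {m n : nat}.
Implicit Types (U : set 'rV[R]_m.+1) (f : 'rV[R]_m.+1 -> 'rV[R]_n.+1).

(* f is of class C^k on U; only meant for U open, where it depends on the
   values of f on U only. *)
Fixpoint class_C (k : nat) U f : Prop :=
  match k with
  | 0 => forall y, U y -> {for y, continuous f}
  | k'.+1 => forall i : 'I_m.+1,
      (forall y, U y -> derivable f y (delta_mx 0 i)) /\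
      class_C k' U (fun y => 'D_(delta_mx 0 i) f y)
  end.

Definition smooth U f := forall k, class_C k U f.

End Smoothness.

Section Surface.
Context {R : realType}.

(* chart_fun is only meaningful on chart_dom, chart_inv only on chart_cod. *)
Record chart (M : topologicalType) := Chart {
  chart_dom : set M;
  chart_cod : set 'rV[R]_2;
  chart_fun : M -> 'rV[R]_2;
  chart_inv : 'rV[R]_2 -> M
}.

Context {M : topologicalType}.
Implicit Types (x y : chart M) (A : set (chart M)).

Definition is_chart x : Prop :=
  [/\ open (chart_dom x) /\ open (chart_cod x),
      forall p, chart_dom x p ->
        chart_cod x (chart_fun x p) /\ chart_inv x (chart_fun x p) = p,
      forall w, chart_cod x w ->
        chart_dom x (chart_inv x w) /\ chart_fun x (chart_inv x w) = w,
      forall p, chart_dom x p -> {for p, continuous (chart_fun x)} &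
      forall w, chart_cod x w -> {for w, continuous (chart_inv x)}].

Definition smooth_transition x y : Prop :=
  smooth [set w | chart_cod x w /\ chart_dom y (chart_inv x w)]
         (chart_fun y \o chart_inv x).

Definition compatible x y : Prop :=
  smooth_transition x y /\ smooth_transition y x.

(* A is an atlas, not necessarily maximal, of a smooth surface structure. *)
Definition smooth_surface A : Prop :=
  [/\ hausdorff_space M, @second_countable M,
      forall x, A x -> is_chart x,
      forall p, exists2 x, A x & chart_dom x p &
      forall x y, A x -> A y -> compatible x y].

Definition local_coordinates A x : Prop :=
  is_chart x /\ forall y, A y -> compatible x y.

Definition smooth_map A n (f : M -> 'rV[R]_n.+1) : Prop :=
  forall x, A x -> smooth (chart_cod x) (f \o chart_inv x).

End Surface.
Arguments chart R M : clear implicits.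

Section H2R.
Context {R : realType}.
Implicit Types (p v w : 'rV[R]_4).

(* The coordinates x_1, ..., x_4 have the indices 0, ..., 3. *)
Definition i1 : 'I_4 := @Ordinal 4 0 isT.
Definition i2 : 'I_4 := @Ordinal 4 1 isT.
Definition i3 : 'I_4 := @Ordinal 4 2 isT.
Definition i4 : 'I_4 := @Ordinal 4 3 isT.

Definition vec4 (a b c d : R) : 'rV[R]_4 := \row_j [:: a; b; c; d]`_j.

Definition vec2 (u v : R) : 'rV[R]_2 := \row_j [:: u; v]`_j.

Definition lorentz v w : R :=
  - (v 0 i1 * w 0 i1) + v 0 i2 * w 0 i2 + v 0 i3 * w 0 i3 + v 0 i4 * w 0 i4.

Definition e3 : 'rV[R]_4 := vec4 0 0 0 1.

Definition H2R : set 'rV[R]_4 :=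
  [set p | - p 0 i1 ^+ 2 + p 0 i2 ^+ 2 + p 0 i3 ^+ 2 = -1 /\ 0 < p 0 i1].

(* The unit timelike normal of H^2(-1) x R in L^4 at p. *)
Definition H2R_normal p : 'rV[R]_4 := vec4 (p 0 i1) (p 0 i2) (p 0 i3) 0.

Definition H2R_tangent p v : Prop := lorentz (H2R_normal p) v = 0.

(* Orthogonal projection of L^4 onto T_p(H^2(-1) x R); the sign is due to
   lorentz (H2R_normal p) (H2R_normal p) = -1. *)
Definition H2R_proj p v : 'rV[R]_4 :=
  v + lorentz (H2R_normal p) v *: H2R_normal p.

(* H^2(-1) x R is a closed submanifold of R^4, hence each of its smooth
   self-maps is the restriction of a smooth self-map of R^4. Nothing is
   required of Phi off H^2(-1) x R besides smoothness. *)
Definition H2R_isometry (Phi : 'rV[R]_4 -> 'rV[R]_4) : Prop :=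
  smooth setT Phi /\
  (exists Psi : 'rV[R]_4 -> 'rV[R]_4,
     smooth setT Psi /\
     forall p, H2R p -> [/\ H2R (Phi p), H2R (Psi p),
                           Psi (Phi p) = p & Phi (Psi p) = p]) /\
  (forall p v w, H2R p -> H2R_tangent p v -> H2R_tangent p w ->
     lorentz ('D_v Phi p) ('D_w Phi p) = lorentz v w).

Definition change_signs (s : 'I_4 -> bool) p : 'rV[R]_4 :=
  \row_j ((-1) ^+ s j * p 0 j).

End H2R.

Section SurfacesInH2R.
Context {R : realType} {M : topologicalType}.
Context (A : set (chart R M)) (F xi : M -> 'rV[R]_4) (lambda : M -> R).

(* The differential of f at chart_inv x w, applied to the tangent vector with
   components X in the coordinates x. *)
Definition tangent_map (f : M -> 'rV[R]_4) (x : chart R M)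
    (w X : 'rV[R]_2) : 'rV[R]_4 :=
  'D_X (f \o chart_inv x) w.

(* M is given the metric induced by F, so that F is isometric. *)
Definition isometric_immersion : Prop :=
  [/\ forall p, H2R (F p),
      smooth_map A F &
      forall x w X, A x -> chart_cod x w ->
        tangent_map F x w X = 0 -> X = 0].

Definition unit_normal : Prop :=
  smooth_map A xi /\
  (forall p, H2R_tangent (F p) (xi p) /\ lorentz (xi p) (xi p) = 1) /\
  (forall x w X, A x -> chart_cod x w ->
     lorentz (xi (chart_inv x w)) (tangent_map F x w X) = 0).

(* The derivative of the field xi along F in the direction X for the Levi
   Civita connection of H^2(-1) x R, which is the tangential part of the flat
   connection of L^4. *)
Definition nabla_xi (x : chart R M) (w X : 'rV[R]_2) : 'rV[R]_4 :=
  H2R_proj (F (chart_inv x w)) (tangent_map xi x w X).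

(* S X = Y at chart_inv x w, where X and Y are components of tangent vectors
   in the coordinates x. *)
Definition shape_operator (x : chart R M) (w X Y : 'rV[R]_2) : Prop :=
  tangent_map F x w Y = - nabla_xi x w X.

Definition totally_umbilical : Prop :=
  forall x w X, A x -> chart_cod x w ->
    shape_operator x w X (lambda (chart_inv x w) *: X).

Definition angle (p : M) : R := acos (lorentz e3 (xi p)).

(* There are local coordinates (u, v) around p, ranging over ]a, b[ x ]c, d[,
   in which the angle function is th(u), lambda is la(u), and F is G(u, v) up
   to sign changes of components and an isometry. The sign changes have to
   bring G into H^2(-1) x R, as isometries are only meaningful there. *)
Definition locally_given (p : M) (a b : R) (th la : R -> R)
    (G : R -> R -> 'rV[R]_4) : Prop :=
  exists x : chart R M,
    [/\ local_coordinates A x, chart_dom x p &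
      exists c d : R,
        chart_cod x = [set w | a < w 0 0 < b /\ c < w 0 1 < d] /\
        exists (s : 'I_4 -> bool) (Phi : 'rV[R]_4 -> 'rV[R]_4),
          H2R_isometry Phi /\
          forall u v, a < u < b -> c < v < d ->
            let q := chart_inv x (vec2 u v) in
            [/\ angle q = th u, lambda q = la u,
                H2R (change_signs s (G u v)) &
                F q = Phi (change_signs s (G u v))]].

End SurfacesInH2R.

Section Formulas.
Context {R : realType}.

Definition acot (t : R) : R := pi / 2 - atan t.
Definition cosh (t : R) : R := (expR t + expR (- t)) / 2.
Definition sinh (t : R) : R := (expR t - expR (- t)) / 2.

Definition is_sign (e : R) : Prop := e = 1 \/ e = -1.

(* h is an antiderivative of (sin th)^2 on ]a, b[ *)
Definition antiderivative_sin2 (th : R -> R) (a b : R) (h : R -> R) : Prop :=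
  forall u, a < u < b -> is_derive u 1 h (sin (th u) ^+ 2).

(* e is the sign written \pm; note that \mp is then - e. *)
Definition theta_i (c e u : R) : R :=
  atan (2 * c * expR (e * c * u) / (1 + c ^+ 2 - expR (e * 2 * c * u))).
Definition theta_ii (e u : R) : R := acot (e * u).
Definition theta_iii (c e u : R) : R := atan (tan c / sin (e * u * sin c)).

Definition lambda_of (th : R -> R) (u : R) : R := derive1 th u / sin (th u).
Definition lambda_ii (e u : R) : R := - e / Num.sqrt (1 + u ^+ 2).

End Formulas.

(* Main.v *)
(* Let N be the component of F in L^3, h the height of F and nu = cos theta.
   Umbilicity reads d xi = - lambda dF - nu dh N, whence d nu = - lambda dh, and
   the symmetry of second derivatives (Codazzi) gives d lambda = nu dh. Therefore
   the L^3-component of xi + lambda F is a constant vector P, and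
     lambda = - <P, N>,   lambda^2 + nu^2 = 1 - <P, P>,   h = h0 + atan (lambda / nu);
   moreover nu never vanishes, since at a zero of nu, a minimum, dh would vanish
   as well, and dF would be confined to the line orthogonal to N and xi in L^3.
   The cases (i), (ii), (iii) are those of P timelike, lightlike and spacelike. In a
   Lorentz frame adapted to P, one coordinate of F is a multiple of lambda, the
   others are given by nu and an angle v; u is the function of lambda and nu which
   the formula for theta prescribes. By the inverse function theorem (u, v) are
   local coordinates: a tangent vector killed by du and dv is killed by dh, hence
   by d lambda and d nu, and hence by dF. *)

Require Import Defs.
From HB Require Import structures.
From mathcomp Require Import all_boot all_order all_algebra.
From mathcomp Require Import all_classical all_reals all_analysis.
From mathcomp Require Import ring lra.
Import Order.TTheory GRing.Theory Num.Theory.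
Import numFieldNormedType.Exports.
Set Implicit Arguments.
Unset Strict Implicit.
Unset Printing Implicit Defensive.
Local Open Scope classical_set_scope.
Local Open Scope ring_scope.

(** * Calculus on the plane *)

(** Only [F] and [xi] are smooth by assumption; [lambda] is an arbitrary function. Its
    differentiability is read off from the umbilicity equation, and its smoothness afterwards from
    [lambda] = - <P, N>, which is linear in [F]. The equations for d lambda and d nu say that the
    vector (nu, lambda) turns by the angle t when the height grows by t; hence the arctangent, and
    the antiderivative of sin^2 theta is this height expressed in u. The constants come from <P, P>,
    which is - c^2 in case (i) and sin^2 c in case (iii). Since M is connected, P is the same for
    the whole surface, and so are the case, c and the sign; only u, v and the isometry are chosen
    anew near each point. The obstacle is a point with theta = 0. In case (i) u escapes to infinity
    there, so that the charts avoid such points, whose complement is shown to be dense; in the other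
    cases nu < 1 holds by itself. Finally, [class_C] speaks of partial derivatives only, and genuine
    differentiability has to be recovered before the chain rule and the inverse function theorem
    apply. *)

Section Differentiability.
Context {R : realType}.

(** A candidate differential is verified here by an explicit estimate, which keeps the Landau
    notation out of later proofs of differentiability. *)
Lemma differentiable_eps (V W : normedModType R) (f : V -> W)
    (df : {linear V -> W}) x : continuous df ->
  (forall e, 0 < e ->
     \forall h \near 0, `|f (h + x) - f x - df h| <= e * `|h|) ->
  differentiable f x /\ 'd f x = df :> (V -> W).
Proof.
move=> dfc dfe.
have fE : f \o shift x = cst (f x) + df +o_ 0 id.
  apply/eqaddoP => e e0; move: (dfe e e0); apply: filterS => h.
  by rewrite /= /cst opprD addrA.
have dE := diff_unique dfc fE; split=> //.
by apply/diff_locallyP; rewrite dE; split.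
Qed.

Lemma near_eq_differentiable (V W : normedModType R) (f g : V -> W) x :
  {near x, f =1 g} -> differentiable f x -> differentiable g x.
Proof.
move=> fg df; have fgx : f x = g x by apply: nbhs_singleton fg.
have [dc /eqaddoP de] := (diff_locallyP x f).1 df.
apply: (proj1 (@differentiable_eps V W g ('d f x) x dc _)).
move=> e e0; have := fg; rewrite (near_shift 0 x) /= => fg0.
apply: filterS2 fg0 (de e e0) => h.
by rewrite /= subr0 => <-; rewrite -fgx /cst opprD addrA.
Qed.

Lemma derive_scale (V W : normedModType R) (f : V -> W) x v (a : R) :
  differentiable f x -> 'D_(a *: v) f x = a *: 'D_v f x.
Proof. by move=> df; rewrite !deriveE // linearZ. Qed.

Lemma derive_chain (V : normedModType R) (phi : R -> R) (g : V -> R) x v d :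
  differentiable g x -> is_derive (g x) 1 phi d ->
  differentiable (phi \o g) x /\ 'D_v (phi \o g) x = d * 'D_v g x.
Proof.
move=> dg [/derivable1_diffP dphi <-].
have dc : differentiable (phi \o g) x by exact: differentiable_comp.
split=> //; rewrite deriveE // diff_comp //= diff1E // -deriveE //.
by rewrite derive1E mulrC.
Qed.

Lemma derive_rV2 (W : normedModType R) (f : 'rV[R]_2 -> W) x v :
  differentiable f x ->
  'D_v f x = v 0 0 *: 'D_(delta_mx 0 0) f x + v 0 1 *: 'D_(delta_mx 0 1) f x.
Proof.
move=> df; rewrite !deriveE // -!linearZ -linearD; congr ('d f x _).
by apply/rowP => i; rewrite !mxE /=; case: i => [[|[|//]] hi] /=;
  rewrite ?mulr1 ?mulr0 ?addr0 ?add0r; congr (v _ _); apply/val_inj.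
Qed.

Lemma differentiable_mxP (V : normedModType R) n (f : V -> 'rV[R]_n.+1) x :
  (forall j, differentiable (fun y => f y 0 j) x) -> differentiable f x.
Proof.
move=> df.
have -> : f = \sum_(j < n.+1) (fun y => f y 0 j *: delta_mx 0 j).
  apply/funext => y; rewrite fct_sumE [LHS]matrix_sum_delta.
  by rewrite big_ord1.
apply: differentiable_sum => j; exact: differentiableZl.
Qed.

Lemma differentiable_coordf (V : normedModType R) n (f : V -> 'rV[R]_n.+1) x j :
  differentiable f x -> differentiable (fun y => f y 0 j) x.
Proof.
move=> df.
apply: (@differentiable_comp _ _ _ _ f (fun N : 'rV[R]_n.+1 => N 0 j)) => //.
exact: differentiable_coord.
Qed.

Lemma derive_coordf (V : normedModType R) n (f : V -> 'rV[R]_n.+1) x v j :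
  derivable f x v -> ('D_v f x) 0 j = 'D_v (fun y => f y 0 j) x.
Proof. by move=> df; rewrite derive_mx // mxE. Qed.

Lemma continuous_rV (T : topologicalType) n (f : T -> 'rV[R]_n.+1) x :
  (forall j, {for x, continuous (fun y => f y 0 j)}) -> {for x, continuous f}.
Proof.
move=> fc; apply/cvgrPdist_lt => /= e e0; near=> y.
rewrite /Num.Def.normr/= mx_normrE (bigmax_lt _ e0)//= => -[i j] _.
rewrite !mxE/= ord1.
move: j; near: y; apply: filter_forall => /= j.
by have /cvgrPdist_lt := fc j; apply.
Unshelve. all: by end_near. Qed.

End Differentiability.

(** * Scalar functions of class C^k and their closure properties *)

Section ScalarCalculus.
Context {R : realType}.
Implicit Types (U W : set 'rV[R]_2) (f g : 'rV[R]_2 -> R) (w X : 'rV[R]_2).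

(* Unlike class_C, this asks for differentiability at every order and not only
   for partial derivatives, so that it is visibly stable under composition. *)
Fixpoint Ck k U g : Prop :=
  match k with
  | 0 => forall w, U w -> {for w, continuous g}
  | k'.+1 => (forall w, U w -> differentiable g w) /\
             forall i : 'I_2, Ck k' U (fun w => 'D_(delta_mx 0 i) g w)
  end.

Definition Csmooth U g := forall k, Ck k U g.

Lemma Ck_continuous k U g w : Ck k U g -> U w -> {for w, continuous g}.
Proof.
case: k => [|k] /=; first by move=> h /h.
by move=> [h _] /h/differentiable_continuous.
Qed.

Lemma Ck_lower k U g : Ck k.+1 U g -> Ck k U g.
Proof.
elim: k g => [|k IH] g h; first by move=> w; apply: Ck_continuous h.
by case: h => d h; split => // i; apply: IH.
Qed.

Lemma Ck_sub k U W g : W `<=` U -> Ck k U g -> Ck k W g.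
Proof.
move=> WU; elim: k g => [|k IH] g /=; first by move=> h w /WU; exact: h.
by move=> [d h]; split => [w /WU|i]; [exact: d|exact: IH].
Qed.

Lemma near_open (T : topologicalType) (U : set T) (P : T -> Prop) (w : T) :
  open U -> U w -> (forall x, U x -> P x) -> \forall x \near w, P x.
Proof. by move=> oU Uw h; apply: filterS (open_nbhs_nbhs (conj oU Uw)). Qed.

Lemma Ck_ext k U f g : open U -> (forall w, U w -> f w = g w) ->
  Ck k U f -> Ck k U g.
Proof.
move=> oU; elim: k f g => [|k IH] f g fg /=.
  move=> h w Uw; have cf := h w Uw; rewrite /prop_for /continuous_at -fg //.
  have E : {near w, f =1 g} by exact: (near_open oU).
  by apply: cvg_trans cf; exact: (near_eq_cvg E).
move=> [d h]; split => [w Uw|i].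
  apply: near_eq_differentiable (d _ Uw).
  exact: (near_open oU).
apply: IH (h i) => w Uw; apply: near_eq_derive.
exact: (near_open oU).
Qed.

Lemma Ck_cst k U (c : R) : Ck k U (fun=> c).
Proof.
elim: k c => [|k IH] c /=; first by move=> w _; exact: cst_continuous.
split=> [w _|i]; first exact: differentiable_cst.
rewrite (_ : 'D_(delta_mx 0 i) _ = fun=> 0) //.
by apply/funext => w; rewrite derive_cst.
Qed.

Lemma Ck_add k U f g : open U -> Ck k U f -> Ck k U g ->
  Ck k U (fun w => f w + g w).
Proof.
move=> oU; elim: k f g => [|k IH] f g /=.
  by move=> hf hg w Uw; exact: (continuousD (hf w Uw) (hg w Uw)).
move=> [df hf] [dg hg]; split=> [w Uw|i].
  by apply: differentiableD; [exact: df|exact: dg].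
apply: Ck_ext (IH _ _ (hf i) (hg i)) => // w Uw.
by rewrite -deriveD //; apply: diff_derivable; [exact: df|exact: dg].
Qed.

Lemma Ck_mul k U f g : open U -> Ck k U f -> Ck k U g ->
  Ck k U (fun w => f w * g w).
Proof.
move=> oU; elim: k f g => [|k IH] f g.
  by move=> hf hg w Uw; exact: (continuousM (hf w Uw) (hg w Uw)).
move=> Hf Hg; have [df hf] := Hf; have [dg hg] := Hg; split=> [w Uw|i].
  by apply: differentiableM; [exact: df|exact: dg].
have h := Ck_add oU (IH _ _ (Ck_lower Hf) (hg i)) (IH _ _ (Ck_lower Hg) (hf i)).
apply: Ck_ext h => // w Uw.
rewrite deriveM //; apply: diff_derivable; [exact: df|exact: dg].
Qed.

Lemma Ck_sum k U n (f : 'I_n -> 'rV[R]_2 -> R) : open U ->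
  (forall i, Ck k U (f i)) -> Ck k U (fun w => \sum_i f i w).
Proof.
move=> oU; elim: n f => [|n IH] f h.
  by apply: Ck_ext (@Ck_cst k U 0) => // w _; rewrite big_ord0.
have h1 := Ck_add oU (IH (fun i => f (widen_ord (leqnSn n) i)) (fun i => h _))
  (h ord_max).
by apply: Ck_ext h1 => // w _; rewrite big_ord_recr.
Qed.

(** The derivative [dphi] is prescribed only at values of [g], which admits functions such as the
    inverse and the logarithm. Its composite with [g] has to be smooth to one order less; this
    closes the induction for the inverse. *)
Lemma Ck_comp1 k U g (phi dphi : R -> R) : open U ->
  (forall w, U w -> is_derive (g w) 1 phi (dphi (g w))) ->
  Ck k.+1 U g -> Ck k U (fun w => dphi (g w)) ->
  Ck k.+1 U (fun w => phi (g w)).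
Proof.
move=> oU hphi [dg hg] hd; split=> [w Uw|i].
  exact: (derive_chain 0 (dg w Uw) (hphi w Uw)).1.
apply: Ck_ext (Ck_mul oU hd (hg i)) => // w Uw.
by rewrite (derive_chain _ (dg w Uw) (hphi w Uw)).2.
Qed.

Lemma Ck_inv k U g : open U -> (forall w, U w -> g w != 0) ->
  Ck k U g -> Ck k U (fun w => (g w)^-1).
Proof.
move=> oU g0; elim: k => [|k IH] h.
  by move=> w Uw; exact: (continuousV (g0 w Uw) (h w Uw)).
(* The derivative of the inverse is written as a product of inverses, so that its smoothness at
   order [k] is the induction hypothesis for the same [g]. *)
apply: (@Ck_comp1 k U g _ (fun x => - 1 * (x^-1 * x^-1))) => // [w Uw|].
  have := @is_deriveV R id (g w) 1 1 (g0 w Uw) (is_derive_id _ _).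
  by move/is_derive_eq; apply; rewrite /GRing.scale /= mulr1 expr2 invfM mulN1r.
have hI := IH (Ck_lower h).
by apply: Ck_mul => //; [exact: Ck_cst|exact: Ck_mul].
Qed.

Lemma Ck_ln k U g : open U -> (forall w, U w -> 0 < g w) ->
  Ck k U g -> Ck k U (fun w => ln (g w)).
Proof.
move=> oU g0 h.
have lg w : U w -> is_derive (g w) 1 (@ln R) (g w)^-1.
  by move=> Uw; apply: is_derive1_ln; exact: g0.
case: k h => [|k] h.
  move=> w Uw; apply: (@continuous_comp _ _ _ g (@ln R)); first exact: h.
  by apply/differentiable_continuous/derivable1_diffP; case: (lg w Uw).
apply: (@Ck_comp1 k U g _ (fun x => x^-1)) => //.
by apply: Ck_inv => // [w /g0/gt_eqF->|] //; exact: Ck_lower.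
Qed.

Lemma Ck_atan k U g : open U -> Ck k U g -> Ck k U (fun w => atan (g w)).
Proof.
move=> oU; case: k => [|k] h.
  move=> w Uw; apply: (@continuous_comp _ _ _ g (@atan R)); first exact: h.
  exact: continuous_atan.
apply: (@Ck_comp1 k U g _ (fun x => (1 + x * x)^-1)) => //.
apply: Ck_inv => // [w _|]; first by rewrite gt_eqF // ltr_pwDl // -expr2 sqr_ge0.
by apply: Ck_add => //; [exact: Ck_cst|apply: Ck_mul => //; exact: Ck_lower].
Qed.

Lemma derive_comp_rV2 (W : normedModType R) (g : 'rV[R]_2 -> W)
    (phi : 'rV[R]_2 -> 'rV[R]_2) w v :
  differentiable phi w -> differentiable g (phi w) ->
  differentiable (g \o phi) w /\
  'D_v (g \o phi) w = \sum_j 'D_v (fun y => phi y 0 j) w *: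
                               'D_(delta_mx 0 j) g (phi w).
Proof.
move=> dphi dg; have dc : differentiable (g \o phi) w.
  exact: differentiable_comp.
split=> //; rewrite deriveE // diff_comp //= -deriveE // -deriveE //.
rewrite derive_rV2 // big_ord_recl big_ord1.
rewrite -!(derive_coordf _ (diff_derivable dphi)).
by congr (_ + 'D_v phi w 0 _ *: 'D_(delta_mx 0 _) g _); apply/val_inj.
Qed.

(** By the chain rule a partial derivative of the composite is a sum of products of derivatives of
    [phi] with partial derivatives of [g] composed with [phi]; hence the induction over all [g]. *)
Lemma Ck_comp k U W (phi : 'rV[R]_2 -> 'rV[R]_2) g : open W ->
  (forall w, W w -> U (phi w)) ->
  (forall j, Ck k W (fun w => phi w 0 j)) -> Ck k U g ->
  Ck k W (fun w => g (phi w)).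
Proof.
move=> oW WU; elim: k g => [|k IH] g hphi.
  move=> hg w Ww; apply: (@continuous_comp _ _ _ phi g); last exact/hg/WU.
  by apply: continuous_rV => j; exact: hphi.
move=> [dg hg].
have dphi w : W w -> differentiable phi w.
  by move=> Ww; apply: differentiable_mxP => j; exact: (hphi j).1.
split=> [w Ww|i].
  by have [] := derive_comp_rV2 0 (dphi w Ww) (dg _ (WU _ Ww)).
have := Ck_sum oW (fun j => Ck_mul oW ((hphi j).2 i)
   (IH _ (fun j => Ck_lower (hphi j)) (hg j))).
apply: Ck_ext => // w Ww.
by have [_ ->] := derive_comp_rV2 (delta_mx 0 i) (dphi w Ww) (dg _ (WU _ Ww)).
Qed.

End ScalarCalculus.

(** * Mean value arguments in the plane *)

Section MeanValue.
Context {R : realType}.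

Lemma continuous_ball (V W : normedModType R) (g : V -> W) w (e : R) :
  {for w, continuous g} -> 0 < e ->
  exists2 d : R, 0 < d & forall y, `|y - w| < d -> `|g y - g w| <= e.
Proof.
move=> /cvgrPdist_le cg e0; have [d /= d0 Hd] := (nbhs_ballP _ _).1 (cg e e0).
exists d => // y yd; rewrite distrC; apply: Hd.
by rewrite -ball_normE /= distrC.
Qed.

Lemma open_ball (V : normedModType R) (U : set V) w : open U -> U w ->
  exists2 d : R, 0 < d & forall y, `|y - w| < d -> U y.
Proof.
move=> oU Uw; have [d /= d0 Hd] := (nbhs_ballP _ _).1 (open_nbhs_nbhs (conj oU Uw)).
by exists d => // y yd; apply: Hd; rewrite -ball_normE /= distrC.
Qed.

Lemma differentiable_ball (V W : normedModType R) (f : V -> W) x (e : R) :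
  differentiable f x -> 0 < e -> exists2 d : R, 0 < d &
  forall h, `|h| < d -> `|f (h + x) - f x - 'D_h f x| <= e * `|h|.
Proof.
move=> df e0; have [dc /eqaddoP de] := (diff_locallyP x f).1 df.
have [d /= d0 Hd] := (nbhs_ballP _ _).1 (de e e0).
exists d => // h hd; rewrite deriveE //.
have := Hd h; rewrite -ball_normE /= sub0r normrN => /(_ hd).
by rewrite /cst; congr (`|_| <= _); rewrite -addrA -opprD.
Qed.

Lemma is_derive_line (V W : normedModType R) (g : V -> W) x v t :
  derivable g (x + t *: v) v ->
  is_derive t 1 (fun s : R => g (x + s *: v)) ('D_v g (x + t *: v)).
Proof.
have E : (fun h : R => h^-1 *: (((fun s : R => g (x + s *: v)) \o shift t) (h *: (1 : R))
                       - g (x + t *: v))) =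
         (fun h : R => h^-1 *: ((g \o shift (x + t *: v)) (h *: v) - g (x + t *: v))).
  apply/funext => h /=; congr (_ *: (g _ - _)).
  by rewrite [h *: 1]mulr1 scalerDl addrCA.
move=> dg; split; last by rewrite /derive /= E.
by rewrite /derivable /= E.
Qed.

Lemma is_derive_shift_arg (V W : normedModType R) (g : V -> W) x c v :
  derivable g (x + c) v -> is_derive x v (fun y => g (y + c)) ('D_v g (x + c)).
Proof.
have E : (fun h : R => h^-1 *: (((fun y => g (y + c)) \o shift x) (h *: v) - g (x + c))) =
         (fun h : R => h^-1 *: ((g \o shift (x + c)) (h *: v) - g (x + c))).
  by apply/funext => h /=; rewrite addrA.
move=> dg; split; last by rewrite /derive /= E.
by rewrite /derivable /= E.
Qed.

(** The number [a] may have either sign, whence the two cases. Of the intermediate point only |c| <=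
    |a| is recorded, which is enough to keep it in a ball. *)
Lemma mvt_dir (V : normedModType R) (g : V -> R) x v (a : R) :
  (forall t : R, `|t| <= `|a| -> derivable g (x + t *: v) v) ->
  exists2 c : R, `|c| <= `|a| & g (x + a *: v) - g x = a * 'D_v g (x + c *: v).
Proof.
move=> dg.
have dl (t : R) : `|t| <= `|a| -> is_derive t 1 (fun s : R => g (x + s *: v))
    ('D_v g (x + t *: v)) by move=> /dg; exact: is_derive_line.
have [a0|/ltW a0] := leP 0 a.
  have [|||c cin E] := @MVT_segment R (fun s : R => g (x + s *: v))
     (fun t => 'D_v g (x + t *: v)) 0 a.
  - by [].
  - move=> t /[!in_itv]/= /andP[t0 ta]; apply: dl.
    by rewrite !ger0_norm // ltW.
  - apply: derivable_within_continuous => t /[!in_itv]/= /andP[t0 ta].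
    by apply: ex_derive; apply: dl; rewrite !ger0_norm // (le_trans t0).
  move: cin; rewrite in_itv /= => /andP[c0 ca].
  exists c; first by rewrite !ger0_norm.
  by move: E; rewrite scale0r addr0 subr0 mulrC.
have [|||c cin E] := @MVT_segment R (fun s : R => g (x + s *: v))
     (fun t => 'D_v g (x + t *: v)) a 0.
- by [].
- move=> t /[!in_itv]/= /andP[t0 ta]; apply: dl.
  by rewrite !ler0_norm ?lerN2 // ltW.
- apply: derivable_within_continuous => t /[!in_itv]/= /andP[t0 ta].
  by apply: ex_derive; apply: dl; rewrite !ler0_norm // lerN2.
move: cin; rewrite in_itv /= => /andP[ac c0].
exists c; first by rewrite !ler0_norm // lerN2.
by move: E; rewrite scale0r addr0 sub0r mulrN => /eqP; rewrite -eqr_oppLR opprB mulrC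
  => /eqP ->.
Qed.

Lemma rV2_norm_le (x : 'rV[R]_2) (e : R) :
  `|x 0 0| <= e -> `|x 0 1| <= e -> `|x| <= e.
Proof.
move=> h0 h1; rewrite /Num.Def.normr/= mx_normrE.
apply: bigmax_le => /=; first exact: le_trans h0.
move=> [i [[|[|//]] hj]] _ /=; rewrite ord1.
  by move: h0; congr (`|x 0 _| <= _); exact/val_inj.
by move: h1; congr (`|x 0 _| <= _); exact/val_inj.
Qed.

Lemma rV_coord_le n (x : 'rV[R]_n) j : `|x 0 j| <= `|x|.
Proof.
rewrite [leRHS]/Num.Def.normr/= mx_normrE.
exact: (le_bigmax _ (fun ij : 'I_1 * 'I_n => `|x ij.1 ij.2|) (0, j)).
Qed.

Lemma rV2_decomp (x : 'rV[R]_2) :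
  x = x 0 0 *: delta_mx 0 0 + x 0 1 *: delta_mx 0 1.
Proof.
apply/rowP => i; rewrite !mxE /=; case: i => [[|[|//]] hi] /=;
  rewrite ?mulr1 ?mulr0 ?addr0 ?add0r; congr (x _ _); exact/val_inj.
Qed.

Lemma linear_form_rV2 (a b : R) : exists2 L : {linear 'rV[R]_2 -> R},
  continuous L & forall h, L h = h 0 0 * a + h 0 1 * b.
Proof.
pose df (h : 'rV[R]_2) : R := h 0 0 * a + h 0 1 * b.
have lin : linear df.
  by move=> c u v; rewrite /df !mxE /GRing.scale /=; ring.
pose dfl : {linear 'rV[R]_2 -> R} :=
  HB.pack df (GRing.isLinear.Build _ _ _ _ _ lin).
exists dfl => // y; apply: (@continuousD _ _ _ (fun h : 'rV[R]_2 => h 0 0 * _)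
    (fun h : 'rV[R]_2 => h 0 1 * _)); apply: continuousM;
  by [exact: coord_continuous|exact: cst_continuous].
Qed.

(** The increment is split into two legs parallel to the axes. The mean value theorem turns each leg
    into a partial derivative at a nearby point, and continuity at [w] compares it with the partial
    derivative at [w]. *)
Lemma C1_differentiable (g : 'rV[R]_2 -> R) (U : set 'rV[R]_2) w :
  open U -> U w ->
  (forall i y, U y -> derivable g y (delta_mx 0 i)) ->
  (forall i, {for w, continuous (fun y => 'D_(delta_mx 0 i) g y)}) ->
  differentiable g w.
Proof.
move=> oU Uw dg cg.
have [dfl dfc dfE] := linear_form_rV2 ('D_(delta_mx 0 0) g w) ('D_(delta_mx 0 1) g w).
apply: (proj1 (@differentiable_eps _ _ _ g dfl w dfc _)) => e e0.
have e20 : 0 < e / 2 by rewrite divr_gt0.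
have near_w : \forall y \near w, U y /\ forall i,
    `|'D_(delta_mx 0 i) g w - 'D_(delta_mx 0 i) g y| <= e / 2.
  near=> y; split; first by near: y; exact: (near_open oU).
  move=> i; move: i; near: y; apply: filter_forall => i.
  by have /cvgrPdist_le := cg i; apply.
have [d /= d0 Hd] := (nbhs_ballP _ _).1 near_w.
apply/nbhs_ballP; exists d => //= h; rewrite -ball_normE /= sub0r normrN => hd.
have HU y : ball w d y -> U y by move=> /Hd[].
have HD i y : ball w d y -> `|'D_(delta_mx 0 i) g w - 'D_(delta_mx 0 i) g y| <= e / 2.
  by move=> /Hd[].
have near_pt (c0 c1 : R) : `|c0| <= `|h| -> `|c1| <= `|h| ->
    ball w d (w + c0 *: delta_mx 0 0 + c1 *: delta_mx 0 1).
  move=> hc0 hc1; rewrite -ball_normE /= -addrA opprD addrA subrr sub0r normrN.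
  by apply: le_lt_trans hd; apply: rV2_norm_le;
    rewrite !mxE /= ?mulr1 ?mulr0 ?addr0 ?add0r.
have [|c0 c0h E0] := @mvt_dir _ g w (delta_mx 0 0) (h 0 0).
  move=> t ht; apply: dg; have := near_pt t 0; rewrite scale0r addr0 normr0 => h'.
  by apply: HU; apply: h' => //; exact: le_trans ht (rV_coord_le _ _).
have [|c1 c1h E1] := @mvt_dir _ g (w + h 0 0 *: delta_mx 0 0) (delta_mx 0 1) (h 0 1).
  move=> t ht; apply: dg; apply: HU; apply: near_pt; first exact: rV_coord_le.
  exact: le_trans ht (rV_coord_le _ _).
have {}c0h := le_trans c0h (rV_coord_le _ _).
have {}c1h := le_trans c1h (rV_coord_le _ _).
have -> : g (h + w) - g w - dfl h =
    h 0 1 * ('D_(delta_mx 0 1) g (w + h 0 0 *: delta_mx 0 0 + c1 *: delta_mx 0 1) -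
             'D_(delta_mx 0 1) g w) +
    h 0 0 * ('D_(delta_mx 0 0) g (w + c0 *: delta_mx 0 0) - 'D_(delta_mx 0 0) g w).
  have -> : h + w = w + h 0 0 *: delta_mx 0 0 + h 0 1 *: delta_mx 0 1.
    by rewrite {1}(rV2_decomp h) addrC addrA.
  by rewrite !mulrBr -E1 -E0 dfE; ring.
have b1 := HD 1 _ (near_pt (h 0 0) c1 (rV_coord_le _ _) c1h).
have b0 : `|'D_(delta_mx 0 0) g w - 'D_(delta_mx 0 0) g (w + c0 *: delta_mx 0 0)| <= e / 2.
  by apply: HD; have := near_pt c0 0; rewrite scale0r addr0 normr0; apply.
rewrite [e]splitr mulrDl; apply: le_trans (ler_normD _ _) _.
have hM (x y c c' : R) : `|x| <= c -> `|y| <= c' -> `|x * y| <= c' * c.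
  by move=> xc yc; rewrite normrM mulrC; apply: ler_pM.
apply: lerD; apply: hM; rewrite 1?distrC; try exact: rV_coord_le; [exact: b1|exact: b0].
Unshelve. all: by end_near. Qed.

(** The second difference of [f] over a square of side s at [w] is s^2 times either mixed
    derivative, each taken at some point of the square. Continuity makes both values close to those
    at [w] once the square is small. *)
Lemma Schwarz (f : 'rV[R]_2 -> R) (U : set 'rV[R]_2) w :
  open U -> U w -> Ck 2 U f ->
  'D_(delta_mx 0 0) ('D_(delta_mx 0 1) f) w =
  'D_(delta_mx 0 1) ('D_(delta_mx 0 0) f) w.
Proof.
move=> oU Uw [df ddf].
set e0 : 'rV[R]_2 := delta_mx 0 0; set e1 : 'rV[R]_2 := delta_mx 0 1.
(* The second difference is the first difference along [u] of the function y |-> f (y + s v) - f y;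
   the mean value theorem is used along [u] and then along [v]. *)
have step (u v : 'rV[R]_2) (s : R) :
    (forall t t' : R, `|t| <= `|s| -> `|t'| <= `|s| -> U (w + t *: u + t' *: v)) ->
    (forall y, U y -> derivable f y u) ->
    (forall y, U y -> derivable ('D_u f) y v) ->
    exists t t' : R, [/\ `|t| <= `|s|, `|t'| <= `|s| &
      f (w + s *: u + s *: v) - f (w + s *: u) - f (w + s *: v) + f w =
      s * (s * 'D_v ('D_u f) (w + t *: u + t' *: v))].
  move=> hU hu hv.
  have s0 : `|0 : R| <= `|s| by rewrite normr0.
  have dsh t : `|t| <= `|s| -> is_derive (w + t *: u) u
     (fun y => f (y + s *: v) - f y)
     ('D_u f (w + t *: u + s *: v) - 'D_u f (w + t *: u)).
    move=> ts; apply: is_deriveB.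
      by apply: is_derive_shift_arg; apply: hu; exact: hU t s ts (lexx _).
    by apply: derivableP; apply: hu; have := hU t 0 ts s0; rewrite scale0r addr0.
  have [t /dsh[//]|t ts E1] := @mvt_dir _ (fun y => f (y + s *: v) - f y) w u s.
  have [t' t's'|t' t's E2] := @mvt_dir _ ('D_u f) (w + t *: u) v s.
    by apply: hv; exact: hU.
  exists t, t'; split=> //; rewrite -E2.
  by have [_ <-] := dsh t ts; rewrite -E1; ring.
apply/eqP; rewrite -subr_eq0 -normr_le0; apply/ler_addgt0Pl => e e_gt0.
rewrite addr0.
have cc (i j : 'I_2) : {for w, continuous ('D_(delta_mx 0 j) ('D_(delta_mx 0 i) f))}.
  exact: (ddf i).2.
have e20 : 0 < e / 2 by rewrite divr_gt0.
have [d1 d1_gt0 H1] := continuous_ball (cc 0 1) e20.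
have [d2 d2_gt0 H2] := continuous_ball (cc 1 0) e20.
have [d3 d3_gt0 HU] := open_ball oU Uw.
pose d := Num.min d1 (Num.min d2 d3).
have d0 : 0 < d by rewrite !lt_min d1_gt0 d2_gt0.
have hd y : `|y - w| < d -> [/\ `|y - w| < d1, `|y - w| < d2 & `|y - w| < d3].
  by rewrite !lt_min => /andP[-> /andP[-> ->]].
pose s := d / 2; have s_gt0 : 0 < s by rewrite divr_gt0.
have sd : `|s| < d by rewrite gtr0_norm // /s ltr_pdivrMr // ltr_pMr // ltr1n.
have near_pt (c0 c1 : R) : `|c0| <= `|s| -> `|c1| <= `|s| ->
    `|(w + c0 *: e0 + c1 *: e1) - w| < d.
  move=> hc0 hc1; rewrite -[w + _ + _]addrA [w + _]addrC addrK.
  by apply: le_lt_trans sd; apply: rV2_norm_le;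
    rewrite !mxE /= ?mulr1 ?mulr0 ?addr0 ?add0r.
have [|||t [t' [ht ht' E]]] := step e0 e1 s.
- by move=> t t' ht ht'; apply: HU; have [] := hd _ (near_pt t t' ht ht').
- by move=> y /df; exact: diff_derivable.
- by move=> y Uy; apply: diff_derivable; exact: (ddf 0).1.
have [|||r [r' [hr hr' E']]] := step e1 e0 s.
- move=> r r' hr hr'; apply: HU; rewrite [w + _ + _]addrAC.
  by have [] := hd _ (near_pt r' r hr' hr).
- by move=> y /df; exact: diff_derivable.
- by move=> y Uy; apply: diff_derivable; exact: (ddf 1).1.
have [k1 _ _] := hd _ (near_pt t t' ht ht').
have [_ k2 _] := hd _ (near_pt r' r hr' hr).
have b1 := H1 _ k1; have b2 := H2 _ k2.
have EE : 'D_e1 ('D_e0 f) (w + t *: e0 + t' *: e1) =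
          'D_e0 ('D_e1 f) (w + r' *: e0 + r *: e1).
  have sn0 : s != 0 by rewrite gt_eqF.
  have EE : s * (s * 'D_e1 ('D_e0 f) (w + t *: e0 + t' *: e1)) =
            s * (s * 'D_e0 ('D_e1 f) (w + r' *: e0 + r *: e1)).
    rewrite [w + r' *: e0 + _]addrAC.
    apply: (etrans (esym E)); apply: (etrans _ E').
    by rewrite [w + s *: e1 + _]addrAC; ring.
  exact: (mulfI sn0 (mulfI sn0 EE)).
rewrite -/e0 -/e1 in b1 b2; rewrite EE in b1; rewrite distrC in b2.
rewrite [e]splitr -(subrKA ('D_e0 ('D_e1 f) (w + r' *: e0 + r *: e1))).
exact: le_trans (ler_normD _ _) (lerD b2 b1).
Qed.
End MeanValue.

(** * Smooth maps and their components *)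

Section SmoothCoordinates.
Context {R : realType}.
Implicit Types (U : set 'rV[R]_2).

(** The partial derivatives of [f] are again smooth, hence continuous, and continuous partial
    derivatives give the differentiability that [Ck] demands at each order. *)
Lemma smooth_Csmooth n U (f : 'rV[R]_2 -> 'rV[R]_n.+1) j :
  open U -> smooth U f -> Csmooth U (fun y => f y 0 j).
Proof.
move=> oU sf k; elim: k f sf => [|k IH] f sf.
  move=> w Uw; apply: (@continuous_comp _ _ _ f (fun N : 'rV[R]_n.+1 => N 0 j)).
    exact: (sf 0).
  exact: coord_continuous.
have sd i : smooth U (fun y => 'D_(delta_mx 0 i) f y).
  by move=> l; exact: ((sf l.+1) i).2.
have df i y : U y -> derivable f y (delta_mx 0 i).
  by move=> Uy; exact: ((sf 1) i).1.
have dfj i y : U y -> ('D_(delta_mx 0 i) f y) 0 j =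
     'D_(delta_mx 0 i) (fun y => f y 0 j) y.
  by move=> Uy; rewrite derive_coordf //; exact: df.
have ck i : Ck k U ('D_(delta_mx 0 i) (fun y => f y 0 j)).
  by apply: Ck_ext (IH _ (sd i)) => // y; exact: dfj.
split=> // w Uw; apply: (C1_differentiable oU Uw) => i.
  by move=> y Uy; move/derivable_mxP: (df i y Uy); apply.
exact: (Ck_continuous (ck i)).
Qed.

Lemma Csmooth_smooth n U (f : 'rV[R]_2 -> 'rV[R]_n.+1) :
  open U -> (forall j, Csmooth U (fun y => f y 0 j)) -> smooth U f.
Proof.
move=> oU sf k; elim: k f {sf}(fun j => sf j k) => [|k IH] f cf.
  by move=> y Uy; apply: continuous_rV => j; exact: cf.
have df i y : U y -> derivable f y (delta_mx 0 i).
  move=> Uy; apply/derivable_mxP => a j; rewrite ord1.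
  by apply: diff_derivable; exact: (cf j).1.
move=> i; split; first exact: df.
apply: IH => j; apply: Ck_ext ((cf j).2 i) => // y Uy.
by rewrite derive_coordf //; exact: df.
Qed.

Lemma Csmooth_differentiable U (g : 'rV[R]_2 -> R) w :
  Csmooth U g -> U w -> differentiable g w.
Proof. by move=> h; exact: (h 1).1. Qed.

Lemma smooth_differentiable n U (f : 'rV[R]_2 -> 'rV[R]_n.+1) w :
  open U -> smooth U f -> U w -> differentiable f w.
Proof.
move=> oU sf Uw; apply: differentiable_mxP => j.
exact: (Csmooth_differentiable (smooth_Csmooth j oU sf)).
Qed.

End SmoothCoordinates.

(** * The inverse function theorem in the plane *)

Section TwoByTwo.
Context {R : realType}.
Implicit Types (J : 'M[R]_2).

Definition det2 J : R := J 0 0 * J 1 1 - J 0 1 * J 1 0.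
(** Cramer's rule is written out so that the smoothness of the entries of an inverse can be read off
    from that of the entries of the matrix. *)
Definition inv2 J : 'M[R]_2 :=
  \matrix_(i, j) ((det2 J)^-1 * (if i == 0 then if j == 0 then J 1 1 else - J 0 1
                                 else if j == 0 then - J 1 0 else J 0 0)).

Lemma ord2P (P : 'I_2 -> Prop) : P 0 -> P 1 -> forall i, P i.
Proof.
by move=> P0 P1 [[|[|//]] hi]; [move: P0|move: P1]; congr P; apply/val_inj.
Qed.

Lemma rV_subE n (x y : 'rV[R]_n) j : (x - y) 0 j = x 0 j - y 0 j.
Proof. by rewrite !mxE. Qed.

Lemma mulmx2E m n (x : 'M[R]_(m, 2)) (J : 'M[R]_(2, n)) i j :
  (x *m J) i j = x i 0 * J 0 j + x i 1 * J 1 j.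
Proof.
rewrite mxE big_ord_recl big_ord1.
by congr (x _ _ * J _ _ + x _ _ * J _ _); apply/val_inj.
Qed.

Lemma mulmx_inv2 J : det2 J != 0 -> J *m inv2 J = 1%:M.
Proof.
move=> dJ; apply/matrixP; apply: ord2P; apply: ord2P; rewrite mulmx2E !mxE /=;
  move: dJ; rewrite /det2; set a := J 0 0; set b := J 0 1; set c := J 1 0;
  set d := J 1 1 => dJ; field; exact: dJ.
Qed.

Lemma mulmx_inv2l J : det2 J != 0 -> inv2 J *m J = 1%:M.
Proof. by move=> /mulmx_inv2/mulmx1C. Qed.

(** If the determinant vanished, the row vectors (J_10, - J_00) and (J_11, - J_01) would be killed
    by [J], hence be zero. Then [J] itself would be zero and would kill (1, 0). *)
Lemma det2_neq0 J : (forall x : 'rV[R]_2, x *m J = 0 -> x = 0) -> det2 J != 0.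
Proof.
move=> inj; apply/eqP => d0.
have inj' (x0 x1 : R) : x0 * J 0 0 + x1 * J 1 0 = 0 ->
    x0 * J 0 1 + x1 * J 1 1 = 0 -> x0 = 0 /\ x1 = 0.
  move=> e0 e1; have /rowP E : \row_(i < 2) (if i == 0 then x0 else x1) = 0.
    by apply: inj; apply/rowP; apply: ord2P; rewrite mulmx2E !mxE.
  by have := E 0; have := E 1; rewrite !mxE /=.
rewrite /det2 in d0.
have [||c0 a0] := inj' (J 1 0) (- J 0 0); [by ring|by lra|].
have [||d1 b0] := inj' (J 1 1) (- J 0 1); [by lra|by ring|].
have [||/eqP] := inj' 1 0; [by lra|by lra|].
by rewrite oner_eq0.
Qed.

Lemma mulmx_continuous m n (J : 'M[R]_(m.+1, n.+1)) :
  continuous (fun x : 'rV[R]_m.+1 => x *m J).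
Proof.
move=> x; apply: continuous_rV => j; apply: differentiable_continuous.
rewrite (_ : (fun _ => _) = \sum_i (fun y : 'rV[R]_m.+1 => y 0 i * J i j)).
  apply: differentiable_sum => i.
  exact: (differentiableM (differentiable_coord _ _ _) (differentiable_cst _ _)).
by apply/funext => y; rewrite mxE fct_sumE.
Qed.
Lemma mulmx_lipschitz m n (J : 'M[R]_(m.+1, n.+1)) :
  exists2 k : R, 0 < k & forall x : 'rV_m.+1, `|x *m J| <= k * `|x|.
Proof.
exact: (@linear_lipschitz _ _ _ (mulmxr J) (@mulmx_continuous _ _ J)).
Qed.

Lemma derive_linear_comp (V W W' : normedModType R) (L : {linear W -> W'})
    (f : V -> W) x v : continuous L -> differentiable f x ->
  differentiable (L \o f) x /\ 'D_v (L \o f) x = L ('D_v f x).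
Proof.
move=> cL df; have dL : differentiable L (f x) by exact: linear_differentiable.
have dc : differentiable (L \o f) x by exact: differentiable_comp.
by split; [exact: dc|rewrite !deriveE // diff_comp //= diff_lin].
Qed.

Lemma derive_mulmx (V : normedModType R) m n (f : V -> 'rV[R]_m.+1)
    (K : 'M[R]_(m.+1, n.+1)) x v : differentiable f x ->
  differentiable (fun y => f y *m K) x /\
  'D_v (fun y => f y *m K) x = 'D_v f x *m K.
Proof.
exact: (@derive_linear_comp _ _ _ (mulmxr K) f x v (@mulmx_continuous _ _ K)).
Qed.

End TwoByTwo.

Section NormBalls.
Context {R : realType}.

Lemma closed_norm_ball (V : normedModType R) (x : V) (rho : R) :
  closed [set w | `|w - x| <= rho].
Proof.
apply: (@preimage_closed _ _ (fun w => `|w - x|) [set t : R | t <= rho]).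
  move=> w _; apply: (@continuous_comp _ _ _ (fun w => w - x) Num.norm).
    by apply: continuousB => //; exact: cst_continuous.
  exact: norm_continuous.
exact: closed_le.
Qed.

Lemma open_norm_ball (V : normedModType R) (x : V) (rho : R) :
  open [set w | `|w - x| < rho].
Proof.
rewrite (_ : [set w | _] = ball x rho); first exact: ball_open.
by apply/seteqP; split=> w; rewrite /= -ball_normE /= distrC.
Qed.

(** Compactness replaces iteration: |T w - w| attains its minimum on the closed ball at some w. The
    point T w is a competitor at which the value is at most half as large, so that the minimum is
    0. *)
Lemma contraction_fixed (n : nat) (x : 'rV[R]_n) (rho : R) (T : 'rV[R]_n -> 'rV[R]_n) :
  0 <= rho ->
  (forall w, `|w - x| <= rho -> {for w, continuous T} /\ `|T w - x| <= rho) ->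
  (forall w w', `|w - x| <= rho -> `|w' - x| <= rho ->
     `|T w - T w'| <= `|w - w'| / 2) ->
  exists2 w, `|w - x| <= rho & T w = w.
Proof.
move=> rho0 hT lT; pose B := [set w | `|w - x| <= rho].
have cB : compact B.
  apply: bounded_closed_compact; last exact: closed_norm_ball.
  exists (rho + `|x|); split; first exact: num_real.
  move=> M hM w /= wB; apply: le_trans (ltW hM).
  by have := ler_normD (w - x) x; rewrite subrK; move: wB; rewrite /B /=; lra.
have B0 : B !=set0 by exists x; rewrite /B /= subrr normr0.
have [|w wB wmin] := EVT_min_rV (f := fun w => `|T w - w|) B0 cB.
  apply: continuous_in_subspaceT => w /set_mem wB.
  apply: (@continuous_comp _ _ _ (fun w => T w - w) Num.norm); last exact: norm_continuous.
  by apply: continuousB => //; exact: (hT w wB).1.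
move/set_mem in wB; exists w => //; have [_ TwB] := hT w wB.
have := wmin (T w) (mem_set TwB); have := lT _ _ TwB wB.
move=> h1 h2; apply/eqP; rewrite -subr_eq0 -normr_le0.
by have := normr_ge0 (T w - w); lra.
Qed.

End NormBalls.

Section InverseFunction.
Context {R : realType} (U : set 'rV[R]_2) (phi : 'rV[R]_2 -> 'rV[R]_2)
  (w0 : 'rV[R]_2).
Context (oU : open U) (Uw0 : U w0)
  (sphi : forall j, Csmooth U (fun w => phi w 0 j))
  (inj0 : forall X, 'D_X phi w0 = 0 -> X = 0).

Let J w : 'M[R]_2 := \matrix_(i, j) 'D_(delta_mx 0 i) (fun y => phi y 0 j) w.

Let JE w i j : J w i j = 'D_(delta_mx 0 i) (fun y => phi y 0 j) w.
Proof. by rewrite mxE. Qed.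

Let dphi w : U w -> differentiable phi w.
Proof.
move=> Uw; apply: differentiable_mxP => j.
exact: (Csmooth_differentiable (sphi j)).
Qed.

Let DphiE w X : U w -> 'D_X phi w = X *m J w.
Proof.
move=> Uw; apply/rowP => j; have dw := dphi Uw.
have dc v : ('D_v phi w) 0 j = 'D_v (fun y => phi y 0 j) w.
  by rewrite derive_coordf //; exact: diff_derivable.
have comb (a b : R) (x y : 'rV[R]_2) :
    (a *: x + b *: y) 0 j = a * x 0 j + b * y 0 j by rewrite !mxE.
by rewrite mulmx2E !JE -!dc (derive_rV2 _ dw) comb.
Qed.

Let K := inv2 (J w0).

Let det0 : det2 (J w0) != 0.
Proof. by apply: det2_neq0 => x xJ; apply: inj0; rewrite DphiE. Qed.

(** Newton's map with the derivative frozen at [w0]: the solutions of phi w = z are the fixed points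
    of [g w + z *m K], and the derivative of [g] vanishes at [w0]. *)
Let g w := w - phi w *m K.

Let dg w : U w -> differentiable g w.
Proof.
move=> Uw; apply: differentiableB => //.
exact: (derive_mulmx K 0 (dphi Uw)).1.
Qed.

Let DgE w X : U w -> 'D_X g w = X *m (1%:M - J w *m K).
Proof.
move=> Uw; rewrite mulmxBr mulmx1 mulmxA -(DphiE _ Uw).
have [dK <-] := derive_mulmx K X (dphi Uw).
rewrite /g deriveB; [|exact: derivable_id|exact: diff_derivable].
by rewrite derive_id.
Qed.

Let small_g : exists2 rho : R, 0 < rho & forall w w', `|w - w0| <= rho ->
  `|w' - w0| <= rho -> [/\ U w, `|g w - g w'| <= `|w - w'| / 2 & det2 (J w) != 0].
Proof.
have cJ i j : {for w0, continuous (fun w => J w i j)}.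
  rewrite (_ : (fun w => _) = 'D_(delta_mx 0 i) (fun y => phi y 0 j)).
    exact: ((sphi j 1).2 i).
  by apply/funext => w; rewrite JE.
have cE i j : {for w0, continuous (fun w => (1%:M - J w *m K) i j)}.
  rewrite (_ : (fun w => _) = fun w => (i == j)%:R - (J w i 0 * K 0 j + J w i 1 * K 1 j)).
    apply: continuousB; first exact: cst_continuous.
    apply: continuousD; apply: continuousM => //; exact: cst_continuous.
  by apply/funext => w; rewrite [LHS]mxE [in LHS]mxE [X in _ + X]mxE mulmx2E.
(* If the four entries of the derivative of [g] are at most 1/8, it maps X to a vector of sup norm
   at most |X| / 4, within the bound |X| / 2 that is wanted. *)
have e0 : (0 : R) < 1 / 8 by lra.
have [d1 d10 H1] := open_ball oU Uw0.
have E0 i j : (1%:M - J w0 *m K) i j = 0 by rewrite mulmx_inv2 // subrr mxE.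
have HE i j : exists2 d, 0 < d & forall w, `|w - w0| < d ->
    `|(1%:M - J w *m K) i j| <= 1 / 8.
  have [d d0 H] := continuous_ball (cE i j) e0.
  by exists d => // w /H; rewrite [X in _ - X](E0 i j) subr0.
have [d2 d20 H2] := HE 0 0.
have [d3 d30 H3] := HE 0 1.
have [d4 d40 H4] := HE 1 0.
have [d5 d50 H5] := HE 1 1.
pose d := Num.min d1 (Num.min d2 (Num.min d3 (Num.min d4 d5))).
have d0 : 0 < d by rewrite !lt_min d10 d20 d30 d40 d50.
have Hd w : `|w - w0| < d -> U w /\ forall i j, `|(1%:M - J w *m K) i j| <= 1 / 8.
  rewrite !lt_min => /and5P[k1 k2 k3 k4 k5]; split; first exact: H1.
  move=> i; apply: (@ord2P (fun j => `|(1%:M - J w *m K) i j| <= 1 / 8));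
  move: i; apply: ord2P.
  - exact: H2.
  - exact: H4.
  - exact: H3.
  - exact: H5.
have Dg_le w X : `|w - w0| < d -> `|'D_X g w| <= `|X| / 2.
  move=> /Hd[Uw hE]; rewrite DgE //.
  have hM i (Y : 'rV[R]_2) j : `|Y 0 i * (1%:M - J w *m K) i j| <= `|Y| / 8.
    rewrite normrM -[8^-1]div1r; apply: ler_pM => //; exact: rV_coord_le.
  have hX j : `|(X *m (1%:M - J w *m K)) 0 j| <= `|X| / 2.
    rewrite mulmx2E; apply: le_trans (ler_normD _ _) _.
    have := hM 0 X j; have := hM 1 X j; have := normr_ge0 X; lra.
  exact: rV2_norm_le.
(* With radius d / 4 the whole segment from w' to w stays within d / 4 + d / 2 of [w0], where the
   derivative of [g] is controlled. *)
exists (d / 4); first by rewrite divr_gt0.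
move=> w w' hw hw'.
have wd : `|w - w0| < d by lra.
have [Uw _] := Hd _ wd; split => //.
  have hv : `|w - w'| <= d / 2.
    rewrite -(subrKA w0); apply: le_trans (ler_normD _ _) _.
    by rewrite [`|w0 - _|]distrC; lra.
  have hj j : `|(g w - g w') 0 j| <= `|w - w'| / 2.
    rewrite rV_subE.
    have seg (t : R) : `|t| <= `|1 : R| -> `|w' + t *: (w - w') - w0| < d.
      rewrite normr1 => t1; rewrite addrAC; apply: le_lt_trans (ler_normD _ _) _.
      rewrite normrZ; have : `|t| * `|w - w'| <= 1 * `|w - w'|.
        by rewrite ler_wpM2r.
      lra.
    have [t /seg ts|c /seg cs E] := @mvt_dir R _ (fun y => g y 0 j) w' (w - w') 1.
      have [Us _] := Hd _ ts.
      by apply: diff_derivable; apply: differentiable_coordf; exact: dg.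
    have [Us _] := Hd _ cs.
    have -> : g w 0 j - g w' 0 j = ('D_(w - w') g (w' + c *: (w - w'))) 0 j.
      rewrite derive_coordf; last by apply: diff_derivable; exact: dg.
      by move: E; rewrite mul1r scale1r [w' + (w - w')]addrC subrK => <-.
    exact: le_trans (rV_coord_le _ _) (Dg_le _ _ cs).
  exact: rV2_norm_le.
(* A vector X killed by the Jacobian satisfies D_X g = X, while |D_X g| <= |X| / 2. *)
apply: det2_neq0 => X XJ.
have := Dg_le w X wd; rewrite DgE // mulmxBr mulmx1 mulmxA XJ mul0mx subr0 => h.
by apply/eqP; rewrite -normr_le0; have := normr_ge0 X; lra.
Qed.

Theorem inverse_function : exists (V : set 'rV[R]_2) (r : R) (psi : 'rV[R]_2 -> 'rV[R]_2),
  [/\ open V, V w0, V `<=` U & 0 < r] /\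
  [/\ forall z, `|z - phi w0| < r -> V (psi z) /\ phi (psi z) = z,
      forall w, V w -> `|phi w - phi w0| < r -> psi (phi w) = w &
      forall j, Csmooth [set z | `|z - phi w0| < r] (fun z => psi z 0 j)].
Proof.
have [rho rho0 Hrho] := small_g.
have hU w : `|w - w0| <= rho -> U w by move=> h; have [] := Hrho w w h h.
have hdet w : `|w - w0| <= rho -> det2 (J w) != 0.
  by move=> h; have [] := Hrho w w h h.
have hg w w' : `|w - w0| <= rho -> `|w' - w0| <= rho -> `|g w - g w'| <= `|w - w'| / 2.
  by move=> h h'; have [] := Hrho w w' h h'.
have w00 : `|w0 - w0| <= rho by rewrite subrr normr0 ltW.
have [k k0 hk] := mulmx_lipschitz K.
(* This radius makes |(z - phi w0) K| < rho / 2. The other half of [rho] is taken up by the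
   contraction [g], so that [g w + z *m K] maps the ball of radius [rho] into itself. *)
pose r := rho / (2 * k).
have r0 : 0 < r by rewrite divr_gt0 // mulr_gt0.
have hr z : `|z - phi w0| < r -> `|(z - phi w0) *m K| < rho / 2.
  move=> hz; apply: le_lt_trans (hk _) _.
  have -> : rho / 2 = k * r by rewrite /r; field; rewrite gt_eqF.
  by rewrite ltr_pM2l.
have phiK w : phi w *m K = w - g w by rewrite /g opprB addrC subrK.
have ex z : `|z - phi w0| < r -> exists w, `|w - w0| < rho /\ phi w = z.
  move=> hz; have [|||w wB wE] := @contraction_fixed R 2 w0 rho (fun w => g w + z *m K).
  - exact: ltW.
  - move=> w hw; split.
      apply: continuousD; last exact: cst_continuous.
      exact/differentiable_continuous/dg/hU.
    have -> : g w + z *m K - w0 = (g w - g w0) + (z - phi w0) *m K.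
      by rewrite mulmxBl phiK opprB; apply/rowP => i; rewrite !mxE; ring.
    apply: le_trans (ler_normD _ _) _.
    by have := hg _ _ hw w00; have := hr _ hz; lra.
  - move=> w w' hw hw'; rewrite opprD addrACA subrr addr0; exact: hg.
  - exists w; split.
      have -> : w - w0 = (g w - g w0) + (z - phi w0) *m K.
        by rewrite -{1}wE mulmxBl phiK opprB; apply/rowP => i; rewrite !mxE; ring.
      apply: le_lt_trans (ler_normD _ _) _.
      by have := hg _ _ wB w00; have := hr _ hz; lra.
    have : phi w *m K = z *m K by apply/eqP; rewrite phiK subr_eq addrC wE.
    move=> /(congr1 (mulmx^~ (J w0))).
    by rewrite -!mulmxA mulmx_inv2l // !mulmx1.
(* Off the ball of radius [r] the value may be an arbitrary default. On that ball [ex] supplies a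
   preimage, and [lip] below makes it unique. *)
pose psi z := get [set w | `|w - w0| < rho /\ phi w = z].
have psiP z : `|z - phi w0| < r -> `|psi z - w0| < rho /\ phi (psi z) = z.
  by move=> /ex; exact: getPex.
(* The difference w - w' is the sum of g w - g w' and (phi w - phi w') K; the first term is at most
   |w - w'| / 2 and is absorbed on the left. *)
have lip w w' : `|w - w0| < rho -> `|w' - w0| < rho ->
    `|w - w'| <= 2 * k * `|phi w - phi w'|.
  move=> hw hw'; have h1 := hg _ _ (ltW hw) (ltW hw'); have h2 := hk (phi w - phi w').
  have h3 : `|w - w'| <= `|g w - g w'| + `|(phi w - phi w') *m K|.
    apply: le_trans (ler_normD _ _).
    by rewrite mulmxBl !phiK opprB addrACA; rewrite le_eqVlt; apply/orP; left;
      apply/eqP; congr `|_|; apply/rowP => i; rewrite !mxE; ring.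
  by rewrite /= in h2; lra.
exists [set w | `|w - w0| < rho], r, psi; split.
  split=> //; first exact: open_norm_ball.
    by rewrite /= subrr normr0.
  by move=> w /ltW; exact: hU.
have psi_phi w : `|w - w0| < rho -> `|phi w - phi w0| < r -> psi (phi w) = w.
  move=> hw hz; have [h1 h2] := psiP _ hz.
  apply/eqP; rewrite -subr_eq0 -normr_le0; have := lip _ _ h1 hw.
  by rewrite h2 subrr normr0 mulr0.
split=> //.
set B := [set z | `|z - phi w0| < r].
have oB : open B by exact: open_norm_ball.
have dpsi z : B z -> differentiable psi z /\
    forall X, 'D_X psi z = X *m inv2 (J (psi z)).
  move=> Bz; have [h1 h2] := psiP _ Bz.
  set w := psi z; set Kw := inv2 (J w).
  have Uw : U w by apply: hU; exact: ltW.
  have [kw kw0 hkw] := mulmx_lipschitz Kw.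
  have [|dp dE] := @differentiable_eps _ _ _ psi (mulmxr Kw) z (@mulmx_continuous R _ _ Kw).
    (* The first-order error of [phi] at [w] is at most e' |q|, where |q| <= 2 k |h| by [lip]; the
       inverse Jacobian then enlarges it by at most the factor [kw]. *)
    move=> e e0; pose e' := e / (kw * (2 * k)).
    have e'0 : 0 < e' by rewrite divr_gt0 // !mulr_gt0.
    have [d d0 Hd] := differentiable_ball (dphi Uw) e'0.
    have [d' d'0 Hd'] := open_ball oB Bz.
    apply/nbhs_ballP; exists (Num.min d' (d / (2 * k))) => /=.
      by rewrite lt_min d'0 divr_gt0 // mulr_gt0.
    move=> h; rewrite -ball_normE /= sub0r normrN lt_min => /andP[hd' hd].
    have Bzh : B (h + z) by apply: Hd'; rewrite addrK.
    have [h3 h4] := psiP _ Bzh.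
    pose q := psi (h + z) - w.
    have qh : `|q| <= 2 * k * `|h| by have := lip _ _ h3 h1; rewrite h4 h2 addrK.
    have qd : `|q| < d.
      by apply: le_lt_trans qh _; rewrite mulrC -ltr_pdivlMr ?mulr_gt0.
    have := Hd q qd; rewrite subrK h4 h2 addrK DphiE // => hq.
    have -> : psi (h + z) - psi z - h *m Kw = - ((h - q *m J w) *m Kw).
      by rewrite mulmxBl -mulmxA mulmx_inv2 ?mulmx1 ?opprB //; apply: hdet; exact: ltW.
    rewrite normrN; apply: le_trans (hkw _) _.
    have -> : e * `|h| = kw * (e' * (2 * k * `|h|)).
      by rewrite /e'; field; rewrite !gt_eqF.
    rewrite ler_pM2l //; apply: le_trans hq _; rewrite ler_pM2l //.
  split=> // X; by rewrite deriveE // dE.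
have cpsi z j : B z -> {for z, continuous (fun z => psi z 0 j)}.
  move=> Bz; apply: differentiable_continuous; apply: differentiable_coordf.
  exact: (dpsi z Bz).1.
(* Bootstrap: the derivative of [psi] is the inverse of the Jacobian of [phi] composed with [psi].
   If [psi] is of class C^k', so is its derivative. *)
move=> j k'; elim: k' j => [|k' IH] j; first by move=> z; exact: cpsi.
split=> [z Bz|i].
  by apply: differentiable_coordf; exact: (dpsi z Bz).1.
have psiU z : B z -> U (psi z) by move=> Bz; apply: hU; apply: ltW; exact: (psiP z Bz).1.
have cJ a b : Ck k' B (fun z => J (psi z) a b).
  have := Ck_comp oB psiU IH ((sphi b k'.+1).2 a).
  by apply: Ck_ext => // z _; rewrite JE.
have cdet : Ck k' B (fun z => (det2 (J (psi z)))^-1).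
  apply: Ck_inv => //; first by move=> z Bz; apply: hdet; apply: ltW; exact: (psiP z Bz).1.
  apply: Ck_add => //; first exact: Ck_mul.
  apply: Ck_ext (Ck_mul oB (Ck_cst _ _ (-1)) (Ck_mul oB (cJ 0 1) (cJ 1 0))) => // z _.
  by rewrite mulN1r.
have cinv a b : Ck k' B (fun z => inv2 (J (psi z)) a b).
  have cN a' b' : Ck k' B (fun z => - J (psi z) a' b').
    apply: Ck_ext (Ck_mul oB (Ck_cst _ _ (-1)) (cJ a' b')) => // z _.
    by rewrite mulN1r.
  move: a b; apply: ord2P; apply: ord2P;
    [have c := cJ 1 1|have c := cN 0 1|have c := cN 1 0|have c := cJ 0 0];
    by apply: Ck_ext (Ck_mul oB cdet c) => // z _; rewrite [RHS]mxE.
apply: Ck_ext (cinv i j) => // z Bz.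
have [dz Dz] := dpsi z Bz.
by rewrite -derive_coordf ?Dz -?rowE ?mxE //; exact: diff_derivable.
Qed.

End InverseFunction.

(** * Charts adapted to given functions *)

Section Charts.
Context {R : realType} {M : topologicalType}.
Implicit Types (x y : chart R M) (A : set (chart R M)).

Lemma open_preim (T T' : topologicalType) (D : set T) (W : set T') (f : T -> T') :
  open D -> (forall t, D t -> {for t, continuous f}) -> open W ->
  open [set t | D t /\ W (f t)].
Proof.
move=> oD cf oW; rewrite openE => t [Dt Wt]; apply: filterI.
  exact: open_nbhs_nbhs.
exact: (cf t Dt _ (open_nbhs_nbhs (conj oW Wt))).
Qed.

Lemma boxE (z0 : 'rV[R]_2) (r : R) :
  [set w : 'rV[R]_2 | z0 0 0 - r < w 0 0 < z0 0 0 + r /\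
     z0 0 1 - r < w 0 1 < z0 0 1 + r] = [set w | `|w - z0| < r].
Proof.
apply/seteqP; split=> w /=.
  move=> [h0 h1].
  rewrite [X in X < _]/Num.Def.normr/= mx_normrE; apply: bigmax_lt => /=.
    by move: h0 => /andP[]; lra.
  move=> [i j] _ /=; rewrite ord1 rV_subE.
  by move: j; apply: ord2P; rewrite ltr_distl.
move=> h; have hj j : `|w 0 j - z0 0 j| < r.
  by apply: le_lt_trans h; rewrite -rV_subE; exact: rV_coord_le.
by have := hj 0; have := hj 1; rewrite !ltr_distl.
Qed.

(** The inverse function theorem is applied to [phi] in the chart [y]. The ball of the sup norm on
    which it yields an inverse is a rectangle, the shape of coordinate domain that is wanted. The
    transition maps to charts of [A] are those of [y] composed with the local inverse or with
    [phi]. *)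
Lemma adapted_chart A y p (O : set 'rV[R]_2) (phi : 'rV[R]_2 -> 'rV[R]_2) :
  smooth_surface A -> A y -> chart_dom y p ->
  open O -> O `<=` chart_cod y -> O (chart_fun y p) ->
  (forall j, Csmooth O (fun w => phi w 0 j)) ->
  (forall X, 'D_X phi (chart_fun y p) = 0 -> X = 0) ->
  let z0 := phi (chart_fun y p) in
  exists (x : chart R M) (r : R), [/\ local_coordinates A x, chart_dom x p, 0 < r,
    chart_cod x = [set w | z0 0 0 - r < w 0 0 < z0 0 0 + r /\
                           z0 0 1 - r < w 0 1 < z0 0 1 + r] &
    forall w, chart_cod x w -> let q := chart_inv x w in
      [/\ chart_dom y q, O (chart_fun y q) & phi (chart_fun y q) = w]].
Proof.
move=> [_ _ chA covA compA] Ay yp oO Ocod Op sphi inj0 z0.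
have [V [r [psi [[oV Vp VO r0] [psiP psi_phi spsi]]]]] :=
  inverse_function oO Op sphi inj0.
have [[ody ocy] yK yK' cy cyi] := chA _ Ay.
pose B := [set w | `|w - z0| < r].
have oB : open B by exact: open_norm_ball.
have cphi w : O w -> {for w, continuous phi}.
  by move=> Ow; apply: continuous_rV => j; exact: (Ck_continuous (sphi j 0)).
have cpsi w : B w -> {for w, continuous psi}.
  by move=> Bw; apply: continuous_rV => j; exact: (Ck_continuous (spsi j 0)).
have oVB : open [set w | V w /\ B (phi w)].
  by apply: open_preim => // w /VO; exact: cphi.
pose x := Chart [set q | chart_dom y q /\ [set w | V w /\ B (phi w)] (chart_fun y q)] B
  (phi \o chart_fun y) (chart_inv y \o psi).
have Vcod w : V w -> chart_cod y w by move=> /VO/Ocod.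
have psicod w : B w -> chart_cod y (psi w).
  by move=> Bw; apply: Vcod; exact: (psiP w Bw).1.
have cix w : B w -> {for w, continuous (chart_inv y \o psi)}.
  move=> Bw; apply: continuous_comp; first exact: cpsi.
  exact/cyi/psicod.
have cx : is_chart x.
  split=> /=.
  - by split=> //; exact: (@open_preim _ _ _ [set w | V w /\ B (phi w)] (chart_fun y)).
  - move=> q [yq [Vq Bq]]; split=> //.
    by rewrite psi_phi //; have [] := yK q yq.
  - move=> w Bw; have [Vw phiw] := psiP w Bw.
    have [h1 h2] := yK' _ (psicod _ Bw); rewrite h2 phiw.
    by split.
  - move=> q [yq [Vq Bq]]; apply: continuous_comp; first exact: cy.
    exact/cphi/VO.
  - exact: cix.
exists x, r; split=> //=.
- split=> // y' Ay'.
  have [[ody' ocy'] _ _ cy' cyi'] := chA _ Ay'.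
  have [syy' sy'y] := compA _ _ Ay Ay'.
  have oyy' : open [set w | chart_cod y w /\ chart_dom y' (chart_inv y w)].
    exact: (@open_preim _ _ (chart_cod y) _ (chart_inv y)).
  have oy'y : open [set w | chart_cod y' w /\ chart_dom y (chart_inv y' w)].
    exact: (@open_preim _ _ (chart_cod y') _ (chart_inv y')).
  split.
    have oW : open [set w | chart_cod x w /\ chart_dom y' (chart_inv x w)].
      exact: (@open_preim _ _ B _ (chart_inv y \o psi)).
    apply: Csmooth_smooth => // j k.
    apply: (@Ck_comp _ k [set w | chart_cod y w /\ chart_dom y' (chart_inv y w)] _ psi
      (fun w => (chart_fun y' \o chart_inv y) w 0 j)) => //.
    - by move=> w [Bw dw]; split=> //; exact: psicod.
    - by move=> i; apply: Ck_sub (spsi i k) => w [].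
    - exact: smooth_Csmooth.
  have [[odx _] _ _ _ _] := cx.
  have oW : open [set w | chart_cod y' w /\ chart_dom x (chart_inv y' w)].
    exact: (@open_preim _ _ (chart_cod y') (chart_dom x) (chart_inv y')).
  apply: Csmooth_smooth => // j k.
  apply: (@Ck_comp _ k O _ (chart_fun y \o chart_inv y') (fun w => phi w 0 j)) => //.
  - by move=> w [_ [_ [/VO]]].
  - move=> i; have := smooth_Csmooth i oy'y sy'y k.
    by apply: Ck_sub => w [h1 [h2 _]].
  - exact: sphi.
- split=> //; split=> //.
  by rewrite /B /= /z0 subrr normr0.
- exact: (esym (boxE z0 r)).
- move=> w Bw; have [Vw phiw] := psiP w Bw.
  have [h1 h2] := yK' _ (psicod _ Bw); rewrite h2 phiw; split=> //.
  exact: VO.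
Qed.

End Charts.

(** * Structure equations of umbilical surfaces *)

Section LocalGeometry.
Context {R : realType}.

Lemma lorentz_normalE (p v : 'rV[R]_4) : lorentz (H2R_normal p) v =
  - (p 0 i1 * v 0 i1) + p 0 i2 * v 0 i2 + p 0 i3 * v 0 i3.
Proof. by rewrite /lorentz /H2R_normal !mxE /= mul0r addr0. Qed.

Lemma ord4P (P : 'I_4 -> Prop) : P i1 -> P i2 -> P i3 -> P i4 -> forall i, P i.
Proof.
move=> P1 P2 P3 P4 [[|[|[|[|//]]]] hi].
- by rewrite (_ : Ordinal hi = i1) //; apply/val_inj.
- by rewrite (_ : Ordinal hi = i2) //; apply/val_inj.
- by rewrite (_ : Ordinal hi = i3) //; apply/val_inj.
- by rewrite (_ : Ordinal hi = i4) //; apply/val_inj.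
Qed.

Lemma derive_prod3 (V : normedModType R) (a b c a' b' c' : V -> R) w v :
  differentiable a w -> differentiable b w -> differentiable c w ->
  differentiable a' w -> differentiable b' w -> differentiable c' w ->
  'D_v (fun y => - (a y * a' y) + b y * b' y + c y * c' y) w =
  - ('D_v a w * a' w + a w * 'D_v a' w) + ('D_v b w * b' w + b w * 'D_v b' w) +
  ('D_v c w * c' w + c w * 'D_v c' w).
Proof.
move=> da db dc da' db' dc'.
have dM (g h : V -> R) : differentiable g w -> differentiable h w ->
    is_derive w v (fun y => g y * h y) ('D_v g w * h w + g w * 'D_v h w).
  move=> dg dh; have := is_deriveM (derivableP (diff_derivable (v := v) dg))
     (derivableP (diff_derivable (v := v) dh)).
  by move/is_derive_eq; apply; rewrite /GRing.scale /=; ring.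
have := is_deriveD (is_deriveD (is_deriveN (dM _ _ da da')) (dM _ _ db db'))
   (dM _ _ dc dc').
by case.
Qed.

Lemma derive_near_cst (V : normedModType R) (g : V -> R) (U : set V) w v c :
  open U -> U w -> (forall y, U y -> g y = c) -> 'D_v g w = 0.
Proof.
move=> oU Uw gc; rewrite -(derive_cst c w v); apply: near_eq_derive.
exact: (near_open oU).
Qed.

Lemma zero_derive_locally_cst (V : normedModType R) (g : V -> R) (U : set V) w :
  open U -> U w -> (forall y, U y -> differentiable g y) ->
  (forall y v, U y -> 'D_v g y = 0) -> \forall y \near w, g y = g w.
Proof.
move=> oU Uw dg g0; have [d d0 Hd] := open_ball oU Uw.
apply/nbhs_ballP; exists d => //= y; rewrite -ball_normE /= distrC => yd.
have seg (t : R) : `|t| <= `|1 : R| -> U (w + t *: (y - w)).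
  rewrite normr1 => t1; apply: Hd; rewrite addrC addKr normrZ.
  by apply: le_lt_trans yd; rewrite ler_piMl.
have [t /seg ts|c /seg cs E] := @mvt_dir R _ g w (y - w) 1.
  by apply: diff_derivable; exact: dg.
by move: E; rewrite g0 // mulr0 scale1r [w + _]addrC subrK => /eqP; rewrite subr_eq0 => /eqP.
Qed.

Lemma derive_local_min (V : normedModType R) (g : V -> R) (U : set V) w v :
  open U -> U w -> (forall y, U y -> differentiable g y) ->
  (forall y, U y -> g w <= g y) -> 'D_v g w = 0.
Proof.
move=> oU Uw dg gmin; have [d d0 Hd] := open_ball oU Uw.
pose s := d / (1 + `|v|).
have v1 : 0 < 1 + `|v| by rewrite ltr_pwDl.
have s0 : 0 < s by rewrite divr_gt0.
have seg (t : R) : t \in `]- s, s[ -> U (w + t *: v).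
  rewrite in_itv /= -ltr_norml => ts; apply: Hd; rewrite addrC addKr normrZ.
  have : `|t| * `|v| <= s * `|v| by rewrite ler_wpM2r // ltW.
  have : s * (1 + `|v|) = d by rewrite /s; field; rewrite gt_eqF.
  by rewrite mulrDr mulr1; lra.
have dl (t : R) : t \in `]- s, s[ -> is_derive t 1 (fun t : R => g (w + t *: v))
    ('D_v g (w + t *: v)).
  by move=> /seg Ut; apply: is_derive_line; apply: diff_derivable; exact: dg.
have in0 : (0 : R) \in `]- s, s[ by rewrite in_itv /=; lra.
have [|||_] := @derive1_at_min R (fun t : R => g (w + t *: v)) (- s) s 0 _ _ in0 _.
- lra.
- by move=> t /dl[].
- by move=> t /seg ts; rewrite scale0r addr0; exact: gmin.
by have [_ ->] := dl 0 in0; rewrite scale0r addr0.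
Qed.

(** The first hypothesis equates the two mixed derivatives of one coordinate of xi. [L], [A], [H],
    [M], [V] stand for the derivatives of lambda, of that coordinate of F, of the height, of the
    entry [Nn] of N, and of nu; [S] and [T] are mixed second derivatives. The disjunction separates
    the L^3-coordinates, where dN = dF, from the height, where dN = 0. *)
Lemma codazzi_algebra (l nu L0 L1 A0 A1 H0 H1 S S' T T' Nn M0 M1 V0 V1 : R) :
  - (L0 * A1 + l * S) - (V0 * (H1 * Nn) + nu * (T * Nn + H1 * M0)) =
  - (L1 * A0 + l * S') - (V1 * (H0 * Nn) + nu * (T' * Nn + H0 * M1)) ->
  S = S' -> T = T' -> V0 = - l * H0 -> V1 = - l * H1 ->
  (M0 = A0 /\ M1 = A1) \/ ((M0 = 0 /\ M1 = 0) /\ (A0 = H0 /\ A1 = H1)) ->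
  (L0 - nu * H0) * A1 = (L1 - nu * H1) * A0.
Proof.
move=> SN ES ET E0 E1 EM; move: SN; rewrite ES ET E0 E1.
by case: EM => [[-> ->]|[[-> ->] [-> ->]]]; lra.
Qed.

(** Up to the sign of one component, the cross product c of a and b is proportional to both p and m,
    one timelike and the other spacelike. In squares this reads c_i^2 <q, q> = q_i^2 Q for q = p and
    q = m; the opposite signs of <p, p> and <m, m> give - c_i^4 = (p_i m_i Q)^2, so that c = 0. *)
Lemma lorentz_cross_algebra (p1 p2 p3 m1 m2 m3 a1 a2 a3 b1 b2 b3 : R) :
  - p1 ^+ 2 + p2 ^+ 2 + p3 ^+ 2 = -1 -> - m1 ^+ 2 + m2 ^+ 2 + m3 ^+ 2 = 1 ->
  - (p1 * a1) + p2 * a2 + p3 * a3 = 0 -> - (p1 * b1) + p2 * b2 + p3 * b3 = 0 ->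
  - (m1 * a1) + m2 * a2 + m3 * a3 = 0 -> - (m1 * b1) + m2 * b2 + m3 * b3 = 0 ->
  [/\ a2 * b3 = a3 * b2, a3 * b1 = a1 * b3 & a1 * b2 = a2 * b1].
Proof.
move=> pp mm pa pb ma mb.
pose c1 := a2 * b3 - a3 * b2; pose c2 := a3 * b1 - a1 * b3.
pose c3 := a1 * b2 - a2 * b1; pose Q := - c1 ^+ 2 + c2 ^+ 2 + c3 ^+ 2.
have cross (q1 q2 q3 : R) : - (q1 * a1) + q2 * a2 + q3 * a3 = 0 ->
    - (q1 * b1) + q2 * b2 + q3 * b3 = 0 ->
    [/\ c2 * q3 = c3 * q2, - (c3 * q1) = c1 * q3 & c1 * q2 = - (c2 * q1)].
  move=> qa qb; rewrite /c1 /c2 /c3; split.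
  - have : a1 * (- (q1 * b1) + q2 * b2 + q3 * b3) = b1 * (- (q1 * a1) + q2 * a2 + q3 * a3).
      by rewrite qa qb; ring.
    lra.
  - have : a2 * (- (q1 * b1) + q2 * b2 + q3 * b3) = b2 * (- (q1 * a1) + q2 * a2 + q3 * a3).
      by rewrite qa qb; ring.
    lra.
  - have : a3 * (- (q1 * b1) + q2 * b2 + q3 * b3) = b3 * (- (q1 * a1) + q2 * a2 + q3 * a3).
      by rewrite qa qb; ring.
    lra.
have sq (q1 q2 q3 s : R) : - q1 ^+ 2 + q2 ^+ 2 + q3 ^+ 2 = s ->
    - (q1 * a1) + q2 * a2 + q3 * a3 = 0 -> - (q1 * b1) + q2 * b2 + q3 * b3 = 0 ->
    [/\ c1 ^+ 2 * s = q1 ^+ 2 * Q, c2 ^+ 2 * s = q2 ^+ 2 * Q & c3 ^+ 2 * s = q3 ^+ 2 * Q].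
  move=> <- qa qb; have [e1 e2 e3] := cross _ _ _ qa qb.
  have s1 : (c2 * q3) ^+ 2 = (c3 * q2) ^+ 2 by rewrite e1.
  have s2 : (c3 * q1) ^+ 2 = (c1 * q3) ^+ 2 by rewrite -e2 sqrrN.
  have s3 : (c1 * q2) ^+ 2 = (c2 * q1) ^+ 2 by rewrite e3 sqrrN.
  by rewrite /Q; split; lra.
have [x1 x2 x3] := sq _ _ _ _ pp pa pb; have [y1 y2 y3] := sq _ _ _ _ mm ma mb.
have zero (c q r : R) : c ^+ 2 * -1 = q ^+ 2 * Q -> c ^+ 2 * 1 = r ^+ 2 * Q -> c = 0.
  move=> h1 h2; have : c ^+ 4 * -1 = (q * r * Q) ^+ 2.
    have -> : (q * r * Q) ^+ 2 = (q ^+ 2 * Q) * (r ^+ 2 * Q) by ring.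
    by rewrite -h1 -h2; ring.
  have h := sqr_ge0 (q * r * Q); have h' : 0 <= c ^+ 4 by rewrite (exprM c 2 2) sqr_ge0.
  move=> h4; have /eqP : c ^+ 4 = 0 by lra.
  by rewrite expf_eq0 /= => /eqP.
by split; apply/eqP; rewrite -subr_eq0; apply/eqP;
  [exact: zero x1 y1|exact: zero x2 y2|exact: zero x3 y3].
Qed.

Lemma parallel_rV4 (a b : 'I_4 -> R) : a i4 = 0 -> b i4 = 0 ->
  [/\ a i2 * b i3 = a i3 * b i2, a i3 * b i1 = a i1 * b i3 & a i1 * b i2 = a i2 * b i1] ->
  forall j k, a j * b k = b j * a k.
Proof.
move=> a4 b4 [k1 k2 k3]; apply: ord4P; apply: ord4P; rewrite ?a4 ?b4 ?mulr0 ?mul0r; lra.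
Qed.

End LocalGeometry.

Section UmbilicalEquations.
Context {R : realType} (U : set 'rV[R]_2) (f n : 'rV[R]_2 -> 'rV[R]_4)
  (la : 'rV[R]_2 -> R).
Context (oU : open U) (sf : smooth U f) (sn : smooth U n)
  (fH : forall w, U w -> H2R (f w))
  (ntan : forall w, U w -> H2R_tangent (f w) (n w))
  (nunit : forall w, U w -> lorentz (n w) (n w) = 1)
  (north : forall w X, U w -> lorentz (n w) ('D_X f w) = 0)
  (fimm : forall w X, U w -> 'D_X f w = 0 -> X = 0)
  (umb : forall w X, U w -> 'D_(la w *: X) f w = - H2R_proj (f w) ('D_X n w)).

Let df w : U w -> differentiable f w.
Proof. exact: smooth_differentiable. Qed.

Let dn w : U w -> differentiable n w.
Proof. exact: smooth_differentiable. Qed.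

Let dfj w j : U w -> differentiable (fun y => f y 0 j) w.
Proof. by move=> Uw; apply: differentiable_coordf; exact: df. Qed.

Let dnj w j : U w -> differentiable (fun y => n y 0 j) w.
Proof. by move=> Uw; apply: differentiable_coordf; exact: dn. Qed.

Let DfE w X j : U w -> ('D_X f w) 0 j = 'D_X (fun y => f y 0 j) w.
Proof. by move=> Uw; apply: derive_coordf; apply: diff_derivable; exact: df. Qed.

Let DnE w X j : U w -> ('D_X n w) 0 j = 'D_X (fun y => n y 0 j) w.
Proof. by move=> Uw; apply: derive_coordf; apply: diff_derivable; exact: dn. Qed.

Let N j (w : 'rV[R]_2) : R := H2R_normal (f w) 0 j.

Let N4 w : N i4 w = 0.
Proof. by rewrite /N /H2R_normal mxE. Qed.

Let NE w : [/\ N i1 w = f w 0 i1, N i2 w = f w 0 i2 & N i3 w = f w 0 i3].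
Proof. by rewrite /N /H2R_normal !mxE. Qed.

Let dN j w : U w -> differentiable (N j) w.
Proof.
move=> Uw; move: j; apply: ord4P.
- by rewrite (_ : N i1 = fun y => f y 0 i1); [exact: dfj|apply/funext => y; have [] := NE y].
- by rewrite (_ : N i2 = fun y => f y 0 i2); [exact: dfj|apply/funext => y; have [] := NE y].
- by rewrite (_ : N i3 = fun y => f y 0 i3); [exact: dfj|apply/funext => y; have [] := NE y].
- by rewrite (_ : N i4 = fun=> 0); [exact: differentiable_cst|apply/funext => y; exact: N4].
Qed.

Let DN4 w v : 'D_v (N i4) w = 0.
Proof.
have -> : N i4 = fun=> 0 by apply/funext => y; exact: N4.
exact: derive_cst.
Qed.

(** Umbilicity determines d xi up to its component along N. That component is <N, d xi> = - <dN,
    xi>, from <N, xi> = 0, and <xi, dF> = 0 turns it into nu dh. *)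
Lemma derive_normal w X j : U w ->
  'D_X (fun y => n y 0 j) w = - la w * 'D_X (fun y => f y 0 j) w
    - n w 0 i4 * 'D_X (fun y => f y 0 i4) w * H2R_normal (f w) 0 j.
Proof.
move=> Uw.
have c1 := derive_near_cst X oU Uw (fun y Uy => etrans (esym (lorentz_normalE _ _)) (ntan Uy)).
rewrite derive_prod3 in c1; [|exact: dfj|exact: dfj|exact: dfj|exact: dnj|exact: dnj|exact: dnj].
have c2 := north X Uw; rewrite /lorentz !DfE // in c2.
have c3 : lorentz (H2R_normal (f w)) ('D_X n w) =
    n w 0 i4 * 'D_X (fun y => f y 0 i4) w.
  by rewrite lorentz_normalE !DnE //; lra.
have := congr1 (fun v : 'rV[R]_4 => v 0 j) (umb X Uw).
rewrite derive_scale; last exact: df.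
have comb (s t : R) (x y z : 'rV[R]_4) :
  (s *: x) 0 j = (- (y + t *: z)) 0 j -> s * x 0 j = - (y 0 j + t * z 0 j).
  by rewrite !mxE.
by rewrite /H2R_proj => /comb; rewrite DfE // DnE // c3; lra.
Qed.

Lemma derive_angle w X : U w ->
  'D_X (fun y => n y 0 i4) w = - la w * 'D_X (fun y => f y 0 i4) w.
Proof. by move=> Uw; rewrite derive_normal // [H2R_normal _ _ _]N4 mulr0 subr0. Qed.

Local Notation e i := (delta_mx 0 i : 'rV[R]_2).

(** Since F is an immersion, some coordinate of F has a nonzero first partial derivative at [w],
    hence near [w]. The equation of [derive_normal] for that coordinate can be solved for lambda,
    which becomes a quotient of differentiable functions. *)
Lemma la_differentiable w : U w -> differentiable la w.
Proof.
move=> Uw.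
have [j hj] : exists j, 'D_(e 0) (fun y => f y 0 j) w != 0.
  apply: contrapT => h.
  have : e 0 = 0.
    apply: (fimm Uw); apply/rowP => j; rewrite DfE // mxE.
    by apply/eqP/negPn/negP => hj; apply: h; exists j.
  by move/matrixP/(_ 0 0); rewrite !mxE /= => /eqP; rewrite oner_eq0.
pose b := 'D_(e 0) (fun y => f y 0 j).
pose a := 'D_(e 0) (fun y => n y 0 j).
pose b4 := 'D_(e 0) (fun y => f y 0 i4).
have cf l : Csmooth U (fun y => f y 0 l) by exact: smooth_Csmooth.
have cn l : Csmooth U (fun y => n y 0 l) by exact: smooth_Csmooth.
have db : differentiable b w by exact: (((cf j 2).2 0).1 w Uw).
have da : differentiable a w by exact: (((cn j 2).2 0).1 w Uw).
have db4 : differentiable b4 w by exact: (((cf i4 2).2 0).1 w Uw).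
have near_b : \forall y \near w, b y != 0.
  have cb := differentiable_continuous db.
  by have := cvgr_neq0 _ cb hj; apply.
have nearU : \forall y \near w, U y by exact: (near_open oU).
apply: (@near_eq_differentiable _ _ _
  (fun y => (- 1 : R) * ((a y + n y 0 i4 * (b4 y * N j y)) * (b y)^-1))).
  near=> y.
  have by0 : b y != 0 by near: y.
  have Uy : U y by near: y.
  have ay : a y = - la y * b y - n y 0 i4 * b4 y * N j y.
    exact: derive_normal.
  rewrite ay; field.
  exact: by0.
apply: differentiableM; first exact: differentiable_cst.
apply: differentiableM; last exact: differentiableV.
apply: differentiableD => //; apply: differentiableM; first exact: dnj.
by apply: differentiableM => //; exact: dN.
Unshelve. all: by end_near. Qed.

Lemma codazzi w X : U w ->
  'D_X la w = n w 0 i4 * 'D_X (fun y => f y 0 i4) w.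
Proof.
move=> Uw.
have cf l : Csmooth U (fun y => f y 0 l) by exact: smooth_Csmooth.
have cn l : Csmooth U (fun y => n y 0 l) by exact: smooth_Csmooth.
have dla := la_differentiable Uw.
pose al (i : 'I_2) := 'D_(e i) la w - n w 0 i4 * 'D_(e i) (fun y => f y 0 i4) w.
have key j : al 0 * 'D_(e 1) (fun y => f y 0 j) w =
             al 1 * 'D_(e 0) (fun y => f y 0 j) w.
  have DD i k : 'D_(e i) ('D_(e k) (fun y => n y 0 j)) w =
     - ('D_(e i) la w * 'D_(e k) (fun y => f y 0 j) w
        + la w * 'D_(e i) ('D_(e k) (fun y => f y 0 j)) w)
     - ('D_(e i) (fun y => n y 0 i4) w * ('D_(e k) (fun y => f y 0 i4) w * N j w)
        + n w 0 i4 * ('D_(e i) ('D_(e k) (fun y => f y 0 i4)) w * N j w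
                      + 'D_(e k) (fun y => f y 0 i4) w * 'D_(e i) (N j) w)).
    have dfk l : differentiable ('D_(e k) (fun y => f y 0 l)) w.
      exact: (((cf l 2).2 k).1 w Uw).
    have dM (g h : 'rV[R]_2 -> R) : differentiable g w -> differentiable h w ->
      is_derive w (e i) (fun y => g y * h y) ('D_(e i) g w * h w + g w * 'D_(e i) h w).
      move=> dg dh; have := is_deriveM (derivableP (diff_derivable (v := e i) dg))
         (derivableP (diff_derivable (v := e i) dh)).
      by move/is_derive_eq; apply; rewrite /GRing.scale /=; ring.
    have dMM (g h : 'rV[R]_2 -> R) (dg : differentiable g w) (dh : differentiable h w) :
      differentiable (fun y => g y * h y) w by exact: differentiableM.
    have E1 := dM _ _ dla (dfk j).
    have E3 := dM _ _ (dfk i4) (dN j Uw).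
    have E2 := dM _ _ (dnj i4 Uw) (dMM _ _ (dfk i4) (dN j Uw)).
    have [_ E] := is_deriveB (is_deriveN E1) E2.
    rewrite (_ : 'D_(e i) _ w = 'D_(e i) ((- (fun y => la y * 'D_(e k) (fun z => f z 0 j) y))
      \- (fun y => n y 0 i4 * ('D_(e k) (fun z => f z 0 i4) y * N j y))) w).
      by rewrite E; case: E3 => _ ->.
    apply: near_eq_derive; apply: (near_open oU) => // y Uy.
    by rewrite derive_normal // -mulrA mulNr.
  have SN := etrans (esym (DD 0 1)) (etrans (Schwarz oU Uw (cn j 2)) (DD 1 0)).
  have Sj := Schwarz oU Uw (cf j 2); have S4 := Schwarz oU Uw (cf i4 2).
  have V0 := derive_angle (e 0) Uw; have V1 := derive_angle (e 1) Uw.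
  have NN : ((forall v, 'D_v (N j) w = 0) /\ j = i4) \/
            (forall v, 'D_v (N j) w = 'D_v (fun y => f y 0 j) w).
    move: (j); apply: ord4P.
    - by right=> v; congr ('D_v _ w); apply/funext => y; have [] := NE y.
    - by right=> v; congr ('D_v _ w); apply/funext => y; have [] := NE y.
    - by right=> v; congr ('D_v _ w); apply/funext => y; have [] := NE y.
    - by left; split; [move=> v; exact: DN4|].
  apply: (codazzi_algebra SN Sj S4 V0 V1); case: NN => [[NN j4]|NN].
    right; split; first by split; exact: NN.
    by split; rewrite j4.
  by left; split; exact: NN.
(* By [key] the vector (- al 1, al 0) lies in the kernel of dF, which is trivial. *)
have al0 : al 0 = 0 /\ al 1 = 0.
  pose r : 'rV[R]_2 := \row_i (if i == 0 then - al 1 else al 0).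
  have r0 : r 0 0 = - al 1 by rewrite mxE.
  have r1 : r 0 1 = al 0 by rewrite mxE.
  have rE : 'D_r f w = 0.
    apply/rowP => j.
    have comb (s t : R) (x y : 'rV[R]_4) : (s *: x + t *: y) 0 j = s * x 0 j + t * y 0 j.
      by rewrite !mxE.
    rewrite (derive_rV2 _ (df Uw)) comb r0 r1 (DfE _ _ Uw) (DfE _ _ Uw) [RHS]mxE.
    by rewrite mulNr addrC (key j) subrr.
  have r_eq0 := fimm Uw rE; rewrite r_eq0 mxE in r0; rewrite r_eq0 mxE in r1.
  by split; [exact: esym|apply/eqP; rewrite -oppr_eq0 -r0].
rewrite (derive_rV2 _ dla) (derive_rV2 _ (dfj i4 Uw)).
move: al0; rewrite /al => -[/eqP + /eqP].
by rewrite !subr_eq0 => /eqP -> /eqP ->;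
  rewrite /GRing.scale /= mulrDr; congr (_ + _); rewrite mulrCA.
Qed.

Lemma moment_locally_cst w j : U w -> j != i4 ->
  \forall y \near w, n y 0 j + la y * f y 0 j = n w 0 j + la w * f w 0 j.
Proof.
move=> Uw j4.
have Nj y : H2R_normal (f y) 0 j = f y 0 j.
  move: j j4; apply: ord4P => // _; rewrite /H2R_normal mxE //.
apply: (@zero_derive_locally_cst _ _ (fun y => n y 0 j + la y * f y 0 j) U) => //.
  move=> y Uy; apply: differentiableD; first exact: dnj.
  by apply: differentiableM; [exact: la_differentiable|exact: dfj].
move=> y X Uy; have dl := la_differentiable Uy.
have Dn := derivableP (diff_derivable (v := X) (dnj j Uy)).
have Dl := derivableP (diff_derivable (v := X) dl).
have Df := derivableP (diff_derivable (v := X) (dfj j Uy)).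
have [_ ->] := is_deriveD Dn (is_deriveM Dl Df).
rewrite derive_normal // codazzi // Nj /GRing.scale /=.
move: ('D_X _ y) ('D_X _ y) => s t; ring.
Qed.

Lemma derive_angle0 w X : U w -> 'D_X (fun y => f y 0 i4) w = 0 ->
  'D_X la w = 0 /\ 'D_X (fun y => n y 0 i4) w = 0.
Proof. by move=> Uw h; rewrite codazzi // derive_angle // h !mulr0. Qed.

(** From d lambda = nu dh and d nu = - lambda dh follows nu d lambda - lambda d nu = (lambda^2 +
    nu^2) dh, so that the polar angle of (nu, lambda) has differential dh. *)
Lemma height_locally_cst w : U w -> (forall y, U y -> 0 < n y 0 i4) ->
  \forall y \near w, f y 0 i4 - atan (la y / n y 0 i4) =
                     f w 0 i4 - atan (la w / n w 0 i4).
Proof.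
move=> Uw n4.
have dq y : U y -> differentiable (fun y => la y * (n y 0 i4)^-1) y.
  move=> Uy; apply: differentiableM; first exact: la_differentiable.
  by apply: differentiableV; [exact: dnj|rewrite gt_eqF // n4].
have chain y X Uy := derive_chain X (dq y Uy) (is_derive1_atan (la y / n y 0 i4)).
apply: (@zero_derive_locally_cst _ _ (fun y => f y 0 i4 - atan (la y / n y 0 i4)) U) => //.
  move=> y Uy; apply: differentiableB; first exact: dfj.
  exact: (chain y 0 Uy).1.
move=> y X Uy; have [da Da] := chain y X Uy.
have Df := derivableP (diff_derivable (v := X) (dfj i4 Uy)).
have [_ E] := is_deriveB Df (derivableP (diff_derivable (v := X) da)).
rewrite [LHS]E Da.
have n0 : n y 0 i4 != 0 by rewrite gt_eqF // n4.
have Dl := derivableP (diff_derivable (v := X) (la_differentiable Uy)).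
have dV : differentiable (fun y => (n y 0 i4)^-1) y.
  by apply: differentiableV => //; exact: dnj.
have [_ ->] := is_deriveM Dl (derivableP (diff_derivable (v := X) dV)).
rewrite deriveV //; last by apply: diff_derivable; exact: dnj.
rewrite codazzi // derive_angle // /GRing.scale /=.
move: ('D_X _ y) (n y 0 i4) (la y) n0 => s nu l n0.
have : nu ^+ 2 + l ^+ 2 != 0.
  by rewrite gt_eqF // ltr_pwDl ?sqr_ge0 // exprn_even_gt0.
by move=> nl; field; rewrite n0 nl.
Qed.

(** Where xi is constantly vertical, d nu = 0 and d xi = 0. If lambda were nonzero, the first would
    give dh = 0 and the second dF = 0, against the immersion. *)
Lemma vertical_normal_flat (O : set 'rV[R]_2) w :
  open O -> O `<=` U -> O w -> (forall y, O y -> n y 0 i4 = 1) ->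
  (forall y j, O y -> j != i4 -> n y 0 j = 0) -> la w = 0.
Proof.
move=> oO OU Ow n4 nj; have Uw := OU _ Ow.
apply: contrapT => /eqP l0.
have f4 X : 'D_X (fun y => f y 0 i4) w = 0.
  have := derive_angle X Uw; rewrite (derive_near_cst X oO Ow n4) => /esym/eqP.
  by rewrite mulf_eq0 oppr_eq0 (negbTE l0) /= => /eqP.
have fj X j : 'D_X (fun y => f y 0 j) w = 0.
  have [->|j4] := eqVneq j i4; first exact: f4.
  have := derive_normal X j Uw; rewrite f4 mulr0 mul0r subr0.
  rewrite (derive_near_cst X oO Ow (fun y Oy => nj y j Oy j4)) => /esym/eqP.
  by rewrite mulf_eq0 oppr_eq0 (negbTE l0) /= => /eqP.
have : e 0 = 0.
  by apply: (fimm Uw); apply/rowP => j; rewrite DfE // fj mxE.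
by move/matrixP/(_ 0 0); rewrite !mxE /= => /eqP; rewrite oner_eq0.
Qed.

Lemma angle_gt0 w : U w -> (forall y, U y -> 0 <= n y 0 i4) -> la w != 0 ->
  0 < n w 0 i4.
Proof.
move=> Uw n_ge0 l0; rewrite lt_neqAle n_ge0 // andbT eq_sym; apply/eqP => n0.
have f4 X : 'D_X (fun y => f y 0 i4) w = 0.
  have := derive_angle X Uw.
  rewrite (derive_local_min X oU Uw (fun y => @dnj y i4)); last first.
    by move=> y Uy; rewrite n0; exact: n_ge0.
  by move/esym/eqP; rewrite mulf_eq0 oppr_eq0 (negbTE l0) /= => /eqP.
have [pp _] := fH Uw.
have mm : - n w 0 i1 ^+ 2 + n w 0 i2 ^+ 2 + n w 0 i3 ^+ 2 = 1.
  by have := nunit Uw; rewrite /lorentz n0; lra.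
have fF X : - (f w 0 i1 * 'D_X (fun y => f y 0 i1) w)
    + f w 0 i2 * 'D_X (fun y => f y 0 i2) w + f w 0 i3 * 'D_X (fun y => f y 0 i3) w = 0.
  have c1 : forall y, U y -> - (f y 0 i1 * f y 0 i1) + f y 0 i2 * f y 0 i2 +
      f y 0 i3 * f y 0 i3 = -1 by move=> y /fH[].
  have := derive_near_cst X oU Uw c1.
  rewrite derive_prod3; [|exact: dfj|exact: dfj|exact: dfj|exact: dfj|exact: dfj|exact: dfj].
  move: ('D_X _ w) ('D_X _ w) ('D_X _ w) => s t r; lra.
have nF X : - (n w 0 i1 * 'D_X (fun y => f y 0 i1) w)
    + n w 0 i2 * 'D_X (fun y => f y 0 i2) w + n w 0 i3 * 'D_X (fun y => f y 0 i3) w = 0.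
  by have := north X Uw; rewrite /lorentz !DfE // n0 mul0r addr0.
have K := lorentz_cross_algebra pp mm (fF (e 0)) (fF (e 1)) (nF (e 0)) (nF (e 1)).
have par := @parallel_rV4 _ (fun j => 'D_(e 0) (fun y => f y 0 j) w)
  (fun j => 'D_(e 1) (fun y => f y 0 j) w) (f4 _) (f4 _) K.
(* The two partial derivatives of F being parallel, the vector with components d_1 F_j and - d_0 F_j
   is killed by dF, whatever the index j. *)
have h j : 'D_(e 1) (fun y => f y 0 j) w = 0.
  pose r : 'rV[R]_2 := \row_i (if i == 0 then 'D_(e 1) (fun y => f y 0 j) w
                               else - 'D_(e 0) (fun y => f y 0 j) w).
  have r0 : r 0 0 = 'D_(e 1) (fun y => f y 0 j) w by rewrite mxE.
  have r1 : r 0 1 = - 'D_(e 0) (fun y => f y 0 j) w by rewrite mxE.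
  have rE : 'D_r f w = 0.
    apply/rowP => k.
    have comb (s t : R) (x y : 'rV[R]_4) : (s *: x + t *: y) 0 k = s * x 0 k + t * y 0 k.
      by rewrite !mxE.
    rewrite (derive_rV2 _ (df Uw)) comb r0 r1 (DfE _ _ Uw) (DfE _ _ Uw) [RHS]mxE.
    by rewrite -par mulNr subrr.
  by rewrite -r0 (fimm Uw rE) mxE.
have : e 1 = 0.
  by apply: (fimm Uw); apply/rowP => j; rewrite DfE // h mxE.
by move/matrixP/(_ 0 1); rewrite !mxE /= => /eqP; rewrite oner_eq0.
Qed.

End UmbilicalEquations.

Section PointwiseAlgebra.
Context {R : realType}.
Implicit Types (p v : 'rV[R]_4).

(** A vector of L^3 orthogonal to a timelike one is spacelike or zero, by Cauchy-Schwarz in the last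
    two coordinates. This bounds the vertical component of a unit normal, with equality only for a
    vertical normal. *)
Lemma normal_pythagoras p v : H2R p -> H2R_tangent p v -> lorentz v v = 1 ->
  [/\ v 0 i1 ^+ 2 <= v 0 i2 ^+ 2 + v 0 i3 ^+ 2, v 0 i4 ^+ 2 <= 1 &
      v 0 i4 ^+ 2 = 1 -> [/\ v 0 i1 = 0, v 0 i2 = 0 & v 0 i3 = 0]].
Proof.
move=> [pp p1]; rewrite /H2R_tangent lorentz_normalE /lorentz.
move: (p 0 i1) (p 0 i2) (p 0 i3) pp p1 => a b c pp a0.
move: (v 0 i1) (v 0 i2) (v 0 i3) (v 0 i4) => x y z t tan unit.
have CS : (a * x) ^+ 2 <= (a ^+ 2 - 1) * (y ^+ 2 + z ^+ 2).
  have -> : a * x = b * y + c * z by lra.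
  have -> : a ^+ 2 - 1 = b ^+ 2 + c ^+ 2 by lra.
  by have := sqr_ge0 (b * z - c * y); lra.
have a1 : 1 <= a ^+ 2 by have := sqr_ge0 b; have := sqr_ge0 c; lra.
have yz : 0 <= y ^+ 2 + z ^+ 2 by have := sqr_ge0 y; have := sqr_ge0 z; lra.
have le : x ^+ 2 <= y ^+ 2 + z ^+ 2.
  have a2 : 0 < a ^+ 2 by lra.
  by rewrite -(ler_pM2l a2); lra.
split; [exact: le|lra|move=> t1].
have E : y ^+ 2 + z ^+ 2 = x ^+ 2 by lra.
have x0 : x = 0.
  have : x ^+ 2 = 0.
    by apply: le_anti; rewrite sqr_ge0 andbT; rewrite E in CS; lra.
  by move/eqP; rewrite sqrf_eq0 => /eqP.
rewrite x0 in E; have y2 := sqr_ge0 y; have z2 := sqr_ge0 z.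
have y0 : y ^+ 2 = 0 by lra.
have z0 : z ^+ 2 = 0 by lra.
by split=> //; apply/eqP; rewrite -sqrf_eq0; apply/eqP.
Qed.

Lemma lorentz_e3 v : lorentz e3 v = v 0 i4.
Proof. by rewrite /lorentz /e3 !mxE /=; ring. Qed.

End PointwiseAlgebra.

(** * Constants of the whole connected surface *)

Section GlobalGeometry.
Context {R : realType} {M : topologicalType} (A : set (chart R M))
    (F xi : M -> 'rV[R]_4) (lambda : M -> R)
    (surfM : smooth_surface A) (connM : connected [set: M])
    (immF : isometric_immersion A F)
    (normal_xi : unit_normal A F xi)
    (angle_le : forall p, 0 <= angle xi p <= pi / 2)
    (umbF : totally_umbilical A F xi lambda)
    (not_geodesic : ~ (forall p, lambda p = 0)).

Lemma connected_locally_cst (g : M -> R) :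
  (forall p, \forall q \near p, g q = g p) -> forall p q, g p = g q.
Proof.
move=> lg p q.
have oB (P : R -> Prop) : open [set r | P (g r)].
  rewrite openE => r Pr; near=> s; rewrite /= (_ : g s = g r) //.
  by near: s; exact: lg.
suff : [set r | g r = g p] = setT.
  by move/seteqP => [_ /(_ q I)].
apply: connM.
- by exists p.
- by exists [set r | g r = g p]; [exact: (oB (fun t => t = g p))|rewrite setTI].
- exists [set r | g r = g p]; last by rewrite setTI.
  rewrite -[X in closed X]setCK; apply: open_closedC.
  exact: (oB (fun t => t <> g p)).
Unshelve. all: by end_near. Qed.

Lemma chart_near (y : chart R M) p (P : 'rV[R]_2 -> Prop) : is_chart y ->
  chart_dom y p -> (\forall w \near chart_fun y p, P w) ->
  \forall q \near p, chart_dom y q /\ P (chart_fun y q).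
Proof.
move=> [[od _] _ _ cy _] yp nP; apply: filterI.
  exact: open_nbhs_nbhs.
exact: (cy p yp _ nP).
Qed.

Let U (y : chart R M) := chart_cod y.
Let f (y : chart R M) := F \o chart_inv y.
Let n (y : chart R M) := xi \o chart_inv y.
Let la (y : chart R M) := lambda \o chart_inv y.

Lemma chart_hyps y : A y ->
  [/\ open (chart_cod y), smooth (chart_cod y) (F \o chart_inv y),
      smooth (chart_cod y) (xi \o chart_inv y) &
      forall w X, chart_cod y w -> 'D_X (F \o chart_inv y) w = 0 -> X = 0].
Proof.
move=> Ay; have [_ _ chA _ _] := surfM; have [[_ oc] _ _ _ _] := chA _ Ay.
have [_ sF immF'] := immF; have [sxi _] := normal_xi.
split=> //; [exact: sF|exact: sxi|by move=> w X; exact: immF'].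
Qed.

Let FH p : H2R (F p). Proof. by have [] := immF. Qed.
Let xitan p : H2R_tangent (F p) (xi p).
Proof. by have [_ [/(_ p)[]]] := normal_xi. Qed.
Let xiunit p : lorentz (xi p) (xi p) = 1.
Proof. by have [_ [/(_ p)[]]] := normal_xi. Qed.

Let north y : A y -> forall w X, U y w -> lorentz (n y w) ('D_X (f y) w) = 0.
Proof. by move=> Ay w X Uw; have [_ [_ h]] := normal_xi; exact: (h y w X Ay Uw). Qed.

Let umb y : A y -> forall w X, U y w ->
  'D_(la y w *: X) (f y) w = - H2R_proj (f y w) ('D_X (n y) w).
Proof. by move=> Ay w X Uw; exact: (umbF X Ay Uw). Qed.

Let ntan y w : U y w -> H2R_tangent (f y w) (n y w).
Proof. by move=> _; exact: xitan. Qed.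

Lemma cos_angle p : cos (angle xi p) = xi p 0 i4.
Proof.
have [_ h _] := normal_pythagoras (FH p) (xitan p) (xiunit p).
rewrite /angle lorentz_e3 acosK // in_itv /=.
by rewrite -ler_norml -(@ler_pXn2r _ 2) ?nnegrE // expr1n -normrX ger0_norm // sqr_ge0.
Qed.

Lemma angle_height_ge0 p : 0 <= xi p 0 i4.
Proof.
rewrite -cos_angle; apply: cos_ge0_pihalf; have /andP[h0 ->] := angle_le p.
by rewrite andbT (le_trans _ h0) // oppr_le0 divr_ge0 // pi_ge0.
Qed.

Let moment j p : R := xi p 0 j + lambda p * F p 0 j.

Lemma moment_cst j p q : j != i4 -> moment j p = moment j q.
Proof.
move=> j4; move: p q; apply: connected_locally_cst => p.
have [_ _ chA cov _] := surfM; have [y Ay yp] := cov p.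
have [oc sf sn im] := chart_hyps Ay; have cy := chA _ Ay.
have [_ yK _ _ _] := cy; have [Uw wK] := yK p yp.
have nP := moment_locally_cst oc sf sn (@ntan y) (north Ay) im (umb Ay) Uw j4.
have := chart_near cy yp nP; apply: filterS => q [yq].
by rewrite /la /= wK (yK q yq).2.
Qed.

Lemma lambda_moment p :
  lambda p = moment i1 p * F p 0 i1 - moment i2 p * F p 0 i2 - moment i3 p * F p 0 i3.
Proof.
have [pp _] := FH p; have t := xitan p; rewrite /H2R_tangent lorentz_normalE in t.
have -> : lambda p = lambda p * - (- F p 0 i1 ^+ 2 + F p 0 i2 ^+ 2 + F p 0 i3 ^+ 2).
  by rewrite pp opprK mulr1.
by rewrite /moment; lra.
Qed.

Lemma lambda_angle_moment p : lambda p ^+ 2 + xi p 0 i4 ^+ 2 =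
  1 + moment i1 p ^+ 2 - moment i2 p ^+ 2 - moment i3 p ^+ 2.
Proof.
have [pp _] := FH p; have t := xitan p; rewrite /H2R_tangent lorentz_normalE in t.
have u := xiunit p; rewrite /lorentz in u; rewrite /moment.
have e1 : lambda p ^+ 2 * (- F p 0 i1 ^+ 2 + F p 0 i2 ^+ 2 + F p 0 i3 ^+ 2) = - lambda p ^+ 2.
  by rewrite pp; ring.
have e2 : lambda p * (- (F p 0 i1 * xi p 0 i1) + F p 0 i2 * xi p 0 i2 + F p 0 i3 * xi p 0 i3) = 0.
  by rewrite t mulr0.
lra.
Qed.

Lemma moment_neq0 p : ~ [/\ moment i1 p = 0, moment i2 p = 0 & moment i3 p = 0].
Proof.
move=> [m1 m2 m3]; apply: not_geodesic => q; rewrite lambda_moment.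
by rewrite (moment_cst q p) // (@moment_cst i2 q p) // (@moment_cst i3 q p) //
  m1 m2 m3; ring.
Qed.

(** The argument at a minimum of nu requires lambda to be nonzero there. If lambda and nu vanished
    together, the constant lambda^2 + nu^2 would be 0, which fails at a point where lambda is
    nonzero. *)
Lemma angle_height_gt0 p : 0 < xi p 0 i4.
Proof.
have [q lq] : exists q, lambda q != 0.
  apply: contrapT => h; apply: not_geodesic => q; apply: contrapT => /eqP lq.
  by apply: h; exists q.
have [lp|lp] := eqVneq (lambda p) 0; last first.
  have [_ _ chA cov _] := surfM; have [y Ay yp] := cov p.
  have [oc sf sn im] := chart_hyps Ay; have cy := chA _ Ay.
  have [_ yK _ _ _] := cy; have [Uw wK] := yK p yp.
  have := @angle_gt0 _ _ _ _ _ oc sf sn (fun w _ => FH _) (@ntan y)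
    (fun w _ => xiunit _) (north Ay) im (umb Ay) _ Uw (fun w _ => angle_height_ge0 _).
  by rewrite /la /= wK => /(_ lp).
rewrite lt_neqAle angle_height_ge0 andbT eq_sym; apply/eqP => x0.
have := lambda_angle_moment q; have := lambda_angle_moment p.
rewrite (@moment_cst i1 q p) // (@moment_cst i2 q p) // (@moment_cst i3 q p) // => <-.
rewrite lp x0 => h; have l2 : 0 < lambda q ^+ 2 by rewrite exprn_even_gt0.
by have := sqr_ge0 (xi q 0 i4); lra.
Qed.

Lemma height_cst p q : F p 0 i4 - atan (lambda p / xi p 0 i4) =
                       F q 0 i4 - atan (lambda q / xi q 0 i4).
Proof.
move: p q; apply: (@connected_locally_cst
  (fun p => F p 0 i4 - atan (lambda p / xi p 0 i4))) => p.
have [_ _ chA cov _] := surfM; have [y Ay yp] := cov p.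
have [oc sf sn im] := chart_hyps Ay; have cy := chA _ Ay.
have [_ yK _ _ _] := cy; have [Uw wK] := yK p yp.
have nP := height_locally_cst oc sf sn (@ntan y) (north Ay) im (umb Ay) Uw
  (fun w _ => angle_height_gt0 _).
have := chart_near cy yp nP; apply: filterS => q [yq].
by rewrite /la /= wK (yK q yq).2.
Qed.

(** On an open set where theta = 0 the normal is vertical, hence lambda = 0, hence P = 0; then
    lambda = - <P, N> would vanish on the whole surface. *)
Lemma angle_neq0_dense : dense [set p | angle xi p != 0].
Proof.
move=> O [p Op] oO; apply: contrapT => h.
have a0 q : O q -> angle xi q = 0.
  by move=> Oq; apply: contrapT => /eqP aq; apply: h; exists q.
have x1 q : O q -> xi q 0 i4 = 1 by move=> /a0 aq; rewrite -cos_angle aq cos0.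
have xj q : O q -> [/\ xi q 0 i1 = 0, xi q 0 i2 = 0 & xi q 0 i3 = 0].
  move=> /x1 xq; have [_ _] := normal_pythagoras (FH q) (xitan q) (xiunit q).
  by apply; rewrite xq expr1n.
have [_ _ chA cov _] := surfM; have [y Ay yp] := cov p.
have [oc sf sn im] := chart_hyps Ay; have cy := chA _ Ay.
have [_ yK _ _ ciy] := cy; have [Uw wK] := yK p yp.
have oO' : open [set w | chart_cod y w /\ O (chart_inv y w)].
  exact: (@open_preim _ _ (chart_cod y) _ (chart_inv y)).
have := vertical_normal_flat oc sf sn (@ntan y) (north Ay) im (umb Ay) oO'
  (fun w (h : _ /\ _) => h.1) (w := chart_fun y p).
rewrite /la /= wK => /(_ (conj Uw Op)) l0.
have {}l0 : lambda p = 0.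
  apply: l0 => [w [_ Ow]|w j [_ Ow]]; first exact: x1.
  have [k1 k2 k3] := xj _ Ow; move: j; apply: ord4P => //.
apply: (@moment_neq0 p); have [k1 k2 k3] := xj _ Op.
by rewrite /moment l0 k1 k2 k3; split; ring.
Qed.

Lemma surface_moment : exists P1 P2 P3 h0 : R,
  [/\ P1 != 0 \/ P2 != 0 \/ P3 != 0,
      forall p, lambda p = P1 * F p 0 i1 - P2 * F p 0 i2 - P3 * F p 0 i3,
      forall p, lambda p ^+ 2 + xi p 0 i4 ^+ 2 = 1 + P1 ^+ 2 - P2 ^+ 2 - P3 ^+ 2 &
      forall p, F p 0 i4 = h0 + atan (lambda p / xi p 0 i4)].
Proof.
have [p _] : exists p : M, True.
  by apply: contrapT => h; apply: not_geodesic => p; case: h; exists p.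
exists (moment i1 p), (moment i2 p), (moment i3 p),
  (F p 0 i4 - atan (lambda p / xi p 0 i4)); split.
- apply: contrapT => h; apply: (@moment_neq0 p).
  by split; apply: contrapT => /eqP k; apply: h; [left|right; left|right; right].
- by move=> q; rewrite lambda_moment (@moment_cst i1 q p) // (@moment_cst i2 q p) //
    (@moment_cst i3 q p).
- by move=> q; rewrite lambda_angle_moment (@moment_cst i1 q p) // (@moment_cst i2 q p) //
    (@moment_cst i3 q p).
- by move=> q; rewrite (height_cst p q) subrK.
Qed.

End GlobalGeometry.

(** * Smooth functions on the surface *)

Section SmoothFunctions.
Context {R : realType} {M : topologicalType} (A : set (chart R M))
  (surfM : smooth_surface A).
Implicit Types (W : set M) (g : M -> R).

Definition msmooth W g := forall y, A y ->
  Csmooth [set w | chart_cod y w /\ W (chart_inv y w)] (g \o chart_inv y).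

Lemma chart_open W y : open W -> A y ->
  open [set w | chart_cod y w /\ W (chart_inv y w)].
Proof.
move=> oW Ay; have [_ _ chA _ _] := surfM; have [[_ oc] _ _ _ ciy] := chA _ Ay.
exact: (@open_preim _ _ (chart_cod y) W (chart_inv y)).
Qed.

Lemma msmooth_cst W c : msmooth W (fun=> c).
Proof. by move=> y Ay k; exact: Ck_cst. Qed.

Lemma msmooth_add W g g' : open W -> msmooth W g -> msmooth W g' ->
  msmooth W (fun q => g q + g' q).
Proof.
by move=> oW sg sg' y Ay k; apply: (Ck_add (chart_open oW Ay) (sg y Ay k) (sg' y Ay k)).
Qed.

Lemma msmooth_mul W g g' : open W -> msmooth W g -> msmooth W g' ->
  msmooth W (fun q => g q * g' q).
Proof.
by move=> oW sg sg' y Ay k; apply: (Ck_mul (chart_open oW Ay) (sg y Ay k) (sg' y Ay k)).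
Qed.

Lemma msmooth_opp W g : open W -> msmooth W g -> msmooth W (fun q => - g q).
Proof.
move=> oW sg; rewrite (_ : (fun q => - g q) = fun q => -1 * g q).
  by apply: msmooth_mul => //; exact: msmooth_cst.
by apply/funext => q; rewrite mulN1r.
Qed.

Lemma msmooth_inv W g : open W -> (forall q, W q -> g q != 0) -> msmooth W g ->
  msmooth W (fun q => (g q)^-1).
Proof.
move=> oW g0 sg y Ay k; apply: (Ck_inv (chart_open oW Ay) _ (sg y Ay k)).
by move=> w [_ Ww]; exact: g0.
Qed.

Lemma msmooth_ln W g : open W -> (forall q, W q -> 0 < g q) -> msmooth W g ->
  msmooth W (fun q => ln (g q)).
Proof.
move=> oW g0 sg y Ay k; apply: (Ck_ln (chart_open oW Ay) _ (sg y Ay k)).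
by move=> w [_ Ww]; exact: g0.
Qed.

Lemma msmooth_atan W g : open W -> msmooth W g -> msmooth W (fun q => atan (g q)).
Proof.
by move=> oW sg y Ay k; apply: (Ck_atan (chart_open oW Ay) (sg y Ay k)).
Qed.

Lemma msmooth_coord W n (f : M -> 'rV[R]_n.+1) j : open W -> smooth_map A f ->
  msmooth W (fun q => f q 0 j).
Proof.
move=> oW sf y Ay k.
have [_ _ chA _ _] := surfM; have [[_ oc] _ _ _ _] := chA _ Ay.
have := smooth_Csmooth j oc (sf y Ay) k.
by apply: Ck_sub => w [].
Qed.

Lemma msmooth_continuous W g q : open W -> msmooth W g -> W q ->
  {for q, continuous g}.
Proof.
move=> oW sg Wq; have [_ _ chA cov _] := surfM; have [y Ay yq] := cov q.
have [[od _] yK _ cy _] := chA _ Ay.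
have [cq qK] := yK q yq.
have c : {for q, continuous (g \o chart_inv y \o chart_fun y)}.
  apply: continuous_comp; first exact: cy.
  apply: (Ck_continuous (sg y Ay 0)); split=> //.
  by rewrite qK.
rewrite /prop_for /continuous_at (_ : g q = (g \o chart_inv y \o chart_fun y) q); last first.
  by rewrite /= qK.
apply: cvg_trans c; apply: near_eq_cvg.
apply: filterS (open_nbhs_nbhs (conj od yq)) => r yr.
by rewrite /= (yK r yr).2.
Qed.

Lemma msmooth_open_pos W g : open W -> msmooth W g -> open [set q | W q /\ 0 < g q].
Proof.
move=> oW sg; apply: (@open_preim _ _ W [set r : R | 0 < r] g) => //.
by move=> q; exact: msmooth_continuous.
Qed.

(* The tangent vector with components X at chart_inv y w is in the kernel of dg. *)
Definition flat (y : chart R M) w X g :=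
  differentiable (g \o chart_inv y) w /\ 'D_X (g \o chart_inv y) w = 0.

Lemma flat_cst y w X c : flat y w X (fun=> c).
Proof. by split; [exact: differentiable_cst|exact: derive_cst]. Qed.

Lemma flat_add y w X g g' : flat y w X g -> flat y w X g' ->
  flat y w X (fun q => g q + g' q).
Proof.
move=> [d e] [d' e']; split; first exact: (differentiableD d d').
have [_ h] := is_deriveD (derivableP (diff_derivable (v := X) d))
  (derivableP (diff_derivable (v := X) d')).
by rewrite [LHS]h e e' addr0.
Qed.

Lemma flat_mul y w X g g' : flat y w X g -> flat y w X g' ->
  flat y w X (fun q => g q * g' q).
Proof.
move=> [d e] [d' e']; split; first exact: (differentiableM d d').
have [_ h] := is_deriveM (derivableP (diff_derivable (v := X) d))
  (derivableP (diff_derivable (v := X) d')).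
by rewrite [LHS]h e e' !scaler0 addr0.
Qed.

Lemma flat_opp y w X g : flat y w X g -> flat y w X (fun q => - g q).
Proof.
move=> h; rewrite (_ : (fun q => - g q) = fun q => -1 * g q).
  by apply: flat_mul => //; exact: flat_cst.
by apply/funext => q; rewrite mulN1r.
Qed.

Lemma flat_comp y w X g (phi : R -> R) : flat y w X g ->
  derivable phi (g (chart_inv y w)) 1 -> flat y w X (fun q => phi (g q)).
Proof.
move=> [d e] dphi; have [dc h] := derive_chain X d (derivableP dphi).
by split=> //; rewrite [LHS]h e mulr0.
Qed.

Lemma flat_eq (W : set M) y w X g g' : open W -> A y -> chart_cod y w ->
  W (chart_inv y w) -> (forall q, W q -> g q = g' q) ->
  flat y w X g -> flat y w X g'.
Proof.
move=> oW Ay cw Ww gg' [d e].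
have nE : \forall z \near w, (g \o chart_inv y) z = (g' \o chart_inv y) z.
  by apply: (near_open (chart_open oW Ay)) => // z [_ Wz]; exact: gg'.
split; first exact: near_eq_differentiable d.
by rewrite -(near_eq_derive X nE).
Qed.

End SmoothFunctions.

(** * Coordinates built from the height and one more function *)

Section SurfaceCoordinates.
Context {R : realType} {M : topologicalType} (A : set (chart R M))
    (F xi : M -> 'rV[R]_4) (lambda : M -> R)
    (surfM : smooth_surface A)
    (immF : isometric_immersion A F)
    (normal_xi : unit_normal A F xi)
    (umbF : totally_umbilical A F xi lambda).

(** The hypotheses isolate what each case supplies: the height as a function of u, and the other
    coordinates of F as functions of lambda, nu and v, of which only the infinitesimal consequence
    at [p] is asked. *)
Lemma surface_coordinates p (W : set M) (u v : M -> R) (h : R -> R) :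
  open W -> W p -> msmooth A W u -> msmooth A W v ->
  (forall q, W q -> F q 0 i4 = h (u q)) -> derivable h (u p) 1 ->
  (forall y w X, A y -> chart_cod y w -> chart_inv y w = p ->
     flat y w X lambda -> flat y w X (fun q => xi q 0 i4) -> flat y w X v ->
     forall j, j != i4 -> flat y w X (fun q => F q 0 j)) ->
  exists (x : chart R M) (r : R), [/\ local_coordinates A x, chart_dom x p, 0 < r,
    chart_cod x = [set w | u p - r < w 0 0 < u p + r /\ v p - r < w 0 1 < v p + r] &
    forall u' v', u p - r < u' < u p + r -> v p - r < v' < v p + r ->
      let q := chart_inv x (vec2 u' v') in [/\ W q, u q = u' & v q = v']].
Proof.
move=> oW Wp su sv hu dh hflat.
have [_ _ chA cov _] := surfM; have [y Ay yp] := cov p.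
have [oc sf sn im] := chart_hyps surfM immF normal_xi Ay.
have [_ yK _ _ _] := chA _ Ay; have [cp pK] := yK p yp.
pose w := chart_fun y p; pose O := [set w | chart_cod y w /\ W (chart_inv y w)].
have oO : open O by exact: (chart_open surfM).
have Op : O w by split=> //; rewrite /w pK.
pose phi w := vec2 (u (chart_inv y w)) (v (chart_inv y w)).
have phi0 : (fun z => phi z 0 0) = u \o chart_inv y by apply/funext => z; rewrite mxE.
have phi1 : (fun z => phi z 0 1) = v \o chart_inv y by apply/funext => z; rewrite mxE.
have sphi j : Csmooth O (fun z => phi z 0 j).
  by move: j; apply: ord2P; [rewrite phi0; exact: su|rewrite phi1; exact: sv].
have ntan z : chart_cod y z -> H2R_tangent ((F \o chart_inv y) z) ((xi \o chart_inv y) z).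
  by move=> _; have [_ [/(_ (chart_inv y z))[]]] := normal_xi.
have north z X : chart_cod y z -> lorentz ((xi \o chart_inv y) z) ('D_X (F \o chart_inv y) z) = 0.
  by move=> cz; have [_ [_ H]] := normal_xi; exact: (H y z X Ay cz).
have umb z X : chart_cod y z -> 'D_((lambda \o chart_inv y) z *: X) (F \o chart_inv y) z =
    - H2R_proj ((F \o chart_inv y) z) ('D_X (xi \o chart_inv y) z).
  by move=> cz; exact: (umbF X Ay cz).
have [||x [r [lx xp r0 cx Hx]]] := @adapted_chart _ _ A y p O phi surfM Ay yp oO _ Op sphi.
- by move=> z [].
- move=> X DX.
  have dphi : differentiable phi w.
    by apply: differentiable_mxP => j; exact: (Csmooth_differentiable (sphi j)).
  have Dj j : 'D_X (fun z => phi z 0 j) w = 0.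
    by rewrite -derive_coordf ?DX ?mxE //; exact: diff_derivable.
  have fu : flat y w X u.
    by have := Dj 0; rewrite phi0 => e; split=> //; exact: (Csmooth_differentiable (su y Ay)).
  have fv : flat y w X v.
    by have := Dj 1; rewrite phi1 => e; split=> //; exact: (Csmooth_differentiable (sv y Ay)).
  have fF4 : flat y w X (fun q => F q 0 i4).
    apply: (flat_eq surfM oW Ay cp Op.2 (fun q Wq => esym (hu q Wq))).
    by apply: flat_comp => //; rewrite /w pK.
  have [Dl Dn] := derive_angle0 oc sf sn ntan north im umb cp fF4.2.
  have dl := la_differentiable oc sf sn ntan north im umb cp.
  have fl : flat y w X lambda by split.
  have fn : flat y w X (fun q => xi q 0 i4).
    by split=> //; apply: differentiable_coordf; exact: (smooth_differentiable oc sn cp).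
  have fF j : flat y w X (fun q => F q 0 j).
    by have [->//|j4] := eqVneq j i4; exact: hflat.
  apply: (im w X cp); apply/rowP => j; rewrite mxE derive_coordf; first exact: (fF j).2.
  apply: diff_derivable; exact: (smooth_differentiable oc sf cp).
have z00 : phi (chart_fun y p) 0 0 = u p by rewrite mxE /= pK.
have z01 : phi (chart_fun y p) 0 1 = v p by rewrite mxE /= pK.
rewrite z00 z01 in cx.
exists x, r; split=> // u' v' hu' hv'.
have cw : chart_cod x (vec2 u' v') by rewrite cx /= !mxE.
have [dq [_ Wq] E] := Hx _ cw; have [_ qK] := yK _ dq.
rewrite qK in Wq; split=> //.
  by have := congr1 (fun z : 'rV[R]_2 => z 0 0) E; rewrite /phi !mxE /= qK.
by have := congr1 (fun z : 'rV[R]_2 => z 0 1) E; rewrite /phi !mxE /= qK.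
Qed.

End SurfaceCoordinates.

(** * Lorentz frames *)

Section Isometries.
Context {R : realType}.

Lemma mulmx4E m n (x : 'M[R]_(m, 4)) (J : 'M[R]_(4, n)) i j : (x *m J) i j =
  x i i1 * J i1 j + x i i2 * J i2 j + x i i3 * J i3 j + x i i4 * J i4 j.
Proof.
rewrite mxE !big_ord_recl big_ord0 addr0 !addrA.
by congr (x _ _ * J _ _ + x _ _ * J _ _ + x _ _ * J _ _ + x _ _ * J _ _); apply/val_inj.
Qed.

Lemma vec4E (a b c d : R) : [/\ vec4 a b c d 0 i1 = a, vec4 a b c d 0 i2 = b,
  vec4 a b c d 0 i3 = c & vec4 a b c d 0 i4 = d].
Proof. by split; rewrite mxE. Qed.

Lemma smooth_affine m n (L : 'M[R]_(m.+1, n.+1)) c :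
  smooth setT (fun x : 'rV[R]_m.+1 => x *m L + c) /\
  forall v x, 'D_v (fun x : 'rV[R]_m.+1 => x *m L + c) x = v *m L.
Proof.
have dL v x : is_derive x v (fun x : 'rV[R]_m.+1 => x *m L + c) (v *m L).
  have [d E] := derive_mulmx L v (@ex_diff _ _ _ _ _ _ _ (is_diff_id x)).
  have := is_deriveD (derivableP (diff_derivable (v := v) d)) (is_derive_cst c x v).
  by move/is_derive_eq; apply; rewrite E derive_id addr0.
split; last by move=> v x; case: (dL v x).
have cst_smooth k (w : 'rV[R]_n.+1) : class_C k setT ((fun=> w) : 'rV[R]_m.+1 -> 'rV[R]_n.+1).
  elim: k w => [|k IH] w /=; first by move=> x _; exact: cst_continuous.
  move=> i; split; first by move=> x _; exact: derivable_cst.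
  rewrite (_ : 'D_(delta_mx 0 i) _ = fun=> 0) //.
  by apply/funext => x; rewrite derive_cst.
case=> [|k] /=.
  by move=> x _; apply: continuousD; [exact: mulmx_continuous|exact: cst_continuous].
move=> i; split; first by move=> x _; case: (dL (delta_mx 0 i) x).
rewrite (_ : 'D_(delta_mx 0 i) _ = fun=> delta_mx 0 i *m L) //.
by apply/funext => x; case: (dL (delta_mx 0 i) x).
Qed.

(** Cauchy-Schwarz in the last two coordinates, each of whose squared lengths is one less than the
    square of the first coordinate. The signs of [b] and [c] are free, so that the Lorentz product
    is covered as well. *)
Lemma hyperboloid_pos (p1 p2 p3 a b c : R) :
  - p1 ^+ 2 + p2 ^+ 2 + p3 ^+ 2 = -1 -> 0 < p1 ->
  - a ^+ 2 + b ^+ 2 + c ^+ 2 = -1 -> 0 < a -> 0 < p1 * a + p2 * b + p3 * c.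
Proof.
move=> pp p0 aa a0.
have CS : (p2 * b + p3 * c) ^+ 2 <= (p1 ^+ 2 - 1) * (a ^+ 2 - 1).
  have -> : p1 ^+ 2 - 1 = p2 ^+ 2 + p3 ^+ 2 by lra.
  have -> : a ^+ 2 - 1 = b ^+ 2 + c ^+ 2 by lra.
  by have := sqr_ge0 (p2 * c - p3 * b); lra.
have lt : (p2 * b + p3 * c) ^+ 2 < (p1 * a) ^+ 2.
  have : 1 <= p1 ^+ 2 by have := sqr_ge0 p2; have := sqr_ge0 p3; lra.
  have : 1 <= a ^+ 2 by have := sqr_ge0 b; have := sqr_ge0 c; lra.
  have -> : (p1 * a) ^+ 2 = p1 ^+ 2 * a ^+ 2 by ring.
  by lra.
have : `|p2 * b + p3 * c| < p1 * a.
  rewrite -(@ltr_pXn2r _ 2) ?nnegrE //; last by rewrite mulr_ge0 // ltW.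
  by rewrite -normrX ger0_norm // sqr_ge0.
by rewrite ltr_norml => /andP[]; lra.
Qed.

(** Otherwise the opposite vector would lie on the upper sheet, and its product with p would have
    the wrong sign. *)
Lemma hyperboloid_future (p1 p2 p3 a b c : R) :
  - p1 ^+ 2 + p2 ^+ 2 + p3 ^+ 2 = -1 -> 0 < p1 ->
  - a ^+ 2 + b ^+ 2 + c ^+ 2 = -1 -> 0 < p1 * a - p2 * b - p3 * c -> 0 < a.
Proof.
move=> pp p0 aa h; rewrite ltNge; apply/negP => a0.
have a1 : 0 < - a.
  rewrite lt_neqAle oppr_ge0 a0 andbT eq_sym oppr_eq0; apply/eqP => a00.
  by have := sqr_ge0 b; have := sqr_ge0 c; rewrite a00 in aa; lra.
have := @hyperboloid_pos p1 p2 p3 (- a) b c pp p0; rewrite sqrrN => /(_ aa a1); lra.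
Qed.

(* The rows (a1, a2, a3), (b1, b2, b3), (c1, c2, c3) form a Lorentz-orthonormal
   frame of L^3 whose first vector is timelike and future-directed. *)
Definition lorentz_frame (a1 a2 a3 b1 b2 b3 c1 c2 c3 : R) : Prop :=
  [/\ - a1 ^+ 2 + a2 ^+ 2 + a3 ^+ 2 = -1, - b1 ^+ 2 + b2 ^+ 2 + b3 ^+ 2 = 1,
      - c1 ^+ 2 + c2 ^+ 2 + c3 ^+ 2 = 1 & 0 < a1] /\
  [/\ - (a1 * b1) + a2 * b2 + a3 * b3 = 0, - (a1 * c1) + a2 * c2 + a3 * c3 = 0 &
      - (b1 * c1) + b2 * c2 + b3 * c3 = 0].

(** The third vector is the Lorentz cross product, that is the Euclidean one with the sign of its
    first component reversed. Its square is given by the Lagrange identity <a, b>^2 - <a, a> <b,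
    b>. *)
Lemma frame_complete (a1 a2 a3 b1 b2 b3 : R) :
  - a1 ^+ 2 + a2 ^+ 2 + a3 ^+ 2 = -1 -> - b1 ^+ 2 + b2 ^+ 2 + b3 ^+ 2 = 1 ->
  - (a1 * b1) + a2 * b2 + a3 * b3 = 0 -> 0 < a1 ->
  lorentz_frame a1 a2 a3 b1 b2 b3
    (- (a2 * b3 - a3 * b2)) (a3 * b1 - a1 * b3) (a1 * b2 - a2 * b1).
Proof.
move=> aa bb ab a0; split; last by split=> //; ring.
split=> //.
have -> : - (- (a2 * b3 - a3 * b2)) ^+ 2 + (a3 * b1 - a1 * b3) ^+ 2 + (a1 * b2 - a2 * b1) ^+ 2 =
  (- (a1 * b1) + a2 * b2 + a3 * b3) ^+ 2
  - (- a1 ^+ 2 + a2 ^+ 2 + a3 ^+ 2) * (- b1 ^+ 2 + b2 ^+ 2 + b3 ^+ 2) by ring.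
by rewrite aa bb ab; ring.
Qed.

Lemma frame_swap (a1 a2 a3 b1 b2 b3 c1 c2 c3 : R) :
  lorentz_frame a1 a2 a3 b1 b2 b3 c1 c2 c3 -> lorentz_frame a1 a2 a3 c1 c2 c3 b1 b2 b3.
Proof. by move=> [[? ? ? ?] [? ? ?]]; split; split=> //; lra. Qed.

(* Coordinates of the H^2-component of z along a timelike (tcoord) or spacelike
   (scoord) unit vector of a Lorentz-orthonormal frame. *)
Definition tcoord (a1 a2 a3 : R) (z : 'rV[R]_4) : R :=
  z 0 i1 * a1 - z 0 i2 * a2 - z 0 i3 * a3.

Definition scoord (a1 a2 a3 : R) (z : 'rV[R]_4) : R :=
  - (z 0 i1 * a1) + z 0 i2 * a2 + z 0 i3 * a3.

Lemma frame_isometry (a1 a2 a3 b1 b2 b3 c1 c2 c3 t : R) :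
  lorentz_frame a1 a2 a3 b1 b2 b3 c1 c2 c3 ->
  exists2 Phi, H2R_isometry Phi & forall z : 'rV[R]_4, H2R z ->
    let x1 := tcoord a1 a2 a3 z in let x2 := scoord b1 b2 b3 z in
    let x3 := scoord c1 c2 c3 z in
    [/\ - x1 ^+ 2 + x2 ^+ 2 + x3 ^+ 2 = -1 /\ 0 < x1,
        Phi (vec4 x1 x2 x3 (z 0 i4 - t)) = z,
        z 0 i1 = x1 * a1 + x2 * b1 + x3 * c1,
        z 0 i2 = x1 * a2 + x2 * b2 + x3 * c2 &
        z 0 i3 = x1 * a3 + x2 * b3 + x3 * c3].
Proof.
move=> [[aa bb cc a0] [ab ac bc]].
(* The rows of [L] are the frame and the vertical direction; [L'] below is its transpose for the
   Lorentz metric, hence its inverse. *)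
pose L : 'M[R]_4 := \matrix_(i, j) (nth [::] [:: [:: a1; a2; a3; 0];
  [:: b1; b2; b3; 0]; [:: c1; c2; c3; 0]; [:: 0; 0; 0; 1]] i)`_j.
pose L' : 'M[R]_4 := \matrix_(i, j) (nth [::] [:: [:: a1; - b1; - c1; 0];
  [:: - a2; b2; c2; 0]; [:: - a3; b3; c3; 0]; [:: 0; 0; 0; 1]] i)`_j.
have LE (v : 'rV[R]_4) : [/\ (v *m L) 0 i1 = v 0 i1 * a1 + v 0 i2 * b1 + v 0 i3 * c1,
   (v *m L) 0 i2 = v 0 i1 * a2 + v 0 i2 * b2 + v 0 i3 * c2,
   (v *m L) 0 i3 = v 0 i1 * a3 + v 0 i2 * b3 + v 0 i3 * c3 &
   (v *m L) 0 i4 = v 0 i4].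
  by split; rewrite mulmx4E !mxE /=; ring.
have LE' (v : 'rV[R]_4) : [/\ (v *m L') 0 i1 = v 0 i1 * a1 - v 0 i2 * a2 - v 0 i3 * a3,
   (v *m L') 0 i2 = - (v 0 i1 * b1) + v 0 i2 * b2 + v 0 i3 * b3,
   (v *m L') 0 i3 = - (v 0 i1 * c1) + v 0 i2 * c2 + v 0 i3 * c3 &
   (v *m L') 0 i4 = v 0 i4].
  by split; rewrite mulmx4E !mxE /=; ring.
have LL' : L *m L' = 1%:M.
  apply/matrixP; apply: ord4P; apply: ord4P; rewrite mulmx4E !mxE /=; lra.
have L'L : L' *m L = 1%:M by exact: mulmx1C.
(* The first column of a Lorentz matrix is a unit timelike vector too; together with 0 < a1 it shows
   that [L] preserves the sheet x_1 > 0. *)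
have col : - a1 ^+ 2 + b1 ^+ 2 + c1 ^+ 2 = -1.
  by have := congr1 (fun K : 'M[R]_4 => K i1 i1) L'L; rewrite mulmx4E !mxE /=; lra.
have Llor v w : lorentz (v *m L) (w *m L) = lorentz v w.
  rewrite /lorentz; have [-> -> -> ->] := LE v; have [-> -> -> ->] := LE w.
  move: (v 0 i1) (v 0 i2) (v 0 i3) (v 0 i4) (w 0 i1) (w 0 i2) (w 0 i3) (w 0 i4).
  move=> v1 v2 v3 v4 w1 w2 w3 w4.
  have -> : - ((v1 * a1 + v2 * b1 + v3 * c1) * (w1 * a1 + w2 * b1 + w3 * c1)) +
    (v1 * a2 + v2 * b2 + v3 * c2) * (w1 * a2 + w2 * b2 + w3 * c2) +
    (v1 * a3 + v2 * b3 + v3 * c3) * (w1 * a3 + w2 * b3 + w3 * c3) + v4 * w4 =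
    v1 * w1 * (- a1 ^+ 2 + a2 ^+ 2 + a3 ^+ 2) + v2 * w2 * (- b1 ^+ 2 + b2 ^+ 2 + b3 ^+ 2)
    + v3 * w3 * (- c1 ^+ 2 + c2 ^+ 2 + c3 ^+ 2)
    + (v1 * w2 + v2 * w1) * (- (a1 * b1) + a2 * b2 + a3 * b3)
    + (v1 * w3 + v3 * w1) * (- (a1 * c1) + a2 * c2 + a3 * c3)
    + (v2 * w3 + v3 * w2) * (- (b1 * c1) + b2 * c2 + b3 * c3) + v4 * w4 by ring.
  by rewrite aa bb cc ab ac bc; ring.
have H2RE (z : 'rV[R]_4) : H2R z <-> lorentz z z - z 0 i4 ^+ 2 = -1 /\ 0 < z 0 i1.
  by rewrite /H2R /lorentz /=; split=> -[h h0]; split=> //; lra.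
pose shift4 : 'rV[R]_4 := t *: e3.
have s4 : [/\ shift4 0 i1 = 0, shift4 0 i2 = 0, shift4 0 i3 = 0 & shift4 0 i4 = t].
  by split; rewrite !mxE /= ?mulr0 ?mulr1.
have [s41 s42 s43 s44] := s4.
have shiftE (z : 'rV[R]_4) : [/\ (z + shift4) 0 i1 = z 0 i1, (z + shift4) 0 i2 = z 0 i2,
    (z + shift4) 0 i3 = z 0 i3 & (z + shift4) 0 i4 = z 0 i4 + t].
  by split; rewrite mxE ?s41 ?s42 ?s43 ?s44 ?addr0.
have H2Rshift (z : 'rV[R]_4) : H2R (z + shift4) <-> H2R z.
  by rewrite /H2R /=; have [-> -> -> _] := shiftE z.
have H2RL (z : 'rV[R]_4) : H2R z -> H2R (z *m L).
  move=> hz; have [z1 z2] := hz; have [k1 _] := (H2RE z).1 hz; apply/H2RE.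
  have [e1 _ _ e4] := LE z; rewrite Llor e4 e1; split=> //.
  exact: hyperboloid_pos z1 z2 col a0.
have H2RL' (z : 'rV[R]_4) : H2R z -> H2R (z *m L').
  move=> hz; have [z1 z2] := hz; have [k1 _] := (H2RE z).1 hz; apply/H2RE.
  rewrite -Llor -mulmxA L'L mulmx1; have [-> _ _ ->] := LE' z; split=> //.
  have := @hyperboloid_pos _ _ _ a1 (- a2) (- a3) z1 z2; rewrite !sqrrN => /(_ aa a0).
  lra.
pose Phi z := z *m L + shift4; pose Psi z := z *m L' + - shift4 *m L'.
have [sPhi dPhi] := smooth_affine L shift4.
have [sPsi _] := smooth_affine L' (- shift4 *m L').
have PsiE z : Psi z = (z - shift4) *m L' by rewrite mulmxDl.
exists Phi.
  split=> //; split.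
    exists Psi; split=> // z hz; rewrite !PsiE /Phi; split.
    - by apply/H2Rshift; exact: H2RL.
    - by apply: H2RL'; apply/H2Rshift; rewrite subrK.
    - by rewrite addrK -mulmxA LL' mulmx1.
    - by rewrite -mulmxA L'L mulmx1 subrK.
  by move=> z v w _ _ _; rewrite !dPhi Llor.
move=> z hz; rewrite /tcoord /scoord; have [k1 k2 k3 k4] := LE' (z - shift4).
have sub j : (z - shift4) 0 j = z 0 j - shift4 0 j by exact: rV_subE.
have zL : z = (z - shift4) *m L' *m L + shift4 by rewrite -mulmxA L'L mulmx1 subrK.
have [h1 h2] : H2R ((z - shift4) *m L').
  by apply: H2RL'; apply/H2Rshift; rewrite subrK.
move: h1 h2; rewrite k1 k2 k3 !sub s41 s42 s43 !subr0 => h1 h2.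
have [l1 l2 l3 _] := LE ((z - shift4) *m L').
have [m1 m2 m3 _] := shiftE ((z - shift4) *m L' *m L).
split=> //; last 3 first.
- by rewrite {1}zL m1 l1 k1 k2 k3 !sub s41 s42 s43 !subr0.
- by rewrite {1}zL m2 l2 k1 k2 k3 !sub s41 s42 s43 !subr0.
- by rewrite {1}zL m3 l3 k1 k2 k3 !sub s41 s42 s43 !subr0.
rewrite /Phi [RHS]zL; congr (_ *m L + _); apply/rowP.
have [n1 n2 n3 n4] := vec4E
  (z 0 i1 * a1 - z 0 i2 * a2 - z 0 i3 * a3) (- (z 0 i1 * b1) + z 0 i2 * b2 + z 0 i3 * b3)
  (- (z 0 i1 * c1) + z 0 i2 * c2 + z 0 i3 * c3) (z 0 i4 - t).
by apply: ord4P; rewrite ?k1 ?k2 ?k3 ?k4 ?n1 ?n2 ?n3 ?n4 !sub ?s41 ?s42 ?s43 ?s44 ?subr0.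
Qed.

End Isometries.

(** * Formulas in one variable *)

Section OneVariable.
Context {R : realType}.
Implicit Types (f g : R -> R) (x df dg : R).

Lemma is_derive1_mul f g x df dg : is_derive x 1 f df -> is_derive x 1 g dg ->
  is_derive x 1 (fun t => f t * g t) (df * g x + f x * dg).
Proof.
move=> hf hg; have := is_deriveM hf hg; move/is_derive_eq; apply.
by rewrite /GRing.scale /=; ring.
Qed.

Lemma is_derive1_scal (k : R) f x df : is_derive x 1 f df ->
  is_derive x 1 (fun t => k * f t) (k * df).
Proof.
move=> hf; have := is_derive1_mul (is_derive_cst k x 1) hf.
by move/is_derive_eq; apply; rewrite mul0r add0r.
Qed.

Lemma is_derive1_div f g x df dg :
  is_derive x 1 f df -> is_derive x 1 g dg -> g x != 0 ->
  is_derive x 1 (fun t => f t / g t) ((df * g x - f x * dg) / g x ^+ 2).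
Proof.
move=> hf hg g0; have := is_derive1_mul hf (is_deriveV g0 hg).
move/is_derive_eq; apply; rewrite /GRing.scale /=; field; exact: g0.
Qed.

Lemma is_derive1_atan_comp g x dg : is_derive x 1 g dg ->
  is_derive x 1 (fun t => atan (g t)) (dg / (1 + g x ^+ 2)).
Proof.
move=> hg; have := @is_derive1_comp R atan g x _ _ (is_derive1_atan (g x)) hg.
by move/is_derive_eq; apply; rewrite mulrC.
Qed.

Lemma is_derive1_exp_scal (k x : R) :
  is_derive x 1 (fun t => expR (k * t)) (k * expR (k * x)).
Proof.
have hk := is_derive1_scal k (is_derive_id x 1).
have := @is_derive1_comp R expR _ x _ _ (is_derive_expR (k * x)) hk.
by move/is_derive_eq; apply; rewrite mulr1 mulrC.
Qed.

Lemma acos_sin_cos (nu : R) : 0 < nu <= 1 ->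
  [/\ acos nu = atan (Num.sqrt (1 - nu ^+ 2) / nu),
      sin (acos nu) = Num.sqrt (1 - nu ^+ 2) &
      Num.sqrt (1 - nu ^+ 2) ^+ 2 = 1 - nu ^+ 2].
Proof.
move=> /andP[n0 n1].
have nn : nu ^+ 2 <= 1 by rewrite expr_le1 // ltW.
have S2 : Num.sqrt (1 - nu ^+ 2) ^+ 2 = 1 - nu ^+ 2 by rewrite sqr_sqrtr // subr_ge0.
split=> //; last by rewrite sin_acos // n1 andbT (le_trans _ (ltW n0)) // lerN10.
set y := _ / nu.
have y0 : 0 <= y by rewrite divr_ge0 ?sqrtr_ge0 // ltW.
have -> : nu = cos (atan y).
  rewrite cos_atan /y expr_div_n S2.
  have -> : 1 + (1 - nu ^+ 2) / nu ^+ 2 = (nu^-1) ^+ 2 by field; rewrite gt_eqF.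
  by rewrite sqrtr_sqr ger0_norm ?invr_ge0 ?invrK // ltW.
rewrite cosK // in_itv /= -{1}(@atan0 R) le_atan //=.
by apply: ltW; apply: lt_trans (atan_ltpi2 y) _; rewrite ltr_pdivrMr // ltr_pMr ?pi_gt0 // ltr1n.
Qed.

Lemma polar (x y : R) : 0 < x ->
  x = Num.sqrt (x ^+ 2 + y ^+ 2) * cos (atan (y / x)) /\
  y = Num.sqrt (x ^+ 2 + y ^+ 2) * sin (atan (y / x)).
Proof.
move=> x0; have xn : x != 0 by rewrite gt_eqF.
have cE : x = Num.sqrt (x ^+ 2 + y ^+ 2) * cos (atan (y / x)).
  have -> : x ^+ 2 + y ^+ 2 = x ^+ 2 * (1 + (y / x) ^+ 2) by field.
  rewrite sqrtrM ?sqr_ge0 // sqrtr_sqr gtr0_norm // cos_atan mulfK //.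
  by rewrite sqrtr_eq0 -ltNge ltr_pwDl // sqr_ge0.
split=> //; have c0 : cos (atan (y / x)) != 0.
  by apply/eqP => c0; move: cE xn; rewrite c0 mulr0 => ->; rewrite eqxx.
have -> : sin (atan (y / x)) = y / x * cos (atan (y / x)).
  have h : sin (atan (y / x)) / cos (atan (y / x)) = y / x by exact: atanK.
  by rewrite -[LHS](divfK c0) h.
by rewrite mulrCA -cE divfK.
Qed.

(** The number v is the inverse hyperbolic tangent of y / x, written as a logarithm; its exponential
    is (x + y) / r. *)
Lemma hyperbolic_polar (x y r : R) : 0 < r -> 0 < x -> x ^+ 2 - y ^+ 2 = r ^+ 2 ->
  let v := ln ((x + y) / (x - y)) / 2 in x = r * cosh v /\ y = r * sinh v.
Proof.
move=> r0 x0 xy v; have r2 : 0 < r ^+ 2 by rewrite exprn_gt0.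
have yx : `|y| < x.
  have x_ge0 := ltW x0.
  by rewrite -(@ltr_pXn2r _ 2) ?nnegrE // -normrX ger0_norm ?sqr_ge0 //; lra.
have [p1 p2] : 0 < x + y /\ 0 < x - y by move: yx; rewrite ltr_norml => /andP[]; split; lra.
have q0 : 0 < (x + y) / (x - y) by rewrite divr_gt0.
have e2 : expR v ^+ 2 = (x + y) / (x - y).
  by rewrite -expRM_natl mulrC /v divfK // lnK // posrE.
have ev : expR v = (x + y) / r.
  apply/eqP; rewrite -(eqrXn2 (n := 2)) ?expR_ge0 ?divr_ge0 ?ltW // e2.
  rewrite expr_div_n -xy; apply/eqP; field.
  by rewrite xy !gt_eqF.
have rr : r / (x + y) = (x - y) / r.
  have -> : r / (x + y) = r ^+ 2 / (r * (x + y)) by field; rewrite !gt_eqF.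
  by rewrite -xy subr_sqr; field; rewrite !gt_eqF.
by rewrite /cosh /sinh expRN ev invf_div rr; split; field; rewrite gt_eqF.
Qed.

End OneVariable.

(** * The explicit functions of u in the three cases *)

Section Formulas.
Context {R : realType}.

(** With E the exponential of e c u and S = sin theta, the formula for theta reads S (a - E^2) = 2 c
    E nu. This quadratic equation has discriminant 4 L^2 and the positive root E = (L - c nu) / S,
    so that E^2 = a (L - c nu) / (L + c nu); [u] is its logarithm, rescaled. The function [h] is
    lambda / nu rewritten in u. *)
Lemma theta_i_formulas (c e nu L : R) : 0 < c -> e ^+ 2 = 1 -> 0 < nu < 1 -> 0 < L ->
  L ^+ 2 + nu ^+ 2 = 1 + c ^+ 2 ->
  let a := 1 + c ^+ 2 in
  let u := e / (2 * c) * ln (a * ((L - c * nu) / (L + c * nu))) in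
  let h := fun t => e * c * ((a + expR (e * 2 * c * t)) / (a - expR (e * 2 * c * t))) in
  [/\ 0 < L - c * nu, theta_i c e u = acos nu, lambda_of (theta_i c e) u = e * L,
      is_derive u 1 (fun t => atan (h t)) (sin (theta_i c e u) ^+ 2) &
      h u = e * L / nu].
Proof.
move=> c0 e2 /andP[n0 n1] L0 LN a u h.
have a0 : 0 < a by rewrite /a ltr_pwDl // sqr_ge0.
have n2 : 0 < 1 - nu ^+ 2 by rewrite subr_gt0 expr_lt1 // ltW.
have cn0 : 0 < c * nu by rewrite mulr_gt0.
have prod : (L - c * nu) * (L + c * nu) = a * (1 - nu ^+ 2) by rewrite /a; lra.
have p0 : 0 < L + c * nu by lra.
have m0 : 0 < L - c * nu by rewrite -(pmulr_lgt0 _ p0) prod mulr_gt0.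
set Y := a * ((L - c * nu) / (L + c * nu)) in u *.
have Y0 : 0 < Y by rewrite mulr_gt0 // divr_gt0.
have [c_n n_n p_n a_n] : [/\ c != 0, nu != 0, L + c * nu != 0 & a != 0].
  by rewrite !gt_eqF.
pose E := expR (e * c * u).
have uE : e * c * u = ln Y / 2.
  rewrite /u; have -> : e * c * (e / (2 * c) * ln Y) = e ^+ 2 * (ln Y / 2) by field.
  by rewrite e2 mul1r.
have YE : expR (e * 2 * c * u) = Y.
  have -> : e * 2 * c * u = 2 * (e * c * u) by ring.
  by rewrite uE mulrC divfK // lnK.
have E2 : E ^+ 2 = Y by rewrite /E uE -expRM_natl mulrC divfK // lnK.
have E0 : 0 < E := expR_gt0 _.
have aY : a - Y = a * (2 * c * nu) / (L + c * nu) by rewrite /Y; field.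
have aY' : a + Y = a * (2 * L) / (L + c * nu) by rewrite /Y; field.
have aY0 : 0 < a - Y by rewrite aY divr_gt0 // mulr_gt0 // !mulr_gt0.
have [acosE sinE S2] : [/\ acos nu = atan (Num.sqrt (1 - nu ^+ 2) / nu),
      sin (acos nu) = Num.sqrt (1 - nu ^+ 2) &
      Num.sqrt (1 - nu ^+ 2) ^+ 2 = 1 - nu ^+ 2] by apply: acos_sin_cos; rewrite n0 ltW.
set S := Num.sqrt (1 - nu ^+ 2) in acosE sinE S2.
have S0 : 0 < S by rewrite sqrtr_gt0.
have SE : E * (L + c * nu) = a * S.
  apply/eqP; rewrite -(eqrXn2 (n := 2)) ?mulr_ge0 ?ltW //.
  rewrite !exprMn E2 S2 /Y; apply/eqP.
  have -> : a ^+ 2 * (1 - nu ^+ 2) = a * ((L - c * nu) * (L + c * nu)) by rewrite prod; ring.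
  by field.
have gE : 2 * c * E / (a - Y) = S / nu.
  rewrite aY; have -> : 2 * c * E / (a * (2 * c * nu) / (L + c * nu)) =
     (E * (L + c * nu)) / (a * nu) by field; rewrite c_n n_n p_n a_n.
  by rewrite SE; field; rewrite n_n a_n.
have thE : theta_i c e u = acos nu.
  by rewrite /theta_i -/E YE gE acosE.
have aYn : a - Y != 0 by rewrite gt_eqF.
have dY : is_derive u 1 (fun t => expR (e * 2 * c * t)) (e * 2 * c * Y).
  by rewrite -{1}YE; exact: is_derive1_exp_scal.
have dE : is_derive u 1 (fun t => expR (e * c * t)) (e * c * E) by exact: is_derive1_exp_scal.
have dth : is_derive u 1 (theta_i c e) (e * L * S).
  have dden : is_derive u 1 (fun t => a - expR (e * 2 * c * t)) (0 - e * 2 * c * Y).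
    exact: is_deriveB (is_derive_cst a u 1) dY.
  have dn0 : a - expR (e * 2 * c * u) != 0 by rewrite YE.
  have := is_derive1_atan_comp (is_derive1_div (is_derive1_scal (2 * c) dE) dden dn0).
  move/is_derive_eq; apply; rewrite YE -/E gE.
  have -> : 1 + (S / nu) ^+ 2 = (nu ^+ 2)^-1 by rewrite expr_div_n S2; field.
  rewrite invrK.
  have -> : (2 * c * (e * c * E) * (a - Y) - 2 * c * E * (0 - e * 2 * c * Y)) / (a - Y) ^+ 2 =
     e * c * (2 * c * E / (a - Y)) * ((a + Y) / (a - Y)) by field.
  rewrite gE aY aY'; field; by rewrite c_n n_n p_n a_n.
have hu : h u = e * L / nu.
  by rewrite /h YE aY aY'; field; rewrite c_n n_n p_n a_n.
have laE : lambda_of (theta_i c e) u = e * L.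
  by rewrite /lambda_of thE sinE derive1E; case: dth => _ ->; rewrite mulfK // gt_eqF.
suff dh : is_derive u 1 (fun t => atan (h t)) (sin (theta_i c e u) ^+ 2).
  by split; [exact: m0|exact: thE|exact: laE|exact: dh|exact: hu].
have dnum : is_derive u 1 (fun t => a + expR (e * 2 * c * t)) (0 + e * 2 * c * Y).
  exact: is_deriveD (is_derive_cst a u 1) dY.
have dden : is_derive u 1 (fun t => a - expR (e * 2 * c * t)) (0 - e * 2 * c * Y).
  exact: is_deriveB (is_derive_cst a u 1) dY.
have dn0 : a - expR (e * 2 * c * u) != 0 by rewrite YE.
have := is_derive1_atan_comp (is_derive1_scal (e * c) (is_derive1_div dnum dden dn0)).
move/is_derive_eq; apply; rewrite -/(h u) hu YE thE sinE S2.
have -> : 1 + (e * L / nu) ^+ 2 = a / nu ^+ 2.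
  have -> : (e * L / nu) ^+ 2 = e ^+ 2 * L ^+ 2 / nu ^+ 2 by field.
  by rewrite e2 /a -LN; field.
have -> : e * c * (((0 + e * 2 * c * Y) * (a - Y) - (a + Y) * (0 - e * 2 * c * Y)) / (a - Y) ^+ 2) =
   e ^+ 2 * (4 * c ^+ 2 * a * Y / (a - Y) ^+ 2) by field.
rewrite e2 aY /Y.
have -> : 1 - nu ^+ 2 = (L - c * nu) * (L + c * nu) / a by rewrite prod; field.
by field; rewrite c_n n_n p_n a_n.
Qed.

(** Here sin theta = |lambda| = - e lambda, so that cot theta = e u means u = - nu / lambda. Then
    lambda / nu is - 1 / u, which produces the constant e pi / 2 between the two arctangents. *)
Lemma theta_ii_formulas (e la nu : R) : e ^+ 2 = 1 -> 0 < nu -> 0 < - (e * la) ->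
  la ^+ 2 + nu ^+ 2 = 1 ->
  let u := - nu / la in
  [/\ theta_ii e u = acos nu, lambda_ii e u = la,
      Num.sqrt (1 + u ^+ 2) = (- (e * la))^-1 &
      atan (la / nu) = atan u - e * (pi / 2)].
Proof.
move=> e2 n0 m0 ln u.
have l0 : la != 0 by apply/eqP => l0; move: m0; rewrite l0 mulr0 oppr0 ltxx.
have m2 : (e * la) ^+ 2 = la ^+ 2 by rewrite exprMn e2 mul1r.
have sq : Num.sqrt (1 + u ^+ 2) = (- (e * la))^-1.
  have -> : 1 + u ^+ 2 = ((- (e * la))^-1) ^+ 2.
    rewrite exprVn sqrrN m2 /u expr_div_n sqrrN.
    have -> : nu ^+ 2 = 1 - la ^+ 2 by lra.
    by field.
  by rewrite sqrtr_sqr ger0_norm // invr_ge0 ltW.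
have n1 : nu <= 1.
  by have n_ge0 := ltW n0; rewrite -(@expr_le1 _ 2) //; have := sqr_ge0 la; lra.
have [acosE sinE S2] : [/\ acos nu = atan (Num.sqrt (1 - nu ^+ 2) / nu),
      sin (acos nu) = Num.sqrt (1 - nu ^+ 2) &
      Num.sqrt (1 - nu ^+ 2) ^+ 2 = 1 - nu ^+ 2] by apply: acos_sin_cos; rewrite n0.
have SE : Num.sqrt (1 - nu ^+ 2) = - (e * la).
  have -> : 1 - nu ^+ 2 = (- (e * la)) ^+ 2 by rewrite sqrrN m2; lra.
  by rewrite sqrtr_sqr ger0_norm // ltW.
have eu : e * u = nu / (- (e * la)).
  rewrite /u; have e0 : e != 0.
    by apply/eqP => e0; move: e2; rewrite e0 expr0n => /eqP; rewrite eq_sym oner_eq0.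
  have -> : e * (- nu / la) = - nu * e ^+ 2 / (e * la) by field; rewrite e0 l0.
  by rewrite e2; field; rewrite e0 l0.
have eu0 : 0 < e * u by rewrite eu divr_gt0.
have inv_atan (x : R) : 0 < x -> atan x^-1 = pi / 2 - atan x.
  move=> x0; have xn : x != 0 by rewrite gt_eqF.
  have at0 : 0 < atan x by rewrite -(@atan0 R) lt_atan.
  have cx : cos (atan x^-1) = cos (pi / 2 - atan x).
    rewrite cos_atan cosB cos_pihalf sin_pihalf mul0r add0r mul1r.
    have h : sin (atan x) / cos (atan x) = x by exact: atanK.
    have c0 : cos (atan x) != 0.
      by apply/eqP => c0; move: h xn; rewrite c0 invr0 mulr0 => <-; rewrite eqxx.
    rewrite -[RHS](divfK c0) h cos_atan.
    have -> : 1 + x^-1 ^+ 2 = x ^- 2 * (1 + x ^+ 2) by field.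
    by rewrite sqrtrM ?invr_ge0 ?sqr_ge0 // -exprVn sqrtr_sqr invfM gtr0_norm ?invr_gt0 ?invrK.
  apply: cos_inj cx; rewrite in_itv /=.
    rewrite -{1}(@atan0 R) le_atan ?invr_ge0 ?ltW //=.
    by apply: lt_trans (atan_ltpi2 _) _; rewrite ltr_pdivrMr // ltr_pMr ?pi_gt0 // ltr1n.
  have := atan_ltpi2 x; have := @pi_gt0 R; lra.
have e_or : e = 1 \/ e = -1.
  have : (e - 1) * (e + 1) = 0 by lra.
  by move/eqP; rewrite mulf_eq0 => /orP[/eqP|/eqP] h; [left|right]; lra.
have acE : acos nu = pi / 2 - atan (e * u).
  by rewrite acosE SE -inv_atan // eu invf_div.
split=> //.
- rewrite /lambda_ii sq invrK; have -> : - e * - (e * la) = e ^+ 2 * la by ring.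
  by rewrite e2 mul1r.
- have lu : la / nu = - e * (e * u)^-1.
    rewrite eu invf_div.
    have -> : - e * (- (e * la) / nu) = e ^+ 2 * (la / nu) by field; rewrite gt_eqF.
    by rewrite e2 mul1r.
  rewrite lu; case: e_or eu0 => ->.
    by rewrite mul1r => u0; rewrite mulN1r atanN inv_atan //; lra.
  by rewrite mulN1r => u0; rewrite opprK mul1r inv_atan // atanN; lra.
Qed.

(** The formula for theta fixes only sin (s u) = tan c cot theta, leaving two branches of the
    arcsine. Prescribing cot (s u) = - lambda / (nu s) selects the branch by the sign of lambda.
    Since s u then ranges in ]0, pi[, the sign e = 1 accounts for both signs of lambda. *)
Lemma theta_iii_formulas (c la nu : R) : 0 < sin c -> 0 < cos c -> 0 < nu < 1 ->
  la ^+ 2 + nu ^+ 2 = cos c ^+ 2 ->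
  let s := sin c in
  let u := (pi / 2 + atan (la / (nu * s))) / s in
  let h := fun t => - s * (cos (s * t) / sin (s * t)) in
  [/\ theta_iii c 1 u = acos nu, lambda_of (theta_iii c 1) u = la,
      is_derive u 1 (fun t => atan (h t)) (sin (theta_iii c 1 u) ^+ 2) &
      h u = la / nu].
Proof.
move=> s0 k0 /andP[n0 n1] ln s u h.
have n2 : 0 < 1 - nu ^+ 2 by rewrite subr_gt0 expr_lt1 // ltW.
have [acosE sinE S2] : [/\ acos nu = atan (Num.sqrt (1 - nu ^+ 2) / nu),
      sin (acos nu) = Num.sqrt (1 - nu ^+ 2) &
      Num.sqrt (1 - nu ^+ 2) ^+ 2 = 1 - nu ^+ 2] by apply: acos_sin_cos; rewrite n0 ltW.
set S := Num.sqrt (1 - nu ^+ 2) in acosE sinE S2.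
have S0 : 0 < S by rewrite sqrtr_gt0.
set k := cos c in k0 ln.
have sk : s ^+ 2 = 1 - k ^+ 2 by have := cos2Dsin2 c; rewrite -/k -/s; lra.
have [s_n k_n n_n S_n] : [/\ s != 0, k != 0, nu != 0 & S != 0] by rewrite !gt_eqF.
pose y := la / (nu * s); pose cy := nu * s / (k * S).
have cosy : cos (atan y) = cy.
  rewrite cos_atan.
  have -> : 1 + y ^+ 2 = (cy^-1) ^+ 2.
    have -> : 1 + y ^+ 2 = (la ^+ 2 + nu ^+ 2 * s ^+ 2) / (nu ^+ 2 * s ^+ 2).
      by rewrite /y; field; rewrite n_n s_n.
    have -> : la ^+ 2 + nu ^+ 2 * s ^+ 2 = k ^+ 2 * S ^+ 2.
      by rewrite S2 sk -ln; ring.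
    by rewrite /cy; field; rewrite n_n s_n k_n S_n.
  by rewrite sqrtr_sqr ger0_norm ?invrK // invr_ge0 divr_ge0 // ltW // mulr_gt0.
have cy0 : 0 < cy by rewrite divr_gt0 // mulr_gt0.
have cy_n : cy != 0 by rewrite gt_eqF.
have siny : sin (atan y) = y * cy.
  have E : sin (atan y) / cos (atan y) = y by exact: atanK.
  by rewrite -[in RHS]E cosy divfK.
have us : s * u = pi / 2 + atan y by rewrite /u mulrC divfK.
have sinu : sin (s * u) = cy by rewrite us sinD sin_pihalf cos_pihalf mul1r mul0r addr0.
have cosu : cos (s * u) = - (y * cy).
  by rewrite us cosD sin_pihalf cos_pihalf mul1r mul0r sub0r siny.
have gE : tan c / sin (s * u) = S / nu.
  by rewrite sinu /tan -/k -/s /cy; field; rewrite n_n s_n k_n S_n.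
have thF : theta_iii c 1 = fun t => atan (tan c / sin (s * t)).
  by apply/funext => t; rewrite /theta_iii mul1r [t * _]mulrC.
have thE : theta_iii c 1 u = acos nu by rewrite thF gE acosE.
have dsu : is_derive u 1 (fun t : R => s * t) s.
  by have := is_derive1_scal s (is_derive_id u 1); rewrite mulr1.
have dsin : is_derive u 1 (fun t => sin (s * t)) (- (y * cy) * s).
  by have := @is_derive1_comp R sin _ u _ _ (is_derive_sin (s * u)) dsu; rewrite cosu.
have dcos : is_derive u 1 (fun t => cos (s * t)) (- cy * s).
  by have := @is_derive1_comp R cos _ u _ _ (is_derive_cos (s * u)) dsu; rewrite sinu.
have sin_n : sin (s * u) != 0 by rewrite sinu.
have nS : 1 + (S / nu) ^+ 2 = (nu ^+ 2)^-1 by rewrite expr_div_n S2; field.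
have dth : is_derive u 1 (theta_iii c 1) (la * S).
  rewrite thF.
  have := is_derive1_atan_comp (is_derive1_div (is_derive_cst (tan c) u 1) dsin sin_n).
  move/is_derive_eq; apply; rewrite gE nS invrK sinu.
  have -> : (0 * cy - tan c * (- (y * cy) * s)) / cy ^+ 2 = tan c / cy * (y * s) by field.
  by rewrite -sinu gE /y; field; rewrite n_n s_n.
have laE : lambda_of (theta_iii c 1) u = la.
  by rewrite /lambda_of thE sinE derive1E; case: dth => _ ->; rewrite mulfK.
have hu : h u = la / nu.
  by rewrite /h sinu cosu /y; field; rewrite cy_n n_n s_n.
suff dh : is_derive u 1 (fun t => atan (h t)) (sin (theta_iii c 1 u) ^+ 2).
  by split; [exact: thE|exact: laE|exact: dh|exact: hu].
have := is_derive1_atan_comp (is_derive1_scal (- s) (is_derive1_div dcos dsin sin_n)).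
move/is_derive_eq; apply; rewrite -/(h u) hu thE sinE sinu cosu.
have -> : 1 + (la / nu) ^+ 2 = k ^+ 2 / nu ^+ 2.
  by rewrite -ln; field.
have -> : - s * ((- cy * s * cy - - (y * cy) * (- (y * cy) * s)) / cy ^+ 2) =
  s ^+ 2 * (1 + y ^+ 2) by field.
have -> : 1 + y ^+ 2 = (cy^-1) ^+ 2.
  have -> : 1 + y ^+ 2 = (la ^+ 2 + nu ^+ 2 * s ^+ 2) / (nu ^+ 2 * s ^+ 2).
    by rewrite /y; field; rewrite n_n s_n.
  have -> : la ^+ 2 + nu ^+ 2 * s ^+ 2 = k ^+ 2 * S ^+ 2.
    by rewrite S2 sk -ln; ring.
  by rewrite /cy; field; rewrite n_n s_n k_n S_n.
by rewrite /cy; field; rewrite n_n s_n k_n S_n.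
Qed.
End Formulas.

(** * Frames adapted to a vector *)

Section Frames.
Context {R : realType}.

(** The first vector is P, normalised and made future-directed; the second is the direction of the
    component of n orthogonal to it, so that n has a positive second coordinate. That component is
    nonzero by the strict inequality, which expresses nu < 1. *)
Lemma frame_timelike (P1 P2 P3 n1 n2 n3 c e : R) : 0 < c -> e ^+ 2 = 1 ->
  P1 ^+ 2 - P2 ^+ 2 - P3 ^+ 2 = c ^+ 2 -> 0 < e * P1 ->
  - n1 ^+ 2 + n2 ^+ 2 + n3 ^+ 2 = -1 ->
  c ^+ 2 < (P1 * n1 - P2 * n2 - P3 * n3) ^+ 2 ->
  exists b1 b2 b3 c1 c2 c3,
    lorentz_frame (e * P1 / c) (e * P2 / c) (e * P3 / c) b1 b2 b3 c1 c2 c3 /\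
    0 < - (n1 * b1) + n2 * b2 + n3 * b3.
Proof.
move=> c0 e2 PP eP nn Pn; have c_n : c != 0 by rewrite gt_eqF.
pose a1 := e * P1 / c; pose a2 := e * P2 / c; pose a3 := e * P3 / c.
have aa : - a1 ^+ 2 + a2 ^+ 2 + a3 ^+ 2 = -1.
  have -> : - a1 ^+ 2 + a2 ^+ 2 + a3 ^+ 2 = - e ^+ 2 * (P1 ^+ 2 - P2 ^+ 2 - P3 ^+ 2) / c ^+ 2.
    by rewrite /a1 /a2 /a3; field.
  by rewrite PP e2; field.
have a0 : 0 < a1 by rewrite divr_gt0.
pose x := n1 * a1 - n2 * a2 - n3 * a3.
have x2 : 1 < x ^+ 2.
  have -> : x ^+ 2 = e ^+ 2 * ((P1 * n1 - P2 * n2 - P3 * n3) ^+ 2 / c ^+ 2).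
    by rewrite /x /a1 /a2 /a3; field.
  by rewrite e2 mul1r ltr_pdivlMr ?mul1r // exprn_gt0.
pose r := Num.sqrt (x ^+ 2 - 1).
have r0 : 0 < r by rewrite sqrtr_gt0 subr_gt0.
have r_n : r != 0 by rewrite gt_eqF.
have r2 : r ^+ 2 = x ^+ 2 - 1 by rewrite sqr_sqrtr // subr_ge0 ltW.
pose b1 := (n1 - x * a1) / r; pose b2 := (n2 - x * a2) / r; pose b3 := (n3 - x * a3) / r.
have na : - (n1 * a1) + n2 * a2 + n3 * a3 = - x by rewrite /x; ring.
have bb : - b1 ^+ 2 + b2 ^+ 2 + b3 ^+ 2 = 1.
  have -> : - b1 ^+ 2 + b2 ^+ 2 + b3 ^+ 2 = ((- n1 ^+ 2 + n2 ^+ 2 + n3 ^+ 2)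
     - 2 * x * (- (n1 * a1) + n2 * a2 + n3 * a3)
     + x ^+ 2 * (- a1 ^+ 2 + a2 ^+ 2 + a3 ^+ 2)) / r ^+ 2.
    by rewrite /b1 /b2 /b3; field.
  by rewrite nn na aa r2; field; rewrite -r2 expf_neq0.
have ab : - (a1 * b1) + a2 * b2 + a3 * b3 = 0.
  have -> : - (a1 * b1) + a2 * b2 + a3 * b3 = ((- (n1 * a1) + n2 * a2 + n3 * a3)
     - x * (- a1 ^+ 2 + a2 ^+ 2 + a3 ^+ 2)) / r by rewrite /b1 /b2 /b3; field.
  by rewrite na aa; field.
have nb : - (n1 * b1) + n2 * b2 + n3 * b3 = r.
  have -> : - (n1 * b1) + n2 * b2 + n3 * b3 = ((- n1 ^+ 2 + n2 ^+ 2 + n3 ^+ 2)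
     - x * (- (n1 * a1) + n2 * a2 + n3 * a3)) / r by rewrite /b1 /b2 /b3; field.
  rewrite nn na; have -> : (-1 - x * - x) / r = r ^+ 2 / r by rewrite r2; field.
  by field.
have fr := frame_complete aa bb ab a0.
by do 6!eexists; split; [exact: fr|rewrite nb].
Qed.

(** The sign of the last vector makes the coordinate of F along it equal to lambda / s. The
    component of n orthogonal to it is timelike and future-directed, and is normalised to give the
    first vector. *)
Lemma frame_spacelike (P1 P2 P3 n1 n2 n3 s : R) : 0 < s ->
  - P1 ^+ 2 + P2 ^+ 2 + P3 ^+ 2 = s ^+ 2 ->
  - n1 ^+ 2 + n2 ^+ 2 + n3 ^+ 2 = -1 -> 0 < n1 ->
  exists a1 a2 a3 b1 b2 b3,
    lorentz_frame a1 a2 a3 b1 b2 b3 (- P1 / s) (- P2 / s) (- P3 / s).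
Proof.
move=> s0 PP nn n0; have s_n : s != 0 by rewrite gt_eqF.
pose c1 := - P1 / s; pose c2 := - P2 / s; pose c3 := - P3 / s.
have cc : - c1 ^+ 2 + c2 ^+ 2 + c3 ^+ 2 = 1.
  have -> : - c1 ^+ 2 + c2 ^+ 2 + c3 ^+ 2 = (- P1 ^+ 2 + P2 ^+ 2 + P3 ^+ 2) / s ^+ 2.
    by rewrite /c1 /c2 /c3; field.
  by rewrite PP; field.
pose x := - (n1 * c1) + n2 * c2 + n3 * c3.
pose r := Num.sqrt (1 + x ^+ 2).
have x0 : 0 < 1 + x ^+ 2 by rewrite ltr_pwDl // sqr_ge0.
have r0 : 0 < r by rewrite sqrtr_gt0.
have r_n : r != 0 by rewrite gt_eqF.
have r2 : r ^+ 2 = 1 + x ^+ 2 by rewrite sqr_sqrtr // ltW.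
have nc : - (n1 * c1) + n2 * c2 + n3 * c3 = x by [].
pose a1 := (n1 - x * c1) / r; pose a2 := (n2 - x * c2) / r; pose a3 := (n3 - x * c3) / r.
have aa : - a1 ^+ 2 + a2 ^+ 2 + a3 ^+ 2 = -1.
  have -> : - a1 ^+ 2 + a2 ^+ 2 + a3 ^+ 2 = ((- n1 ^+ 2 + n2 ^+ 2 + n3 ^+ 2)
     - 2 * x * (- (n1 * c1) + n2 * c2 + n3 * c3)
     + x ^+ 2 * (- c1 ^+ 2 + c2 ^+ 2 + c3 ^+ 2)) / r ^+ 2.
    by rewrite /a1 /a2 /a3; field.
  by rewrite nn nc cc r2; field; rewrite -r2 expf_neq0.
have ac : - (a1 * c1) + a2 * c2 + a3 * c3 = 0.
  have -> : - (a1 * c1) + a2 * c2 + a3 * c3 = ((- (n1 * c1) + n2 * c2 + n3 * c3)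
     - x * (- c1 ^+ 2 + c2 ^+ 2 + c3 ^+ 2)) / r by rewrite /a1 /a2 /a3; field.
  by rewrite nc cc; field.
have a0 : 0 < a1.
  apply: (hyperboloid_future nn n0 aa).
  have -> : n1 * a1 - n2 * a2 - n3 * a3 = - ((- n1 ^+ 2 + n2 ^+ 2 + n3 ^+ 2)
     - x * (- (n1 * c1) + n2 * c2 + n3 * c3)) / r by rewrite /a1 /a2 /a3; field.
  by rewrite nn nc divr_gt0 //; lra.
have fr := frame_swap (frame_complete aa cc ac a0).
by do 6!eexists; exact: fr.
Qed.

Lemma lightlike_pos (q1 q2 q3 n1 n2 n3 : R) :
  - q1 ^+ 2 + q2 ^+ 2 + q3 ^+ 2 = 0 -> 0 < q1 ->
  - n1 ^+ 2 + n2 ^+ 2 + n3 ^+ 2 = -1 -> 0 < n1 ->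
  0 < q1 * n1 - q2 * n2 - q3 * n3.
Proof.
move=> qq q0 nn n0.
have CS : (q2 * n2 + q3 * n3) ^+ 2 <= q1 ^+ 2 * (n1 ^+ 2 - 1).
  have -> : q1 ^+ 2 = q2 ^+ 2 + q3 ^+ 2 by lra.
  have -> : n1 ^+ 2 - 1 = n2 ^+ 2 + n3 ^+ 2 by lra.
  by have := sqr_ge0 (q2 * n3 - q3 * n2); lra.
have lt : (q2 * n2 + q3 * n3) ^+ 2 < (q1 * n1) ^+ 2.
  have -> : (q1 * n1) ^+ 2 = q1 ^+ 2 * n1 ^+ 2 by ring.
  have : 0 < q1 ^+ 2 by rewrite exprn_gt0.
  by lra.
have qn := ltW (mulr_gt0 q0 n0).
have : `|q2 * n2 + q3 * n3| < q1 * n1.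
  by rewrite -(@ltr_pXn2r _ 2) ?nnegrE // -normrX ger0_norm // sqr_ge0.
by rewrite ltr_norml => /andP[]; lra.
Qed.

(** A null vector cannot be normalised, so the frame splits it as a sum of a timelike and a
    spacelike unit vector, both in the plane spanned by q and n: half the sum and half the
    difference of q and the other null direction of that plane. *)
Lemma frame_lightlike (q1 q2 q3 n1 n2 n3 : R) :
  - q1 ^+ 2 + q2 ^+ 2 + q3 ^+ 2 = 0 -> 0 < q1 ->
  - n1 ^+ 2 + n2 ^+ 2 + n3 ^+ 2 = -1 -> 0 < n1 ->
  exists a1 a2 a3 b1 b2 b3 c1 c2 c3,
    lorentz_frame a1 a2 a3 b1 b2 b3 c1 c2 c3 /\
    [/\ a1 + c1 = q1, a2 + c2 = q2 & a3 + c3 = q3].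
Proof.
move=> qq q0 nn n0; have m0 := lightlike_pos qq q0 nn n0.
pose m := q1 * n1 - q2 * n2 - q3 * n3; rewrite -/m in m0.
have m_n : m != 0 by rewrite gt_eqF.
have qn : - (q1 * n1) + q2 * n2 + q3 * n3 = - m by rewrite /m; ring.
(* the null vector of span(q, n) whose product with q is -2 *)
pose q' (q n : R) := 2 / m * n - q / m ^+ 2.
pose a (q n : R) := (q + q' q n) / 2; pose c (q n : R) := (q - q' q n) / 2.
have gram (f1 g1 f2 g2 : R) :
  - ((f1 * q1 + g1 * n1) * (f2 * q1 + g2 * n1)) + (f1 * q2 + g1 * n2) * (f2 * q2 + g2 * n2)
  + (f1 * q3 + g1 * n3) * (f2 * q3 + g2 * n3) = - (g1 * g2) - (f1 * g2 + f2 * g1) * m.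
  have -> : - ((f1 * q1 + g1 * n1) * (f2 * q1 + g2 * n1))
  + (f1 * q2 + g1 * n2) * (f2 * q2 + g2 * n2)
  + (f1 * q3 + g1 * n3) * (f2 * q3 + g2 * n3) = f1 * f2 * (- q1 ^+ 2 + q2 ^+ 2 + q3 ^+ 2)
   + g1 * g2 * (- n1 ^+ 2 + n2 ^+ 2 + n3 ^+ 2)
   + (f1 * g2 + f2 * g1) * (- (q1 * n1) + q2 * n2 + q3 * n3) by ring.
  by rewrite qq nn qn; ring.
pose fa := (1 - (m ^+ 2)^-1) / 2; pose fc := (1 + (m ^+ 2)^-1) / 2.
have aE q n : a q n = fa * q + m^-1 * n by rewrite /a /q' /fa; field.
have cE q n : c q n = fc * q + (- m^-1) * n by rewrite /c /q' /fc; field.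
have aa : - a q1 n1 ^+ 2 + a q2 n2 ^+ 2 + a q3 n3 ^+ 2 = -1.
  by rewrite !expr2 !aE gram /fa; field.
have cc : - c q1 n1 ^+ 2 + c q2 n2 ^+ 2 + c q3 n3 ^+ 2 = 1.
  by rewrite !expr2 !cE gram /fc; field.
have ac : - (a q1 n1 * c q1 n1) + a q2 n2 * c q2 n2 + a q3 n3 * c q3 n3 = 0.
  by rewrite !aE !cE gram /fa /fc; field.
have a0 : 0 < a q1 n1.
  apply: (hyperboloid_future nn n0 aa).
  have -> : n1 * a q1 n1 - n2 * a q2 n2 - n3 * a q3 n3 =
    fa * m - m^-1 * (- n1 ^+ 2 + n2 ^+ 2 + n3 ^+ 2) by rewrite !aE /m; ring.
  rewrite nn /fa.
  have -> : (1 - (m ^+ 2)^-1) / 2 * m - m^-1 * -1 = (m + m^-1) / 2 by field.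
  by rewrite divr_gt0 // addr_gt0 // invr_gt0.
have fr := frame_swap (frame_complete aa cc ac a0).
do 9!eexists; split; first exact: fr.
by split; rewrite /a /c; field.
Qed.

End Frames.

(** * The three cases *)

Section Classification.
Context {R : realType} {M : topologicalType} (A : set (chart R M))
    (F xi : M -> 'rV[R]_4) (lambda : M -> R)
    (surfM : smooth_surface A) (connM : connected [set: M])
    (immF : isometric_immersion A F)
    (normal_xi : unit_normal A F xi)
    (angle_le : forall p, 0 <= angle xi p <= pi / 2)
    (umbF : totally_umbilical A F xi lambda)
    (not_geodesic : ~ (forall p, lambda p = 0)).

Let nu p := xi p 0 i4.

Let FH p : H2R (F p). Proof. by have [] := immF. Qed.

Let nu_gt0 p : 0 < nu p.
Proof. exact: angle_height_gt0 surfM connM immF normal_xi angle_le umbF not_geodesic p. Qed.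

Let angleE p : angle xi p = acos (nu p).
Proof. by rewrite /angle lorentz_e3. Qed.

Let nu_lt1 p : angle xi p != 0 -> nu p < 1.
Proof.
have [_ [h _]] := normal_xi; have [tp up] := h p.
have [_ n1 _] := normal_pythagoras (FH p) tp up.
move=> a0; rewrite lt_neqAle; apply/andP; split.
  by apply: contraNneq a0 => n1'; rewrite angleE n1' acos1.
by have n_ge0 := ltW (nu_gt0 p); rewrite -(@expr_le1 _ 2).
Qed.

(** The clause that every t in ]a, b[ is a value of [u] on [W] carries identities proved at points
    of the surface, such as the derivative of the height function, over to the whole interval. *)
Lemma locally_given_of p (W : set M) (u v : M -> R) (k th la : R -> R) G
    (s : 'I_4 -> bool) Phi :
  open W -> W p -> msmooth A W u -> msmooth A W v ->
  (forall q, W q -> F q 0 i4 = k (u q)) -> derivable k (u p) 1 ->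
  (forall y w X, A y -> chart_cod y w -> chart_inv y w = p ->
     flat y w X lambda -> flat y w X nu -> flat y w X v ->
     forall j, j != i4 -> flat y w X (fun q => F q 0 j)) ->
  H2R_isometry Phi ->
  (forall q, W q -> [/\ angle xi q = th (u q), lambda q = la (u q),
     H2R (change_signs s (G (u q) (v q))) & F q = Phi (change_signs s (G (u q) (v q)))]) ->
  exists a b : R, (forall t, a < t < b -> exists2 q, W q & u q = t) /\
    locally_given A F xi lambda p a b th la G.
Proof.
move=> oW Wp su sv hk dk hflat isoPhi hG.
have [x [r [lx xp r0 cx hx]]] :=
  surface_coordinates surfM immF normal_xi umbF oW Wp su sv hk dk hflat.
exists (u p - r), (u p + r); split.
  move=> t ht; have hv : v p - r < v p < v p + r by apply/andP; split; lra.
  by have [Wq uq _] := hx t (v p) ht hv; exists (chart_inv x (vec2 t (v p))).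
exists x; split=> //; exists (v p - r), (v p + r); split=> //.
exists s, Phi; split=> // u' v' hu hv q.
have [Wq uq vq] := hx u' v' hu hv.
by have := hG _ Wq; rewrite uq vq.
Qed.

Let msF W j : open W -> msmooth A W (fun q => F q 0 j).
Proof. by move=> oW; have [_ sF _] := immF; exact: (msmooth_coord surfM j oW sF). Qed.

Let msnu W : open W -> msmooth A W nu.
Proof. by move=> oW; have [sx _] := normal_xi; exact: (msmooth_coord surfM i4 oW sx). Qed.

Lemma scale_vec4 (k a b c d : R) : k *: vec4 a b c d = vec4 (k * a) (k * b) (k * c) (k * d).
Proof. by apply/rowP; apply: ord4P; rewrite !mxE. Qed.

Lemma no_change_signs (z : 'rV[R]_4) : change_signs (fun=> false) z = z.
Proof. by apply/rowP => j; rewrite mxE expr0 mul1r. Qed.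

Lemma flat_lin3 (y : chart R M) w X (g1 g2 g3 : M -> R) (k1 k2 k3 : R) :
  flat y w X g1 -> flat y w X g2 -> flat y w X g3 ->
  flat y w X (fun q => g1 q * k1 + g2 q * k2 + g3 q * k3).
Proof.
by move=> h1 h2 h3; apply: flat_add; [apply: flat_add|]; apply: flat_mul => //;
  exact: flat_cst.
Qed.

Let frame_flat p W a1 a2 a3 b1 b2 b3 c1 c2 c3 (x1 x2 x3 : M -> R) :
  open W -> W p ->
  (forall q, W q -> [/\ F q 0 i1 = x1 q * a1 + x2 q * b1 + x3 q * c1,
                        F q 0 i2 = x1 q * a2 + x2 q * b2 + x3 q * c2 &
                        F q 0 i3 = x1 q * a3 + x2 q * b3 + x3 q * c3]) ->
  forall y w X, A y -> chart_cod y w -> chart_inv y w = p ->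
    flat y w X x1 -> flat y w X x2 -> flat y w X x3 ->
    forall j, j != i4 -> flat y w X (fun q => F q 0 j).
Proof.
move=> oW Wp hF y w X Ay cw wp f1 f2 f3; have Ww : W (chart_inv y w) by rewrite wp.
apply: ord4P => // _.
- apply: (flat_eq surfM oW Ay cw Ww (fun q Wq => esym (let: And3 h _ _ := hF q Wq in h))).
  exact: flat_lin3.
- apply: (flat_eq surfM oW Ay cw Ww (fun q Wq => esym (let: And3 _ h _ := hF q Wq in h))).
  exact: flat_lin3.
- apply: (flat_eq surfM oW Ay cw Ww (fun q Wq => esym (let: And3 _ _ h := hF q Wq in h))).
  exact: flat_lin3.
Qed.

Context (P1 P2 P3 h0 : R)
  (lamE : forall p, lambda p = P1 * F p 0 i1 - P2 * F p 0 i2 - P3 * F p 0 i3)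
  (KE : forall p, lambda p ^+ 2 + nu p ^+ 2 = 1 + P1 ^+ 2 - P2 ^+ 2 - P3 ^+ 2)
  (hE : forall p, F p 0 i4 = h0 + atan (lambda p / nu p)).

Let mslam W : open W -> msmooth A W lambda.
Proof.
move=> oW; rewrite (_ : lambda = fun q => P1 * F q 0 i1 + - (P2 * F q 0 i2) + - (P3 * F q 0 i3)).
  have mF c j : msmooth A W (fun q => c * F q 0 j).
    by apply: (msmooth_mul surfM) => //; [exact: msmooth_cst|exact: msF].
  apply: (msmooth_add surfM) => //; last by apply: (msmooth_opp surfM).
  by apply: (msmooth_add surfM) => //; apply: (msmooth_opp surfM).
by apply/funext => q; rewrite lamE.
Qed.

Let ms_lin (W : set M) (k1 k2 k3 : R) : open W ->
  msmooth A W (fun q => k1 * F q 0 i1 + k2 * F q 0 i2 + k3 * F q 0 i3).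
Proof.
move=> oW.
have mF c j : msmooth A W (fun q => c * F q 0 j).
  by apply: (msmooth_mul surfM) => //; [exact: msmooth_cst|exact: msF].
by do 2!apply: (msmooth_add surfM) => //.
Qed.

Let ms_scoord (W : set M) (b1 b2 b3 : R) : open W -> msmooth A W (fun q => scoord b1 b2 b3 (F q)).
Proof.
move=> oW; rewrite (_ : (fun q => _) =
    fun q => - b1 * F q 0 i1 + b2 * F q 0 i2 + b3 * F q 0 i3); first exact: ms_lin.
by apply/funext => q; rewrite /scoord; ring.
Qed.

Let ms_tcoord (W : set M) (b1 b2 b3 : R) : open W -> msmooth A W (fun q => tcoord b1 b2 b3 (F q)).
Proof.
move=> oW; rewrite (_ : (fun q => _) =
    fun q => b1 * F q 0 i1 + - b2 * F q 0 i2 + - b3 * F q 0 i3); first exact: ms_lin.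
by apply/funext => q; rewrite /tcoord; ring.
Qed.

Let flat_sin (y : chart R M) w X : nu (chart_inv y w) < 1 -> flat y w X nu ->
  flat y w X (fun q => Num.sqrt (1 - nu q ^+ 2)).
Proof.
move=> n1 fn; have n2 : 0 < 1 - nu (chart_inv y w) ^+ 2.
  by rewrite subr_gt0 expr_lt1 // ltW // nu_gt0.
apply: (@flat_comp _ _ y w X (fun q => 1 - nu q ^+ 2) Num.sqrt).
  apply: flat_add; first exact: flat_cst.
  apply: flat_opp; rewrite (_ : (fun q => nu q ^+ 2) = fun q => nu q * nu q).
    exact: flat_mul.
  by apply/funext => q; rewrite expr2.
by have [] := is_derive1_sqrt n2.
Qed.

Let S q := Num.sqrt (1 - nu q ^+ 2).

Let SP q : nu q < 1 -> [/\ sin (angle xi q) = S q, S q ^+ 2 = 1 - nu q ^+ 2 & 0 < S q].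
Proof.
move=> n1; have [_ sE S2] : [/\ acos (nu q) = atan (S q / nu q),
      sin (acos (nu q)) = S q & S q ^+ 2 = 1 - nu q ^+ 2].
  by apply: acos_sin_cos; rewrite nu_gt0 ltW.
split=> //; first by rewrite angleE.
by rewrite sqrtr_gt0 subr_gt0 expr_lt1 // ltW // nu_gt0.
Qed.

(** As P and N are both timelike, lambda = - <P, N> has the sign [e] of [P1] everywhere. The
    coordinate of F along e P / c is |lambda| / c; the squares of the other two add up to (sin theta
    / c)^2, and v is their polar angle. *)
Lemma case_timelike (c e : R) : 0 < c -> e ^+ 2 = 1 ->
  P1 ^+ 2 - P2 ^+ 2 - P3 ^+ 2 = c ^+ 2 -> 0 < e * P1 ->
  forall p, angle xi p != 0 ->
  exists (a b : R) (h : R -> R),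
    let th := theta_i c e in
    let la := lambda_of th in
    antiderivative_sin2 th a b h /\
    locally_given A F xi lambda p a b th la (fun u v =>
      c^-1 *: vec4 (la u) (sin (th u) * cos v) (sin (th u) * sin v) (c * h u)).
Proof.
move=> c0 e2 PP eP p ap; have c_n : c != 0 by rewrite gt_eqF.
have LN q : lambda q ^+ 2 + nu q ^+ 2 = 1 + c ^+ 2 by rewrite KE; lra.
have [nn n0] := FH p.
have np1 := nu_lt1 ap.
have np2 : nu p ^+ 2 < 1 by rewrite expr_lt1 // ltW // nu_gt0.
have cl : c ^+ 2 < (P1 * F p 0 i1 - P2 * F p 0 i2 - P3 * F p 0 i3) ^+ 2.
  by rewrite -lamE; have := LN p; lra.
have [b1 [b2 [b3 [c1 [c2 [c3 [fr xp2]]]]]]] := frame_timelike c0 e2 PP eP nn cl.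
have [Phi isoPhi hPhi] := frame_isometry 0 fr.
pose x2 q := scoord b1 b2 b3 (F q); pose x3 q := scoord c1 c2 c3 (F q).
pose L q := e * lambda q.
have x1E q : tcoord (e * P1 / c) (e * P2 / c) (e * P3 / c) (F q) = L q / c.
  by rewrite /tcoord /L lamE; field.
have L0 q : 0 < L q.
  have [[_ h] _ _ _ _] := hPhi _ (FH q); move: h; rewrite x1E.
  by rewrite ltr_pdivlMr // mul0r.
have L2 q : L q ^+ 2 = lambda q ^+ 2 by rewrite exprMn e2 mul1r.
(* The first condition makes the logarithm in u meaningful, the second makes the arctangent of x3 /
   x2 a polar angle. *)
pose W := [set q | [set q | True /\ 0 < 1 - nu q] q /\ 0 < x2 q].
have oW1 : open [set q : M | True /\ 0 < 1 - nu q].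
  apply: (@msmooth_open_pos _ _ A surfM setT) => //; first exact: openT.
  apply: (msmooth_add surfM); [exact: openT|exact: msmooth_cst|].
  by apply: (msmooth_opp surfM); [exact: openT|exact: msnu openT].
have oW : open W.
  by apply: (@msmooth_open_pos _ _ A surfM) => //; exact: ms_scoord.
have Wp : W p by split; [split=> //; rewrite subr_gt0|].
pose a := 1 + c ^+ 2.
pose u q := e / (2 * c) * ln (a * ((L q - c * nu q) / (L q + c * nu q))).
pose v q := atan (x3 q / x2 q).
pose h1 t := e * c * ((a + expR (e * 2 * c * t)) / (a - expR (e * 2 * c * t))).
pose h t := h0 + atan (h1 t).
have thP q : W q -> [/\ 0 < L q - c * nu q, theta_i c e (u q) = acos (nu q),
    lambda_of (theta_i c e) (u q) = lambda q,
    is_derive (u q) 1 h (sin (theta_i c e (u q)) ^+ 2) & h (u q) = F q 0 i4].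
  move=> [[_ q1] _]; have nq : 0 < nu q < 1 by rewrite nu_gt0 /=; lra.
  have LNq : L q ^+ 2 + nu q ^+ 2 = 1 + c ^+ 2 by rewrite L2.
  have [k1 k2 k3 k4 k5] := theta_i_formulas c0 e2 nq (L0 q) LNq.
  split=> //.
  - by rewrite [LHS]k3 /L mulrA -expr2 e2 mul1r.
  - have := is_deriveD (is_derive_cst h0 (u q) 1) k4.
    by move/is_derive_eq; apply; rewrite add0r.
  - by rewrite /h [h1 _]k5 /L mulrA -expr2 e2 mul1r -hE.
have msL : msmooth A W L.
  by apply: (msmooth_mul surfM) => //; [exact: msmooth_cst|exact: mslam].
have mscn : msmooth A W (fun q => c * nu q).
  by apply: (msmooth_mul surfM) => //; [exact: msmooth_cst|exact: msnu].
have posL q : 0 < L q + c * nu q by rewrite addr_gt0 // mulr_gt0 // nu_gt0.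
have su : msmooth A W u.
  apply: (msmooth_mul surfM) => //; first exact: msmooth_cst.
  apply: (msmooth_ln surfM) => //.
    move=> q /thP[k1 _ _ _ _].
    by rewrite mulr_gt0 ?divr_gt0 // /a ltr_pwDl // sqr_ge0.
  apply: (msmooth_mul surfM) => //; first exact: msmooth_cst.
  apply: (msmooth_mul surfM) => //.
    by apply: (msmooth_add surfM) => //; exact: (msmooth_opp surfM).
  apply: (msmooth_inv surfM) => //; first by move=> q _; rewrite gt_eqF.
  exact: (msmooth_add surfM).
have sv : msmooth A W v.
  apply: (msmooth_atan surfM) => //; apply: (msmooth_mul surfM) => //.
    exact: ms_scoord.
  apply: (msmooth_inv surfM) => //; last exact: ms_scoord.
  by move=> q [_ q2]; rewrite gt_eqF.
have x23 q : W q -> x2 q = S q / c * cos (v q) /\ x3 q = S q / c * sin (v q).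
  move=> [[_ q1] q2]; have [|_ S2 S0] := @SP q; first lra.
  have [[nq _] _ _ _ _] := hPhi _ (FH q); rewrite x1E -/(x2 q) -/(x3 q) in nq.
  have r2 : x2 q ^+ 2 + x3 q ^+ 2 = (S q / c) ^+ 2.
    have -> : x2 q ^+ 2 + x3 q ^+ 2 = (L q ^+ 2 - c ^+ 2) / c ^+ 2.
      have -> : (L q ^+ 2 - c ^+ 2) / c ^+ 2 = (L q / c) ^+ 2 - 1 by field.
      lra.
    by rewrite expr_div_n S2 L2; congr (_ / _); have := LN q; lra.
  have [k1 k2] := polar (x3 q) q2; rewrite r2 sqrtr_sqr ger0_norm in k1 k2.
    by split.
  by rewrite divr_ge0 // ltW.
(* The first entry lambda / c of the formula has the sign [e], whereas x_1 > 0 on H^2; hence the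
   change of sign of x_1 if e = -1. *)
have [|||a' [b' [hab lg]]] := @locally_given_of p W u v h (theta_i c e) (lambda_of (theta_i c e))
  (fun u v => c^-1 *: vec4 (lambda_of (theta_i c e) u) (sin (theta_i c e u) * cos v)
     (sin (theta_i c e u) * sin v) (c * h u))
  (fun j => (j == i1) && (e == -1)) Phi oW Wp su sv
  (fun q Wq => esym (let: And5 _ _ _ _ k := thP q Wq in k)) _ _ isoPhi _.
- by have [_ _ _ [d _] _] := thP p Wp.
- move=> y w X Ay cw wp fl fn fv.
  have fF q : W q -> [/\
    F q 0 i1 = L q / c * (e * P1 / c) + S q / c * cos (v q) * b1 + S q / c * sin (v q) * c1,
    F q 0 i2 = L q / c * (e * P2 / c) + S q / c * cos (v q) * b2 + S q / c * sin (v q) * c2 &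
    F q 0 i3 = L q / c * (e * P3 / c) + S q / c * cos (v q) * b3 + S q / c * sin (v q) * c3].
    move=> Wq; have [_ _ k1 k2 k3] := hPhi _ (FH q).
    by have [<- <-] := x23 q Wq; rewrite -x1E.
  have fS : flat y w X (fun q => S q / c).
    apply: flat_mul; last exact: flat_cst.
    by apply: flat_sin => //; rewrite wp.
  apply: (frame_flat oW Wp fF Ay cw wp).
  - by apply: flat_mul; [apply: flat_mul => //|]; exact: flat_cst.
  - by apply: flat_mul => //; apply: flat_comp => //; exact: derivable_cos.
  - by apply: flat_mul => //; apply: flat_comp => //; exact: derivable_sin.
- move=> q Wq; have [k1 k2 k3 _ k5] := thP q Wq; have [[_ q1] q2] := Wq.
  have [|sE S2 S0] := @SP q; first lra.
  have GE : change_signs (fun j => (j == i1) && (e == -1))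
     (c^-1 *: vec4 (lambda_of (theta_i c e) (u q)) (sin (theta_i c e (u q)) * cos (v q))
     (sin (theta_i c e (u q)) * sin (v q)) (c * h (u q))) =
     vec4 (L q / c) (x2 q) (x3 q) (F q 0 i4 - 0).
    have [-> ->] := x23 q Wq; rewrite scale_vec4 k2 -angleE sE k3 k5 subr0.
    have sgn : (-1) ^+ (e == -1) = e.
      have : (e - 1) * (e + 1) = 0 by lra.
      move/eqP; rewrite mulf_eq0 => /orP[/eqP h'|/eqP h'].
        have -> : e = 1 by lra.
        by rewrite -subr_eq0 opprK gt_eqF // addr_gt0.
      have -> : e = -1 by lra.
      by rewrite eqxx.
    apply/rowP; apply: ord4P; rewrite !mxE /= ?expr0 ?mul1r.
    - by rewrite sgn /L; ring.
    - by ring.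
    - by ring.
    - by field.
  have [[nq nq0] FE _ _ _] := hPhi _ (FH q); rewrite x1E in nq nq0 FE.
  split; [by rewrite angleE k2|by rewrite k3| |].
    by rewrite GE /H2R /=; have [-> -> -> _] := vec4E (L q / c) (x2 q) (x3 q) (F q 0 i4 - 0).
  by rewrite GE FE.
exists a', b', h; split; last exact: lg.
by move=> t /hab[q Wq <-]; have [_ _ _ k _] := thP q Wq.
Qed.

(** With q = - e P the coordinate m = x1 - x3 = - <q, N> equals - e lambda = sin theta and is
    positive. Since (x1 - x3) (x1 + x3) = 1 + x2^2, the numbers m and x2 determine the point. The
    pair v = x2 / m and 1 / m gives its coordinates in the upper half-plane model, where the curves
    of constant m are horocycles. *)
Lemma case_lightlike (e : R) : e ^+ 2 = 1 ->
  P1 ^+ 2 - P2 ^+ 2 - P3 ^+ 2 = 0 -> 0 < - (e * P1) ->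
  forall p, exists a b : R,
    locally_given A F xi lambda p a b (theta_ii e) (lambda_ii e)
      (fun u v => (Num.sqrt (1 + u ^+ 2))^-1 *:
         vec4 ((u ^+ 2 + v ^+ 2) / 2 + 1) v ((u ^+ 2 + v ^+ 2) / 2)
              (Num.sqrt (1 + u ^+ 2) * atan u)).
Proof.
move=> e2 PP eP p.
have LN q : lambda q ^+ 2 + nu q ^+ 2 = 1 by rewrite KE; lra.
pose m q := - (e * lambda q).
have qq : - (- (e * P1)) ^+ 2 + (- (e * P2)) ^+ 2 + (- (e * P3)) ^+ 2 = 0.
  rewrite !sqrrN !exprMn e2; lra.
have mE q : m q = - (e * P1) * F q 0 i1 - - (e * P2) * F q 0 i2 - - (e * P3) * F q 0 i3.
  by rewrite /m lamE; ring.
have m0 q : 0 < m q.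
  by rewrite mE; have [nn n0] := FH q; exact: lightlike_pos.
have l_n q : lambda q != 0.
  by apply: contraTneq (m0 q) => l0; rewrite /m l0 mulr0 oppr0 ltxx.
have m2 q : m q ^+ 2 = lambda q ^+ 2 by rewrite /m sqrrN exprMn e2 mul1r.
have [nn n0] := FH p.
have [a1 [a2 [a3 [b1 [b2 [b3 [c1 [c2 [c3 [fr [E1 E2 E3]]]]]]]]]]] :=
  frame_lightlike qq eP nn n0.
(* The vertical translation absorbs the constant between the arctangents of lambda / nu and of u. *)
pose t := h0 - e * (pi / 2).
have [Phi isoPhi hPhi] := frame_isometry t fr.
pose x1 q := tcoord a1 a2 a3 (F q); pose x2 q := scoord b1 b2 b3 (F q).
pose x3 q := scoord c1 c2 c3 (F q).
have x13 q : x1 q - x3 q = m q.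
  by rewrite mE -E1 -E2 -E3 /x1 /x3 /tcoord /scoord; ring.
have m_n q : m q != 0 by rewrite gt_eqF.
pose u q := - nu q / lambda q; pose v q := x2 q / m q.
have xE q : x1 q = (m q + (1 + (m q * v q) ^+ 2) / m q) / 2 /\
            x2 q = m q * v q /\ x3 q = (- m q + (1 + (m q * v q) ^+ 2) / m q) / 2.
  have [[nq _] _ _ _ _] := hPhi _ (FH q); rewrite -/(x1 q) -/(x2 q) -/(x3 q) in nq.
  have mv : m q * v q = x2 q by rewrite /v mulrC divfK.
  have s13 : x1 q + x3 q = (1 + x2 q ^+ 2) / m q.
    have -> : 1 + x2 q ^+ 2 = m q * (x1 q + x3 q) by rewrite -x13; lra.
    by rewrite mulrC mulKf.
  by rewrite mv -s13 -x13; split; [lra|split; [by []|lra]].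
have oT : open [set: M] by exact: openT.
have mslam' := mslam oT; have msnu' := msnu oT.
have msm : msmooth A setT m.
  apply: (msmooth_opp surfM) => //; apply: (msmooth_mul surfM) => //.
  exact: msmooth_cst.
have su : msmooth A setT u.
  apply: (msmooth_mul surfM) => //; first exact: (msmooth_opp surfM).
  exact: (msmooth_inv surfM).
have sv : msmooth A setT v.
  by apply: (msmooth_mul surfM) => //; [exact: ms_scoord|exact: (msmooth_inv surfM)].
have thP q : [/\ theta_ii e (u q) = acos (nu q), lambda_ii e (u q) = lambda q,
      Num.sqrt (1 + u q ^+ 2) = (m q)^-1 &
      F q 0 i4 = t + atan (u q)].
  have [k1 k2 k3 k4] := theta_ii_formulas e2 (nu_gt0 q) (m0 q) (LN q).
  by split=> //; rewrite hE k4 /t; ring.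
have [|||a' [b' [_ lg]]] := @locally_given_of p setT u v (fun s => t + atan s)
  (theta_ii e) (lambda_ii e) (fun u v => (Num.sqrt (1 + u ^+ 2))^-1 *:
         vec4 ((u ^+ 2 + v ^+ 2) / 2 + 1) v ((u ^+ 2 + v ^+ 2) / 2)
              (Num.sqrt (1 + u ^+ 2) * atan u))
  (fun=> false) Phi oT I su sv (fun q _ => let: And4 _ _ _ k := thP q in k) _ _ isoPhi _.
- by apply: derivableD; [exact: derivable_cst|exact: derivable_atan].
- move=> y w X Ay cw wp fl fn fv.
  have fm : flat y w X m.
    by apply: flat_opp; apply: flat_mul => //; exact: flat_cst.
  have fx2 : flat y w X x2.
    rewrite (_ : x2 = fun q => m q * v q); first exact: flat_mul.
    by apply/funext => q; have [_ []] := xE q.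
  have fs : flat y w X (fun q => (1 + x2 q * x2 q) * (m q)^-1).
    apply: flat_mul.
      by apply: flat_add; [exact: flat_cst|exact: flat_mul].
    apply: (flat_comp (phi := GRing.inv)) => //.
    by have [] := @is_deriveV R id (m (chart_inv y w)) 1 1 (m_n _) (is_derive_id _ _).
  apply: (@frame_flat p setT a1 a2 a3 b1 b2 b3 c1 c2 c3 x1 x2 x3 oT I) => //.
  + by move=> q _; have [] := hPhi _ (FH q).
  + rewrite (_ : x1 = fun q => (m q + (1 + x2 q * x2 q) * (m q)^-1) * 2^-1).
      by apply: flat_mul; [exact: flat_add|exact: flat_cst].
    by apply/funext => q; have [-> [-> _]] := xE q; rewrite expr2.
  + rewrite (_ : x3 = fun q => (- m q + (1 + x2 q * x2 q) * (m q)^-1) * 2^-1).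
      by apply: flat_mul; [apply: flat_add => //; exact: flat_opp|exact: flat_cst].
    by apply/funext => q; have [_ [-> ->]] := xE q; rewrite expr2.
- move=> q _; have [k1 k2 k3 k4] := thP q.
  have [x1E [x2E x3E]] := xE q.
  have u2 : u q ^+ 2 = (1 - m q ^+ 2) / m q ^+ 2.
    by rewrite /u expr_div_n sqrrN m2; congr (_ / _); have := LN q; lra.
  have GE : change_signs (fun=> false) ((Num.sqrt (1 + u q ^+ 2))^-1 *:
         vec4 ((u q ^+ 2 + v q ^+ 2) / 2 + 1) (v q) ((u q ^+ 2 + v q ^+ 2) / 2)
              (Num.sqrt (1 + u q ^+ 2) * atan (u q))) =
      vec4 (x1 q) (x2 q) (x3 q) (F q 0 i4 - t).
    rewrite no_change_signs k3 invrK scale_vec4 x1E x2E x3E k4 u2.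
    have mq := m_n q; congr vec4; by field.
  have [[nq nq0] FE _ _ _] := hPhi _ (FH q).
  split; [by rewrite angleE k1|by rewrite k2| |].
    by rewrite GE /H2R /=; have [-> -> -> _] := vec4E (x1 q) (x2 q) (x3 q) (F q 0 i4 - t).
  by rewrite GE FE.
by exists a', b'.
Qed.

Lemma derivable_cosh_sinh (x : R) : derivable (@cosh R) x 1 /\ derivable (@sinh R) x 1.
Proof.
have dN : derivable (fun t : R => expR (- t)) x 1.
  have [] := is_derive1_exp_scal (-1) x.
  by rewrite (_ : (fun t => expR (-1 * t)) = fun t => expR (- t)) //;
    apply/funext => t; rewrite mulN1r.
have dP : derivable (fun t : R => expR t) x 1 by exact: derivable_expR.
have d2 : derivable (fun=> 2^-1 : R) x 1 by exact: derivable_cst.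
have hD := derivableM (derivableD dP dN) d2.
have hB := derivableM (derivableB dP dN) d2.
by split; [exact: hD|exact: hB].
Qed.

(** The coordinate of F along - P / sin c is lambda / sin c, and x1^2 - x2^2 = (sin theta / sin c)^2
    in the remaining Lorentz plane, where v is the hyperbolic angle. As nu <= cos c < 1 and |x2| <
    x1 at all points, u and v are defined on the whole surface. *)
Lemma case_spacelike (c : R) : 0 < sin c -> 0 < cos c ->
  - P1 ^+ 2 + P2 ^+ 2 + P3 ^+ 2 = sin c ^+ 2 ->
  forall p, exists (a b : R) (h : R -> R),
    let th := theta_iii c 1 in
    let la := lambda_of th in
    antiderivative_sin2 th a b h /\
    locally_given A F xi lambda p a b th la (fun u v =>
      (sin c)^-1 *: vec4 (sin (th u) * cosh v) (sin (th u) * sinh v)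
                         (la u) (sin c * h u)).
Proof.
move=> s0 k0 PP p; have s_n : sin c != 0 by rewrite gt_eqF.
have LN q : lambda q ^+ 2 + nu q ^+ 2 = cos c ^+ 2.
  by rewrite KE; have := cos2Dsin2 c; lra.
have n1 q : nu q < 1.
  have n_ge0 := ltW (nu_gt0 q); rewrite -(@expr_lt1 _ 2) //.
  have : 0 < sin c ^+ 2 by rewrite exprn_gt0.
  by have := LN q; have := cos2Dsin2 c; have := sqr_ge0 (lambda q); lra.
have nu01 q : 0 < nu q < 1 by rewrite nu_gt0 n1.
have [nn n0] := FH p.
have [a1 [a2 [a3 [b1 [b2 [b3 fr]]]]]] := frame_spacelike s0 PP nn n0.
have [Phi isoPhi hPhi] := frame_isometry 0 fr.
pose x1 q := tcoord a1 a2 a3 (F q); pose x2 q := scoord b1 b2 b3 (F q).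
have x3E q : scoord (- P1 / sin c) (- P2 / sin c) (- P3 / sin c) (F q) = lambda q / sin c.
  by rewrite /scoord lamE; field.
have x10 q : 0 < x1 q by have [[_ h] _ _ _ _] := hPhi _ (FH q).
have r0 q : 0 < S q / sin c by have [_ _ S0] := SP (n1 q); rewrite divr_gt0.
have x12 q : x1 q ^+ 2 - x2 q ^+ 2 = (S q / sin c) ^+ 2.
  have [[nq _] _ _ _ _] := hPhi _ (FH q); rewrite x3E -/(x1 q) -/(x2 q) in nq.
  have [_ S2 _] := SP (n1 q); rewrite expr_div_n S2.
  have -> : 1 - nu q ^+ 2 = sin c ^+ 2 + lambda q ^+ 2.
    by have := LN q; have := cos2Dsin2 c; lra.
  have -> : (sin c ^+ 2 + lambda q ^+ 2) / sin c ^+ 2 = 1 + (lambda q / sin c) ^+ 2 by field.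
  lra.
have xpm q : 0 < x1 q + x2 q /\ 0 < x1 q - x2 q.
  have x_ge0 := ltW (x10 q); have r2 : 0 < (S q / sin c) ^+ 2 by rewrite exprn_gt0.
  have : `|x2 q| < x1 q.
    rewrite -(@ltr_pXn2r _ 2) ?nnegrE // -normrX ger0_norm ?sqr_ge0 //.
    by have := x12 q; lra.
  by rewrite ltr_norml => /andP[]; split; lra.
pose u q := (pi / 2 + atan (lambda q / (nu q * sin c))) / sin c.
pose v q := ln ((x1 q + x2 q) / (x1 q - x2 q)) / 2.
have xE q : x1 q = S q / sin c * cosh (v q) /\ x2 q = S q / sin c * sinh (v q).
  exact: hyperbolic_polar (r0 q) (x10 q) (x12 q).
pose h1 t := - sin c * (cos (sin c * t) / sin (sin c * t)).
pose h t := h0 + atan (h1 t).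
have thP q : [/\ theta_iii c 1 (u q) = acos (nu q),
    lambda_of (theta_iii c 1) (u q) = lambda q,
    is_derive (u q) 1 h (sin (theta_iii c 1 (u q)) ^+ 2) & h (u q) = F q 0 i4].
  have [k1 k2 k3 k4] := theta_iii_formulas s0 k0 (nu01 q) (LN q).
  split=> //.
  - have := is_deriveD (is_derive_cst h0 (u q) 1) k3.
    by move/is_derive_eq; apply; rewrite add0r.
  - by rewrite /h [h1 _]k4 -hE.
have oT : open [set: M] by exact: openT.
have mslam' := mslam oT; have msnu' := msnu oT.
have msx1 : msmooth A setT x1 by exact: ms_tcoord.
have msx2 : msmooth A setT x2 by exact: ms_scoord.
have su : msmooth A setT u.
  apply: (msmooth_mul surfM) => //; last exact: msmooth_cst.
  apply: (msmooth_add surfM) => //; first exact: msmooth_cst.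
  apply: (msmooth_atan surfM) => //; apply: (msmooth_mul surfM) => //.
  apply: (msmooth_inv surfM) => //.
    by move=> q _; rewrite mulf_neq0 // gt_eqF // nu_gt0.
  by apply: (msmooth_mul surfM) => //; exact: msmooth_cst.
have sv : msmooth A setT v.
  apply: (msmooth_mul surfM) => //; last exact: msmooth_cst.
  apply: (msmooth_ln surfM) => //.
    by move=> q _; have [h1' h2'] := xpm q; rewrite divr_gt0.
  apply: (msmooth_mul surfM) => //; first exact: (msmooth_add surfM).
  apply: (msmooth_inv surfM) => //.
    by move=> q _; have [_ h2'] := xpm q; rewrite gt_eqF.
  by apply: (msmooth_add surfM) => //; exact: (msmooth_opp surfM).
have [|||a' [b' [hab lg]]] := @locally_given_of p setT u v h (theta_iii c 1)
  (lambda_of (theta_iii c 1)) (fun u v => (sin c)^-1 *: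
     vec4 (sin (theta_iii c 1 u) * cosh v) (sin (theta_iii c 1 u) * sinh v)
          (lambda_of (theta_iii c 1) u) (sin c * h u))
  (fun=> false) Phi oT I su sv (fun q _ => esym (let: And4 _ _ _ k := thP q in k)) _ _ isoPhi _.
- by have [_ _ [d _] _] := thP p.
- move=> y w X Ay cw wp fl fn fv.
  have fS : flat y w X (fun q => S q / sin c).
    by apply: flat_mul; [exact: flat_sin|exact: flat_cst].
  apply: (@frame_flat p setT a1 a2 a3 b1 b2 b3 (- P1 / sin c) (- P2 / sin c) (- P3 / sin c)
    x1 x2 (fun q => lambda q / sin c) oT I) => //.
  + by move=> q _; have [_ _] := hPhi _ (FH q); rewrite x3E.
  + rewrite (_ : x1 = fun q => S q / sin c * cosh (v q)).
      by apply: flat_mul => //; apply: flat_comp => //; exact: (derivable_cosh_sinh _).1.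
    by apply/funext => q; have [] := xE q.
  + rewrite (_ : x2 = fun q => S q / sin c * sinh (v q)).
      by apply: flat_mul => //; apply: flat_comp => //; exact: (derivable_cosh_sinh _).2.
    by apply/funext => q; have [] := xE q.
  + by apply: flat_mul => //; exact: flat_cst.
- move=> q _; have [k1 k2 _ k4] := thP q; have [sE _ _] := SP (n1 q).
  have GE : change_signs (fun=> false) ((sin c)^-1 *:
     vec4 (sin (theta_iii c 1 (u q)) * cosh (v q)) (sin (theta_iii c 1 (u q)) * sinh (v q))
          (lambda_of (theta_iii c 1) (u q)) (sin c * h (u q))) =
      vec4 (x1 q) (x2 q) (lambda q / sin c) (F q 0 i4 - 0).
    rewrite no_change_signs scale_vec4 k1 -angleE sE k2 k4 subr0.
    by have [-> ->] := xE q; congr vec4; field.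
  have [[nq nq0] FE _ _ _] := hPhi _ (FH q); rewrite x3E in nq FE.
  split; [by rewrite angleE k1|by rewrite k2| |].
    by rewrite GE /H2R /=; have [-> -> -> _] :=
      vec4E (x1 q) (x2 q) (lambda q / sin c) (F q 0 i4 - 0).
  by rewrite GE FE.
exists a', b', h; split; last exact: lg.
by move=> t /hab[q _ <-]; have [_ _ k _] := thP q.
Qed.

End Classification.

Unset Implicit Arguments.

Theorem theorem7 (R : realType) (M : topologicalType) (A : set (chart R M))
    (F xi : M -> 'rV[R]_4) (lambda : M -> R)
    (surfM : smooth_surface A) (connM : connected [set: M])
    (immF : isometric_immersion A F)
    (normal_xi : unit_normal A F xi)
    (angle_le : forall p, 0 <= angle xi p <= pi / 2)
    (umbF : totally_umbilical A F xi lambda)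
    (not_geodesic : ~ (forall p, lambda p = 0)) :
  dense [set p | angle xi p != 0] /\
  [\/ exists c e : R, [/\ 0 < c, is_sign e &
        forall p, angle xi p != 0 ->
        exists (a b : R) (h : R -> R),
          let th := theta_i c e in
          let la := lambda_of th in
          antiderivative_sin2 th a b h /\
          locally_given A F xi lambda p a b th la (fun u v =>
            c^-1 *: vec4 (la u) (sin (th u) * cos v) (sin (th u) * sin v)
                         (c * h u))],
      exists e : R, is_sign e /\
        forall p, angle xi p != 0 ->
        exists a b : R,
          locally_given A F xi lambda p a b (theta_ii e) (lambda_ii e)
            (fun u v =>
            (Num.sqrt (1 + u ^+ 2))^-1 *:
              vec4 ((u ^+ 2 + v ^+ 2) / 2 + 1) v ((u ^+ 2 + v ^+ 2) / 2)
                   (Num.sqrt (1 + u ^+ 2) * atan u)) |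
      exists c e : R, [/\ sin c != 0, cos c != 0, is_sign e &
        forall p, angle xi p != 0 ->
        exists (a b : R) (h : R -> R),
          let th := theta_iii c e in
          let la := lambda_of th in
          antiderivative_sin2 th a b h /\
          locally_given A F xi lambda p a b th la (fun u v =>
            (sin c)^-1 *: vec4 (sin (th u) * cosh v) (sin (th u) * sinh v)
                               (la u) (sin c * h u))]].
Proof.
split; first exact: (angle_neq0_dense surfM connM immF normal_xi umbF not_geodesic).
have [P1 [P2 [P3 [h0 [P0 lamE KE hE]]]]] :=
  surface_moment surfM connM immF normal_xi angle_le umbF not_geodesic.
have sign1 (b : bool) : is_sign (if b then 1 : R else -1).
  by case: b; [left|right].
have sqr_sign1 (b : bool) : (if b then 1 : R else -1) ^+ 2 = 1.
  by case: b; rewrite ?sqrrN expr1n.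
have sign_mul : P1 != 0 -> 0 < (if 0 < P1 then 1 else -1) * P1.
  move=> n1; case: (ltP 0 P1) => p1; first by rewrite mul1r.
  by rewrite mulN1r oppr_gt0 lt_neqAle n1.
(* This quantity is - <P, P>: it is negative, positive or zero as P is spacelike, timelike or
   lightlike. *)
case: (ltgtP (P1 ^+ 2 - P2 ^+ 2 - P3 ^+ 2) 0) => D0.
- apply: Or33.
  have [p lp] : exists p, lambda p != 0.
    apply: contrapT => nlp; apply: not_geodesic => p; apply: contrapT => lp.
    by apply: nlp; exists p; exact/eqP.
  have K0 : 0 < 1 + P1 ^+ 2 - P2 ^+ 2 - P3 ^+ 2.
    by rewrite -(KE p) ltr_pwDl ?sqr_ge0 // exprn_even_gt0.
  (* This is cos c, because sin^2 c has to be <P, P>; hence c = [acos k]. *)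
  pose k := Num.sqrt (1 + P1 ^+ 2 - P2 ^+ 2 - P3 ^+ 2).
  have k2 : k ^+ 2 = 1 + P1 ^+ 2 - P2 ^+ 2 - P3 ^+ 2 by rewrite sqr_sqrtr // ltW.
  have k0 : 0 < k by rewrite sqrtr_gt0.
  have k1 : k < 1.
    by have k_ge0 := ltW k0; rewrite -(@expr_lt1 _ 2) // k2; lra.
  have cE : cos (acos k) = k by apply: acosK; rewrite in_itv /=; lra.
  have sE : sin (acos k) = Num.sqrt (1 - k ^+ 2) by apply: sin_acos; lra.
  have s0 : 0 < sin (acos k) by rewrite sE sqrtr_gt0 k2; lra.
  have s2 : - P1 ^+ 2 + P2 ^+ 2 + P3 ^+ 2 = sin (acos k) ^+ 2.
    by have := cos2Dsin2 (acos k); rewrite cE k2; lra.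
  have c0 : 0 < cos (acos k) by rewrite cE.
  exists (acos k), 1; split; [by rewrite gt_eqF|by rewrite gt_eqF|by left|].
  move=> q _; exact: (case_spacelike surfM connM immF normal_xi angle_le umbF
    not_geodesic lamE KE hE s0 c0 s2 q).
- apply: Or31; pose c := Num.sqrt (P1 ^+ 2 - P2 ^+ 2 - P3 ^+ 2).
  have c0 : 0 < c by rewrite sqrtr_gt0.
  have c2 : P1 ^+ 2 - P2 ^+ 2 - P3 ^+ 2 = c ^+ 2 by rewrite sqr_sqrtr // ltW.
  have n1 : P1 != 0.
    apply: contraTneq D0 => ->; rewrite -leNgt expr0n /=.
    by have := sqr_ge0 P2; have := sqr_ge0 P3; lra.
  exists c, (if 0 < P1 then 1 else -1); split; [exact: c0|exact: sign1|].
  move=> p ap; exact: (case_timelike surfM connM immF normal_xi angle_le umbF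
    not_geodesic lamE KE hE c0 (sqr_sign1 _) c2 (sign_mul n1) ap).
- apply: Or32; have n1 : P1 != 0.
    apply/eqP => z1; move: D0; rewrite z1 expr0n /= => D0.
    have p2 := sqr_ge0 P2; have p3 := sqr_ge0 P3.
    have /eqP : P2 ^+ 2 = 0 by lra.
    have /eqP : P3 ^+ 2 = 0 by lra.
    rewrite !sqrf_eq0 => /eqP z3 /eqP z2.
    by move: P0; rewrite z1 z2 z3 eqxx => -[|[]].
  (* In case (ii) the formula gives lambda the sign opposite to [e], while lambda has the sign of
     [P1]; hence the sign is reversed here. *)
  have e0 : 0 < - ((- (if 0 < P1 then 1 else -1)) * P1).
    by rewrite mulNr opprK; exact: sign_mul.
  have e2 : (- (if 0 < P1 then 1 : R else -1)) ^+ 2 = 1 by rewrite sqrrN sqr_sign1.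
  exists (- (if 0 < P1 then 1 else -1)); split.
    by case: ifP => _; rewrite ?opprK; [right|left].
  move=> p _; exact: (case_lightlike surfM connM immF normal_xi angle_le umbF
    not_geodesic lamE KE hE e2 D0 e0 p).
Qed.
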